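(* Let $n\ge 2$, let $\Omega\subset\mathbb{R}^n$ be a bounded open set, let $p_k>1$ and $q_k\in(p_k,+\infty)$ for $k=1,\dots,n$, and suppose $\overline p<n$. Let $0\le h\in L^{\tau}(\Omega)$ with $\tau=\max_{k=1,\dots,n}\frac{q_k}{p_k}$, and let $a_i:\Omega\times\mathbb{R}^n\to\mathbb{R}$, $i=1,\dots,n$, be Carathéodory functions for which there are constants $c_1>0$ and $\tilde\nu\in(0,+\infty)$ such that, for almost every $x\in\Omega$ and all $z,\tilde z\in\mathbb{R}^n$, $$|a_i(x,z)|\le c_1\Big(h(x)+\sum_{j=1}^n|z_j|^{p_j}\Big)^{1-1/p_i}\quad (i=1,\dots,n),$$ $$\tilde\nu\sum_{i=1}^n|z_i-\tilde z_i|^{p_i}\le\sum_{i=1}^n\big(a_i(x,z)-a_i(x,\tilde z)\big)(z_i-\tilde z_i).$$ Let $\theta\in W^{1,(q_k)}(\Omega)$ and let $\psi:\Omega\to[-\infty,+\infty]$ be such that $\theta_*=\max\{\psi,\theta\}\in\theta+W_0^{1,(q_k)}(\Omega)$. Let $b$ be any number satisfying $$0<b\le\min_{j=1,\dots,n}\Big(1-\frac{p_j}{q_j}\Big)\min_{i=1,\dots,n}\Big(1-\frac1{p_i}\Big)\quad\text{and}\quad b<\frac{p_m-1}{p_m}\,\frac{\overline p}{\overline p^*},$$ and suppose $f^i\in L^{p_i/(p_i-1-bp_i)}(\Omega)$ for $i=1,\dots,n$. Then every solution $u\in\mathcal{K}_{\psi,\theta}^{(p_k)}(\Omega)$ to the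 $\mathcal{K}_{\psi,\theta}^{(p_k)}$-obstacle problem (for the functions $a_i$ and $f^i$) satisfies $$u\in\theta_*+L^t_{weak}(\Omega),\qquad\text{where}\quad t=\frac{\overline p^*}{1-\frac{b\,\overline p^*}{\overline p}\,\frac{p_m}{p_m-1}}>\overline p^*.$$
   Context: Notation: $p_m=\max_{k=1,\dots,n}p_k$; $\overline p$ is the harmonic mean of the $p_k$, i.e. $\frac1{\overline p}=\frac1n\sum_{k=1}^n\frac1{p_k}$; for $\overline p<n$, $\overline p^*=\frac{n\overline p}{n-\overline p}$ is the Sobolev exponent of $\overline p$. $D_k v=\partial v/\partial x_k$ denotes the weak partial derivative and $Du=(D_1u,\dots,D_nu)$. For exponents $r_k>1$, $k=1,\dots,n$, the anisotropic Sobolev spaces are $W^{1,(r_k)}(\Omega)=\{v\in W^{1,1}(\Omega): D_kv\in L^{r_k}(\Omega)\text{ for every }k=1,\dots,n\}$ and $W_0^{1,(r_k)}(\Omega)=\{v\in W_0^{1,1}(\Omega): D_kv\in L^{r_k}(\Omega)\text{ for every }k=1,\dots,n\}$. For $t>0$, the weak Lebesgue (Marcinkiewicz) space $L^t_{weak}(\Omega)$ consists of all measurable functions $f$ on $\Omega$ for which there is a positive constant $k=k(f)$ with $|\{x\in\Omega:|f(x)|>\tau\}|\le k/\tau^t$ for every $\tau>0$, where $|E|$ is the $n$-dimensional Lebesgue measure of $E$. For $\psi:\Omega\to\mathbb{R}\cup\{\pm\infty\}$ (the obstacle) and $\theta\in W^{1,(p_k)}(\Omega)$ (the boundary datum), set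 $\mathcal{K}_{\psi,\theta}^{(p_k)}(\Omega)=\{v\in W^{1,(p_k)}(\Omega): v\ge\psi\text{ a.e. and }v\in\theta+W_0^{1,(p_k)}(\Omega)\}$. A solution to the $\mathcal{K}_{\psi,\theta}^{(p_k)}$-obstacle problem (for the equation $\sum_{i=1}^nD_i(a_i(x,Du(x)))=\sum_{i=1}^nD_if^i(x)$) is a function $u\in\mathcal{K}_{\psi,\theta}^{(p_k)}(\Omega)$ such that $$\int_\Omega\sum_{i=1}^na_i(x,Du(x))(D_iv(x)-D_iu(x))\,dx\ge\int_\Omega\sum_{i=1}^nf^i(x)(D_iv(x)-D_iu(x))\,dx$$ for every $v\in\mathcal{K}_{\psi,\theta}^{(p_k)}(\Omega)$. *)

(* Defs.v *)
From HB Require Import structures.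
From mathcomp Require Import all_boot all_order all_algebra.
From mathcomp Require Import all_classical all_reals all_analysis.

Set Implicit Arguments.
Unset Strict Implicit.
Unset Printing Implicit Defensive.

Import Order.TTheory GRing.Theory Num.Theory.
Import numFieldNormedType.Exports.

Local Open Scope classical_set_scope.
Local Open Scope ring_scope.

(* The library has Lebesgue measure on R only.  On R^n = 'rV[R]_n we take the
   product sigma-algebra generated by the coordinates (the Borel sets), build
   the n-fold product of the one-dimensional measure by recursion on n, and
   complete it by Caratheodory's construction, so that measurable sets and
   functions are the Lebesgue-measurable ones. *)

Definition borel_rV (R : realType) (n : nat) : Type := 'rV[R]_n.

Section borel_rV.
Context {R : realType} (n : nat).

Let coord (i : 'I_n) (x : borel_rV R n) : R := (x : 'rV[R]_n) ord0 i.

HB.instance Definition _ := Pointed.copy (borel_rV R n) 'rV[R]_n.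
HB.instance Definition _ := @isMeasurable.Build default_measure_display
  (borel_rV R n) (g_sigma_preimage coord)
  (@sigma_algebra0 _ _ _) (fun A => @sigma_algebraC _ _ A)
  (@sigma_algebra_bigcup _ _ _).

End borel_rV.

Definition rV_cons (R : realType) (n : nat) (p : borel_rV R n * measurableTypeR R) :
  borel_rV R n.+1 := row_mx (p.2 : R)%:M (p.1 : 'rV[R]_n).

Lemma measurable_rV_cons (R : realType) (n : nat) :
  measurable_fun [set: borel_rV R n * measurableTypeR R] (@rV_cons R n).
Proof.
pose C : set (set (borel_rV R n.+1)) := \big[setU/set0]_(i < n.+1)
  preimage_set_system setT (fun x : 'rV[R]_n.+1 => x ord0 i) measurable.
apply: (@measurability _ _ _ _ _ _ C) => // _ [A + <-].
rewrite /C -bigcup_seq => -[i _ [B mB <-]].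
rewrite !setTI -comp_preimage.
case: (split_ordP (i : 'I_(1 + n))) => j ->.
- rewrite (_ : _ \o _ = snd).
    by rewrite -[X in measurable X]setTI; exact: measurable_snd.
  apply/funext => -[v x] /=.
  by rewrite /rV_cons (@row_mxEl _ 1 1 n) !mxE (ord1 j) mulr1n.
- rewrite (_ : _ \o _ = (fun v : borel_rV R n => (v : 'rV[R]_n) ord0 j) \o fst).
    rewrite comp_preimage -[X in measurable X]setTI.
    apply: measurable_fst => //.
    apply: sub_sigma_algebra; rewrite -bigcup_seq.
    by exists j; [rewrite /= mem_index_enum | exists B; rewrite // setTI].
  apply/funext => -[v x] /=.
  by rewrite /rV_cons (@row_mxEr _ 1 1 n).
Qed.

HB.instance Definition _ (R : realType) (n : nat) :=
  @isMeasurableFun.Build _ _ _ _ (@rV_cons R n) (@measurable_rV_cons R n).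

Section image_measure.
Context d d' (T : measurableType d) (T' : measurableType d') (R : realType).
Variables (mu : {measure set T -> \bar R}) (f : {mfun T >-> T'}).
Local Open Scope ereal_scope.

Definition image_measure : set T' -> \bar R := pushforward mu f.

Let image_measure0 : image_measure set0 = 0.
Proof. exact: measure0. Qed.

Let image_measure_ge0 A : 0 <= image_measure A.
Proof. exact: measure_ge0. Qed.

Let image_measure_sigma_additive : semi_sigma_additive image_measure.
Proof. exact: measure_semi_sigma_additive. Qed.

HB.instance Definition _ := isMeasure.Build _ _ _ image_measure
  image_measure0 image_measure_ge0 image_measure_sigma_additive.

End image_measure.

Fixpoint borel_lebesgue (R : realType) (n : nat) :
    {measure set (borel_rV R n) -> \bar R} :=
  if n is m.+1 then
    image_measure (borel_lebesgue R m \x lebesgue_measure)%E (@rV_cons R m)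
  else \d_ ((0 : 'rV[R]_0) : borel_rV R 0).

(* 'rV[R]_n with its Lebesgue sigma-algebra *)
Definition leb_rV (R : realType) (n : nat) :=
  caratheodory_type ((borel_lebesgue R n)^*)%mu.

Definition leb (R : realType) (n : nat) : {measure set (leb_rV R n) -> \bar R} :=
  @completed_measure_extension _ _ _ (borel_lebesgue R n).

Section sobolev.
Context {R : realType} {n : nat}.
Local Notation Rn := 'rV[R]_n.
Local Notation mu := (leb R n).
Variable Omega : set Rn.

(* A function on Omega is represented by a total function on R^n; only its
   restriction to Omega matters below. *)

Definition meas_on (f : Rn -> R) : Prop :=
  measurable_fun (Omega : set (leb_rV R n)) (f : leb_rV R n -> R).

Definition Lp (r : R) : set (Rn -> R) :=
  [set f | (f \_ Omega : leb_rV R n -> R) \in Lfun mu r%:E].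

Definition weak_Lp (t : R) : set (Rn -> R) :=
  [set f | meas_on f /\
    exists2 k : R, 0 < k & forall s : R, 0 < s ->
      (mu [set x | Omega x /\ (s < `|f x|)%R] <= (k / s `^ t)%:E)%E].

Definition partial (k : 'I_n) (f : Rn -> R) : Rn -> R :=
  fun x => 'D_(delta_mx ord0 k : Rn) f x.

(* All iterated partial derivatives exist everywhere and are continuous. *)
Definition smooth (f : Rn -> R) : Prop :=
  forall s : seq 'I_n, continuous (foldr partial f s) /\
    forall (k : 'I_n) (x : Rn),
      derivable (foldr partial f s) x (delta_mx ord0 k : Rn).

Definition test_fun : set (Rn -> R) :=
  [set phi | [/\ smooth phi,
    compact (closure [set x | phi x != 0]) &
    closure [set x | phi x != 0] `<=` Omega]].

Definition is_weak_partial (k : 'I_n) (v g : Rn -> R) : Prop :=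
  forall phi, test_fun phi ->
    \int[mu]_(x in Omega) (v x * partial k phi x) =
    - \int[mu]_(x in Omega) (g x * phi x).

(* A choice of the weak partial derivative D_k v, unique up to a null set; it
   is the constant 0 when v has no weak partial derivative in L^1. *)
Definition wD (k : 'I_n) (v : Rn -> R) : Rn -> R :=
  xget (cst 0) [set g | Lp 1 g /\ is_weak_partial k v g].

Definition wgrad (v : Rn -> R) (x : Rn) : Rn := \row_k wD k v x.

Definition W11 : set (Rn -> R) :=
  [set v | Lp 1 v /\ forall k, exists2 g, Lp 1 g & is_weak_partial k v g].

Definition W11_norm (v : Rn -> R) : \bar R :=
  (\int[mu]_(x in Omega) `|v x|%:E +
   \sum_(k < n) \int[mu]_(x in Omega) `|wD k v x|%:E)%E.

(* the closure of the test functions in W^{1,1} *)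
Definition W11_0 : set (Rn -> R) :=
  [set v | W11 v /\ exists2 phi : nat -> Rn -> R, forall j, test_fun (phi j) &
    W11_norm (fun x => phi j x - v x) @[j --> \oo] --> 0%E].

Definition W1 (r : 'I_n -> R) : set (Rn -> R) :=
  [set v | W11 v /\ forall k, Lp (r k) (wD k v)].

Definition W1_0 (r : 'I_n -> R) : set (Rn -> R) :=
  [set v | W11_0 v /\ forall k, Lp (r k) (wD k v)].

(* f \in g + V, with equality a.e. in Omega; f and g may take infinite
   values. *)
Definition in_translate (f g : Rn -> \bar R) (V : set (Rn -> R)) : Prop :=
  exists2 w, V w &
    {ae mu, forall x, Omega x -> f x = (g x + (w x)%:E)%E}.

Definition obstacle_class (p : 'I_n -> R) (psi : Rn -> \bar R)
    (theta : Rn -> R) : set (Rn -> R) :=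
  [set v | [/\ W1 p v,
    {ae mu, forall x, Omega x -> (psi x <= (v x)%:E)%E} &
    in_translate (EFin \o v) (EFin \o theta) (W1_0 p)]].

Definition obstacle_solution (p : 'I_n -> R) (a : 'I_n -> Rn -> Rn -> R)
    (f : 'I_n -> Rn -> R) (psi : Rn -> \bar R) (theta u : Rn -> R) : Prop :=
  obstacle_class p psi theta u /\
  forall v, obstacle_class p psi theta v ->
    \int[mu]_(x in Omega) (\sum_(i < n) a i x (wgrad u x) * (wD i v x - wD i u x))
    >= \int[mu]_(x in Omega) (\sum_(i < n) f i x * (wD i v x - wD i u x)).

Definition caratheodory_fun (a : Rn -> Rn -> R) : Prop :=
  (forall z, meas_on (fun x => a x z)) /\
  {ae mu, forall x, Omega x -> continuous (a x)}.

End sobolev.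

Section exponents.
Context {R : realType} {n : nat}.

Definition hmean (p : 'I_n -> R) : R := (n%:R^-1 * \sum_(k < n) (p k)^-1)^-1.

Definition sobolev_exp (r : R) : R := n%:R * r / (n%:R - r).

(* Used only for positive families, resp. families with values below 1, where
   the default value is neutral. *)
Definition fam_max (p : 'I_n -> R) : R := \big[Num.max/0]_(k < n) p k.

Definition fam_min (p : 'I_n -> R) : R := \big[Num.min/1]_(k < n) p k.

End exponents.
Arguments sobolev_exp {R} n r.

(* Main.v *)
Require Import Defs.
From HB Require Import structures.
From mathcomp Require Import all_boot all_order all_algebra.
From mathcomp Require Import all_classical all_reals all_analysis measurable_realfun.
From mathcomp Require Import ring lra.
Import Order.TTheory GRing.Theory Num.Theory.
Import numFieldNormedType.Exports.
Set Implicit Arguments.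
Unset Strict Implicit.
Unset Printing Implicit Defensive.
Local Open Scope classical_set_scope.
Local Open Scope ring_scope.

(** Let w = u - theta_star be the excess of the solution over the boundary
datum; it lies in W^{1,1}_0 and D_i w lies in L^{p_i}.  The theorem says that
phi(L) = |{|w| > L}| decays like L^{-t}, and this follows from an inequality
between phi(4L) and phi(L), which combines an energy estimate with a Sobolev
estimate.

Energy.  Let T_L be a smooth nondecreasing function that vanishes on [-L, L] and
satisfies 0 <= T_L(s) / s <= 1 ([trunc]).  The function v = u - T_L(w) lies
between u and theta_star, hence above the obstacle, and is a competitor in the
variational inequality.  In the resulting inequality, monotonicity
is used between Du and D theta_star, and the growth condition and Young's
inequality absorb the remaining terms:
    int T_L'(w) sum_i |D_i w|^{p_i} <= C int T_L'(w) F,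
    F = |h| + sum_j |D_j theta_star|^{p_j} + sum_i |f^i|^{p_i / (p_i - 1)}
([obstacle_energy]).  Put kappa = b p_m / (p_m - 1).  The first
bound on b and the integrability of theta_star, h and the f^i place F in
L^{1 / (1 - kappa)}, so Hoelder's inequality on the set {|w| > L}, outside of
which T_L'(w) vanishes, gives
    int_{|w| > 2L} sum_i |D_i w|^{p_i} <= C phi(L)^kappa
([tail_energy_le]).

Sobolev.  For n functions v_i in W^{1,1}_0, Gagliardo's inequality reads
    int prod_i |v_i|^{1 / (n - 1)} <= prod_i (int |D_i v_i|)^{1 / (n - 1)}
([W11_0_gagliardo]).  The anisotropy enters through the choice of n different
functions, the powers v_i = H^{g_i} of one cutoff H of w at the level L, with
g_i = 1 + pstar (1 - 1 / p_i).  These exponents make the left side equal to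
X = int H^pstar, and make Hoelder's inequality for int |D_i v_i| produce the
same X, which can then be divided out ([cutoff_mass_le]):
    phi(2L) <= C X <= C L^{-pstar} (int_{|w| > L} sum_i |D_i w|^{p_i})^{pstar / pbar}.

Together, phi(4L) <= C L^{-pstar} phi(L)^beta with beta = kappa pstar / pbar,
and the second bound on b is exactly beta < 1.  For such an inequality
L^t phi(L), with t = pstar / (1 - beta), stays bounded along L, 4L, 16L, ...
([decay_iteration]), which is the claim.

All cutoffs are built from exp (-1 / x), so that composing a test function
with one of them gives a test function.  The chain rule in W^{1,1}_0
([W11_0_comp]) is therefore a limit of the classical chain rule along the test
functions that approximate w.  Gagliardo's inequality and integration by
parts for test functions are proved on coordinate lines, by Tonelli's theorem
and induction on the dimension; weak derivatives are unique because an
integrable function that annihilates smooth bumps on boxes vanishes almost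
everywhere ([du_bois_reymond]). *)

(** * Smooth functions built from exp (-1 / x) *)
Section flat.
Context {R : realType}.

(** The powers of 1 / x in front of exp (-1 / x) make the family closed under
differentiation, see [is_derive_flat]. *)
Definition flat (m : nat) (x : R) : R :=
  if 0 < x then x^-1 ^+ m * expR (- x^-1) else 0.

Lemma flat_ge0 m x : 0 <= flat m x.
Proof.
rewrite /flat; case: ifPn => // x0.
by rewrite mulr_ge0 ?expR_ge0// exprn_ge0// invr_ge0 ltW.
Qed.

(** The exponential beats x^{-m}; a quadratic bound is what differentiability
at 0 requires. *)
Lemma flat_le m x : flat m x <= (m.+2)`!%:R * x ^+ 2.
Proof.
rewrite /flat; case: ifPn => [x0|_]; last by rewrite mulr_ge0// sqr_ge0.
have y0 : 0 <= x^-1 by rewrite invr_ge0 ltW.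
have h := expR_ge1Dxn m.+1 y0.
rewrite expRN ler_pdivrMr ?expR_gt0//.
have {h} : x^-1 ^+ m.+2 <= (m.+2)`!%:R * expR x^-1.
  rewrite mulrC -ler_pdivrMr ?ltr0n ?fact_gt0//.
  by apply: le_trans h; rewrite lerDr.
rewrite exprS exprS -(@ler_pM2l _ (x ^+ 2)) ?exprn_gt0// !mulrA.
rewrite expr2 -!mulrA (mulrA _^-1) (mulrA x).
rewrite (_ : x * x * (x^-1 / x * x^-1 ^+ m) = x^-1 ^+ m); last first.
  by field; rewrite gt_eqF.
by move=> /le_trans; apply; rewrite le_eqVlt; apply/orP; left; apply/eqP; ring.
Qed.

Lemma is_derive_flat m (x : R) :
  is_derive x 1 (flat m) (- m%:R * flat m.+1 x + flat m.+2 x).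
Proof.
case: (ltgtP x 0) => [x0|x0|->].
- have -> : - m%:R * flat m.+1 x + flat m.+2 x = 0.
    by rewrite /flat (lt_gtF x0) mulr0 addr0.
  apply: (@near_eq_is_derive _ _ _ (cst 0)).
  near=> y; rewrite /flat lt_gtF//; near: y; exact: lt_nbhsl.
- have xn0 : x != 0 by rewrite gt_eqF.
  have dV : is_derive x 1 (fun y : R => y^-1) (- x ^- 2).
    by have := @is_deriveV R id x 1 1 xn0 _; rewrite -[_ *: 1]/(_ * 1) mulr1; apply.
  have dX := @is_deriveX _ _ _ m _ _ _ dV.
  have dE : is_derive x 1 (fun y : R => expR (- y^-1)) (expR (- x^-1) * (x ^- 2)).
    apply: (@is_derive1_comp _ expR (fun y : R => - y^-1)).
    by rewrite -[X in is_derive _ _ _ X]opprK; exact: is_deriveN.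
  have := @is_deriveM _ _ _ _ _ _ _ _ dX dE.
  set D := _ + _ => hD.
  suff -> : - m%:R * flat m.+1 x + flat m.+2 x = D.
    apply: near_eq_is_derive hD.
    near=> y; rewrite fctE /flat ifT ?fctE ?exprfctE//; near: y; exact: lt_nbhsr.
  rewrite /flat x0 /D /GRing.scale /= fctE !exprVn.
  case: m {dX hD D} => [|m] /=; rewrite ?oppr0 ?mul0r ?add0r.
    by rewrite expr0 invr1 mulr0 addr0 mulrC; ring.
  by rewrite !exprS; field; rewrite xn0 expf_neq0.
(* At 0 the difference quotient is bounded by a multiple of |h|. *)
- have f0 k : flat k (0 : R) = 0 by rewrite /flat ltxx.
  rewrite !f0 mulr0 addr0.
  have : h^-1 *: ((flat m \o shift 0) (h *: (1:R)) - flat m 0) @[h --> (0:R)^'] --> (0:R).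
    apply/cvgrPdist_le => e e0; near=> h.
    have h0 : h != 0 by near: h; exact: nbhs_dnbhs_neq.
    rewrite sub0r normrN f0 subr0 /= /GRing.scale /= mulr1 addr0 normrM normfV.
    rewrite (ger0_norm (flat_ge0 _ _)) ler_pdivrMl ?normr_gt0//.
    apply: (le_trans (flat_le _ _)); rewrite -real_normK ?num_real// expr2 mulrA mulrC.
    rewrite ler_pM2l ?normr_gt0// -ler_pdivlMl ?ltr0n ?fact_gt0//.
    near: h; apply: dnbhs0_le; rewrite mulr_gt0// invr_gt0 ltr0n fact_gt0//.
  move=> c; apply: DeriveDef; first by apply/cvg_ex; exists 0.
  exact: cvg_lim.
Unshelve. all: end_near. Qed.

Lemma continuous_flat m : continuous (flat m).
Proof.
move=> x; apply/differentiable_continuous/derivable1_diffP.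
by have [] := is_derive_flat m x.
Qed.

End flat.

Section smooth_alg.
Context {R : realType} {n : nat}.
Local Notation Rn := 'rV[R]_n.

(** Smoothness speaks of all iterated partial derivatives, and is easiest to
prove for a whole class of expressions that contains the partial derivatives
of its members: then one differentiation suffices ([smooth_alg_partial]). *)
Inductive smooth_alg : (Rn -> R) -> Prop :=
| alg_smooth f of smooth f : smooth_alg f
| alg_cst c : smooth_alg (fun=> c)
| alg_coord i : smooth_alg (fun x => x ord0 i)
| alg_add f g of smooth_alg f & smooth_alg g : smooth_alg (fun x => f x + g x)
| alg_mul f g of smooth_alg f & smooth_alg g : smooth_alg (fun x => f x * g x)
| alg_flat m f of smooth_alg f : smooth_alg (fun x => flat m (f x)).

Lemma smooth_partial k (f : Rn -> R) : smooth f -> smooth (partial k f).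
Proof.
move=> sf s; have := sf (rcons s k).
by rewrite -cats1 foldr_cat.
Qed.

(** Only the derivative of f along v has to exist: on the line through x the
statement is the one-variable chain rule. *)
Lemma is_derive_comp_line (V : normedModType R) (G : R -> R) (f : V -> R) (x v : V) (dG df : R) :
  is_derive (f x) 1 G dG -> is_derive x v f df ->
  is_derive x v (fun y => G (f y)) (dG * df).
Proof.
move=> dGf dff.
have line (g : V -> R) d : is_derive x v g d <->
    is_derive (0:R) 1 (fun t : R => g (t *: v + x)) d.
  have E : (fun h : R => h^-1 *: ((g \o shift x) (h *: v) - g x)) =
     (fun h : R => h^-1 *: (((fun t : R => g (t *: v + x)) \o shift 0) (h *: (1:R)) - g (0 *: v + x))).
    by apply/funext => h /=; rewrite scale0r add0r addr0 /GRing.scale/= mulr1.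
  split=> -[h1 h2]; apply: DeriveDef.
  - by move: h1; rewrite /derivable E.
  - by move: h2; rewrite /derive E.
  - by rewrite /derivable E.
  - by rewrite /derive E.
apply/line; apply: (@is_derive1_comp _ G (fun t : R => f (t *: v + x))).
  by rewrite scale0r add0r.
exact/line.
Qed.

Lemma smooth_alg_partial f : smooth_alg f -> continuous f /\
  forall k, (forall x, derivable f x (delta_mx ord0 k : Rn)) /\ smooth_alg (partial k f).
Proof.
elim => {f} [f sf|c|i|f g _ [cf df] _ [cg dg]|f g af [cf df] ag [cg dg]|m f af [cf df]].
- split; first exact: (sf [::]).1.
  move=> k; split; first by move=> x; exact: (sf [::]).2.
  exact/alg_smooth/smooth_partial.
- split; first exact: cst_continuous.
  move=> k; split=> [x|]; first exact: derivable_cst.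
  by rewrite (_ : partial k _ = fun=> 0); [exact: alg_cst|apply/funext => x; exact: derive_cst].
- have d k x : is_derive x (delta_mx ord0 k : Rn) (fun x : Rn => x ord0 i) ((i == k)%:R).
    have E : (fun h : R => h^-1 *: (((fun x : Rn => x ord0 i) \o shift x) (h *: (delta_mx ord0 k : Rn)) - x ord0 i)) @ 0^' --> ((i == k)%:R : R).
      apply: cvg_near_cst; near=> h.
      have h0 : h != 0 by near: h; exact: nbhs_dnbhs_neq.
      rewrite /= !mxE /= addrK /GRing.scale /= mulrA mulVf// mul1r//.
    apply: DeriveDef; first by apply/cvg_ex; eexists; exact: E.
    exact: cvg_lim.
  split; first exact: coord_continuous.
  move=> k; split=> [x|]; first by have [] := d k x.
  rewrite (_ : partial k _ = fun=> (i == k)%:R); first exact: alg_cst.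
  by apply/funext => x; have [] := d k x.
- split=> [x|k]; first exact: (cvgD (cf x) (cg x)).
  split=> [x|]; first exact: derivableD (proj1 (df k) x) (proj1 (dg k) x).
  rewrite (_ : partial k _ = fun x => partial k f x + partial k g x).
    by apply: alg_add; [exact: (df k).2|exact: (dg k).2].
  by apply/funext => x; exact: deriveD (proj1 (df k) x) (proj1 (dg k) x).
- split=> [x|k]; first exact: (cvgM (cf x) (cg x)).
  split=> [x|]; first exact: derivableM (proj1 (df k) x) (proj1 (dg k) x).
  rewrite (_ : partial k _ = fun x => f x * partial k g x + g x * partial k f x).
    by apply: alg_add; apply: alg_mul => //; [exact: (dg k).2|exact: (df k).2].
  by apply/funext => x; exact: deriveM (proj1 (df k) x) (proj1 (dg k) x).
- have d k x := is_derive_comp_line (is_derive_flat m (f x)) (derivableP (proj1 (df k) x)).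
  split=> [x|k]; first by apply: continuous_comp; [exact: cf|exact: continuous_flat].
  split=> [x|]; first by have [] := d k x.
  rewrite (_ : partial k _ = fun x => (- m%:R * flat m.+1 (f x) + flat m.+2 (f x)) * partial k f x).
    apply: alg_mul; last exact: (df k).2.
    by apply: alg_add; [apply: alg_mul; [exact: alg_cst|exact: alg_flat]|exact: alg_flat].
  by apply/funext => x; have [] := d k x.
Unshelve. all: end_near. Qed.

Lemma smooth_alg_smooth f : smooth_alg f -> smooth f.
Proof.
move=> af s.
have as_ : smooth_alg (foldr partial f s).
  by elim: s => //= k s; move/smooth_alg_partial => -[_ /(_ k)[]].
have [cs ds] := smooth_alg_partial as_.
by split => // k x; exact: (ds k).1.
Qed.

Lemma smooth_alg_prod (I : Type) (r : seq I) (F : I -> Rn -> R) :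
  (forall i, smooth_alg (F i)) -> smooth_alg (fun x => \prod_(i <- r) F i x).
Proof.
move=> aF; elim: r => [|i r IH].
  rewrite (_ : (fun _ => _) = fun=> 1); first exact: alg_cst.
  by apply/funext => x; rewrite big_nil.
rewrite (_ : (fun _ => _) = fun x => F i x * \prod_(i <- r) F i x); first exact: alg_mul.
by apply/funext => x; rewrite big_cons.
Qed.

End smooth_alg.

(** * Test functions and bumps on boxes *)
Section test_functions.
Context {R : realType} {n : nat}.
Local Notation Rn := 'rV[R]_n.
Implicit Types (phi f g : Rn -> R) (Omega : set Rn).

Lemma smooth_continuous f : smooth f -> continuous f.
Proof. by move=> /(_ [::])[]. Qed.

Lemma smooth_derivable f k x : smooth f -> derivable f x (delta_mx ord0 k : Rn).
Proof. by move=> /(_ [::])[_]. Qed.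

Lemma smoothM f g : smooth f -> smooth g -> smooth (fun x => f x * g x).
Proof. by move=> sf sg; apply: smooth_alg_smooth; apply: alg_mul; exact: alg_smooth. Qed.

Lemma smooth_lin c f g : smooth f -> smooth g -> smooth (fun x => f x + c * g x).
Proof.
move=> sf sg; apply: smooth_alg_smooth; apply: alg_add; first exact: alg_smooth.
by apply: alg_mul; [exact: alg_cst|exact: alg_smooth].
Qed.

Lemma partialM k f g x : smooth f -> smooth g ->
  partial k (fun x => f x * g x) x = f x * partial k g x + g x * partial k f x.
Proof. by move=> sf sg; apply: deriveM; exact: smooth_derivable. Qed.

Lemma partial_lin k c f g x : smooth f -> smooth g ->
  partial k (fun x => f x + c * g x) x = partial k f x + c * partial k g x.
Proof.
move=> sf sg; have df := @smooth_derivable _ k x sf; have dg := @smooth_derivable _ k x sg.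
by rewrite /partial (deriveD df (derivableZ (k := c) dg)) (deriveZ c dg).
Qed.

Lemma partial_comp k (G G' : R -> R) f x : smooth f ->
  (forall y : R, is_derive y 1 G (G' y)) ->
  partial k (fun x => G (f x)) x = G' (f x) * partial k f x.
Proof.
move=> sf dG.
by have [] := is_derive_comp_line (dG (f x)) (derivableP (@smooth_derivable f k x sf)).
Qed.

Lemma test_fun_sub (Omega C : set Rn) phi :
  smooth phi -> compact C -> C `<=` Omega -> [set x | phi x != 0] `<=` C ->
  test_fun Omega phi.
Proof.
move=> sphi cC CO sC.
have clC : closure [set x | phi x != 0] `<=` C.
  apply: (subset_trans (closureS sC)).
  by rewrite -(closure_id C).1//; apply: compact_closed cC; exact: norm_hausdorff.
split=> //; last exact: subset_trans CO.
by apply: subclosed_compact cC clC; exact: closed_closure.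
Qed.

Lemma test_fun_lin Omega c phi psi : test_fun Omega phi -> test_fun Omega psi ->
  test_fun Omega (fun x => phi x + c * psi x).
Proof.
move=> [s1 c1 o1] [s2 c2 o2].
apply: (test_fun_sub (smooth_lin c s1 s2) (compactU c1 c2)); first by rewrite subUset.
move=> x /= h; have [p0|p0] := eqVneq (phi x) 0.
  by right; apply: subset_closure => /=; apply: contraNN h => /eqP ->; rewrite p0 mulr0 addr0.
by left; exact: subset_closure.
Qed.

Lemma test_funMl Omega f phi : smooth f -> test_fun Omega phi ->
  test_fun Omega (fun x => f x * phi x).
Proof.
move=> sf [s c o].
apply: (test_fun_sub (smoothM sf s) c o) => x /= h; apply: subset_closure => /=.
by apply: contraNN h => /eqP ->; rewrite mulr0.
Qed.

Lemma test_fun_comp Omega (G : R -> R) phi : (forall f, smooth f -> smooth (G \o f)) ->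
  G 0 = 0 -> test_fun Omega phi -> test_fun Omega (G \o phi).
Proof.
move=> sG G0 [s c o].
apply: (test_fun_sub (sG _ s) c o) => x /= h; apply: subset_closure => /=.
by apply: contraNN h => /eqP ->; rewrite G0.
Qed.

Lemma partial_support k phi x : ~ closure [set x | phi x != 0] x ->
  partial k phi x = 0.
Proof.
move=> ncl.
have /near_eq_derive : \near x, phi x = (cst 0 : Rn -> R) x.
  have : nbhs x (~` closure [set x | phi x != 0]).
    by apply: open_nbhs_nbhs; split=> //; exact/closed_openC/closed_closure.
  apply: filterS => y ny /=; apply/eqP; apply: contraPT ny => py.
  by apply; exact: subset_closure.
by rewrite /partial => ->; rewrite derive_cst.
Qed.

Lemma test_fun0 Omega phi x : test_fun Omega phi -> ~ Omega x -> phi x = 0.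
Proof.
move=> [_ _ so] nO; apply/eqP; apply: contraPT nO => p0.
by apply; apply: so; exact: subset_closure.
Qed.

Lemma test_fun_partial0 Omega k phi x : test_fun Omega phi -> ~ Omega x ->
  partial k phi x = 0.
Proof. by move=> [_ _ so] nO; apply: partial_support => /so. Qed.

Lemma test_fun_bounded_support Omega phi : test_fun Omega phi ->
  exists2 K, 0 < K & forall x, K < `|x| -> phi x = 0 /\ forall k, partial k phi x = 0.
Proof.
move=> [_ /compact_bounded/pinfty_ex_gt0[K K0 hK] _]; exists K => // x Kx.
have nx : ~ closure [set x | phi x != 0] x by move=> /hK /=; rewrite leNgt Kx.
split=> [|k]; last exact: partial_support.
by apply/eqP; apply: contraPT nx => p0; apply; exact: subset_closure.
Qed.

Definition box (a b : Rn) : set Rn := [set x | forall i, a ord0 i < x ord0 i < b ord0 i].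
Definition cbox (a b : Rn) : set Rn := [set x | forall i, a ord0 i <= x ord0 i <= b ord0 i].

Lemma box_cbox a b : box a b `<=` cbox a b.
Proof. by move=> x xab i; have /andP[/ltW -> /ltW ->] := xab i. Qed.

Lemma compact_cbox a b : compact (cbox a b).
Proof.
have := @rV_compact R n (fun i => `[a ord0 i, b ord0 i]%classic) (fun i => @segment_compact _ _ _).
by rewrite (_ : [set v | _] = cbox a b)//; apply/seteqP; split=> x /= h i; have := h i; rewrite in_itv.
Qed.

(** For x in the box each factor is exp (-1 / (N c)) with c > 0 and tends to 1;
outside some factor vanishes.  So the bumps approximate the indicator of the
open box and stay between 0 and 1. *)
Definition box_bump (a b : Rn) (N : nat) (x : Rn) : R :=
  \prod_(i < n) flat 0 (N.+1%:R * ((x ord0 i - a ord0 i) * (b ord0 i - x ord0 i))).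

Lemma flat0_le1 (y : R) : 0 <= flat 0 y <= 1.
Proof.
rewrite flat_ge0/= /flat; case: ifPn => // y0.
by rewrite expr0 mul1r -expR0 ler_expR oppr_le0 invr_ge0 ltW.
Qed.

Lemma box_bump_ge0_le1 a b N x : 0 <= box_bump a b N x <= 1.
Proof.
apply/andP; split; first by apply: prodr_ge0 => i _; have /andP[] := flat0_le1 (N.+1%:R * ((x ord0 i - a ord0 i) * (b ord0 i - x ord0 i))).
rewrite (le_trans (y := \prod_(i < n) (1 : R)))//; last by rewrite big1.
by apply: ler_prod => i _; exact: flat0_le1.
Qed.

Lemma box_bump_cvg (a b x : Rn) : (forall i, a ord0 i <= b ord0 i) -> box_bump a b N x @[N --> \oo] --> (\1_(box a b) x : R).
Proof.
move=> ab; rewrite indicE; case: (boolP (x \in _)) => [|].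
  rewrite inE => xab.
  rewrite [X in _ --> X](_ : _ = \prod_(i < n) (1:R)); last by rewrite big1.
  apply: cvg_big => [|i _]; first exact: mul_continuous.
  set c := (_ * _).
  have c0 : 0 < c by have /andP[ax xb] := xab i; rewrite mulr_gt0// subr_gt0.
  rewrite (_ : (fun _ => _) = fun N => expR (- (c^-1 * N.+1%:R^-1))); last first.
    apply/funext => N; rewrite /flat mulr_gt0// expr0 mul1r invfM mulrC.
    by [].
  suff : expR (- (c^-1 * N.+1%:R^-1)) @[N --> \oo] --> expR (0 : R) by rewrite expR0.
  apply: (cvg_comp (fun N : nat => - (c^-1 * N.+1%:R^-1)) (@expR R)); last exact: continuous_expR.
  rewrite -oppr0; apply: cvgN; rewrite -(mulr0 c^-1).
  by apply: cvgMr; exact: cvg_harmonic.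
rewrite notin_setE => xab; apply: cvg_near_cst; near=> N.
have [i /negP] : exists i, ~ (a ord0 i < x ord0 i < b ord0 i) by apply/existsNP.
rewrite negb_and -!leNgt => axb.
rewrite /box_bump (bigD1 i)//= /flat ifF ?mul0r//; apply/negbTE.
rewrite -leNgt pmulr_rle0//; have := ab i; case/orP: axb; nra.
Unshelve. all: end_near. Qed.

Lemma test_fun_box_bump Omega (a b : Rn) N : (forall i, a ord0 i <= b ord0 i) -> cbox a b `<=` Omega -> test_fun Omega (box_bump a b N).
Proof.
move=> ab sO; apply: (test_fun_sub _ (@compact_cbox a b) sO).
  apply: smooth_alg_smooth; apply: smooth_alg_prod => i.
  apply: (@alg_flat _ _ _ (fun x => N.+1%:R * ((x ord0 i - a ord0 i) * (b ord0 i - x ord0 i)))).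
  apply: alg_mul; first exact: alg_cst.
  apply: alg_mul.
    exact: (alg_add (alg_coord i) (alg_cst (- a ord0 i))).
  apply: (@alg_add _ _ (fun=> b ord0 i) (fun x => - x ord0 i)); first exact: alg_cst.
  rewrite (_ : (fun x : Rn => _) = fun x : Rn => (-1) * x ord0 i); last by apply/funext => x; rewrite mulN1r.
  by apply: alg_mul; [exact: alg_cst|exact: alg_coord].
move=> x /= /prodf_neq0 h i.
have := h i isT; rewrite /flat; case: ifPn; last by rewrite eqxx.
rewrite pmulr_rgt0// => + _; have := ab i; nra.
Qed.

End test_functions.

(** * Borel sets of R^n and Tonelli's theorem *)
Section borel.
Context {R : realType}.
Implicit Types (n : nat).

Lemma measurable_coord n (i : 'I_n) :
  measurable_fun [set: borel_rV R n] (fun x : borel_rV R n => (x : 'rV[R]_n) ord0 i : R).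
Proof.
move=> _ B mB; rewrite setTI; apply: sub_sigma_algebra; rewrite -bigcup_seq.
by exists i; [rewrite /= mem_index_enum | exists B; rewrite // setTI].
Qed.

Lemma measurable_rVP n d (T : measurableType d) (f : T -> borel_rV R n) :
  (forall i : 'I_n, measurable_fun setT (fun x => (f x : 'rV[R]_n) ord0 i)) -> measurable_fun setT f.
Proof.
move=> mf.
pose C : set (set (borel_rV R n)) := \big[setU/set0]_(i < n)
  preimage_set_system setT (fun x : 'rV[R]_n => x ord0 i) measurable.
apply: (@measurability _ _ _ _ _ _ C) => // _ [A + <-]; rewrite /C.
rewrite -bigcup_seq => -[i _ [B mB <-]].
by rewrite !setTI -comp_preimage -[X in measurable X]setTI; apply: mf.
Qed.

(** Rational corners leave countably many boxes, so open sets are Borel and null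
sets can be collected box by box. *)
Lemma open_box n (U : set 'rV[R]_n) x : open U -> U x ->
  exists a b : 'rV[rat]_n, [/\ forall i, (a ord0 i < b ord0 i),
    box (map_mx ratr a) (map_mx ratr b) x & cbox (map_mx ratr a) (map_mx ratr b) `<=` U].
Proof.
move=> oU Ux; have := open_nbhs_nbhs (conj oU Ux).
move=> /nbhs_ballP[e /= e0 eU].
have /choice[a aP] : forall i : 'I_n, exists q : rat, ratr q \in `]x ord0 i - e, x ord0 i[.
  by move=> i; apply: rat_in_itvoo; rewrite gtrBl.
have /choice[b bP] : forall i : 'I_n, exists q : rat, ratr q \in `]x ord0 i, x ord0 i + e[.
  by move=> i; apply: rat_in_itvoo; rewrite ltrDl.
have abP i : [/\ x ord0 i - e < ratr (a i), ratr (a i) < x ord0 i,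
     x ord0 i < ratr (b i) & ratr (b i) < x ord0 i + e].
  by have := aP i; have := bP i; rewrite !in_itv/= => /andP[-> ->] /andP[-> ->].
exists (\row_i a i), (\row_i b i); split=> [i|i|y /= yab].
- by rewrite !mxE -(ltr_rat R); have [_ h1 h2 _] := abP i; exact: lt_trans h2.
- by rewrite !mxE; have [_ -> -> _] := abP i.
- apply: eU; rewrite -ball_normE /ball_/=.
  rewrite /Num.Def.normr/= mx_normrE; apply: bigmax_lt => // -[j i] _ /=.
  rewrite (ord1 j) !mxE; have := yab i; rewrite !mxE => /andP[h1 h2].
  have [h3 h4 h5 h6] := abP i; rewrite ltr_norml; apply/andP; split; lra.
Qed.

Lemma measurable_box n (a b : 'rV[R]_n) : measurable (box a b : set (borel_rV R n)).
Proof.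
rewrite (_ : box a b = \bigcap_(i in [set: 'I_n]) ((fun x : 'rV[R]_n => x ord0 i) @^-1` `]a ord0 i, b ord0 i[%classic)); last first.
  apply/seteqP; split=> x /= h i; first by move=> _; rewrite /= in_itv/=; exact: h.
  by have := h i Logic.I; rewrite /= in_itv.
apply: fin_bigcap_measurable => // i _; rewrite -[X in measurable X]setTI.
exact: measurable_coord.
Qed.

Lemma open_measurable_rV n (U : set 'rV[R]_n) : open U -> measurable (U : set (borel_rV R n)).
Proof.
move=> oU.
pose D : set ('rV[rat]_n * 'rV[rat]_n) := [set ab | cbox (map_mx ratr ab.1) (map_mx ratr ab.2) `<=` U].
rewrite (_ : U = \bigcup_(ab in D) box (map_mx ratr ab.1) (map_mx ratr ab.2)).
  rewrite bigcup_mkcond; apply: countable_bigcupT_measurable => [|ab].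
    exact: countableP.
  by case: ifP => // _; exact: measurable_box.
apply/seteqP; split=> x.
  by move=> /(open_box oU)[a [b [_ abx abU]]]; exists (a, b).
by move=> [[a b]/= abU /box_cbox /abU].
Qed.

Lemma continuous_measurable_rV n (f : 'rV[R]_n -> R) : continuous f ->
  measurable_fun [set: borel_rV R n] (f : borel_rV R n -> R).
Proof.
move=> cf; apply: (measurability _ (RGenOInfty.measurableE R)) => _ [_ [x ->] <-].
rewrite setTI; apply: open_measurable_rV; move/continuousP: cf; apply.
exact: interval_open.
Qed.

Lemma rV_cons0 n (y : borel_rV R n) (x : measurableTypeR R) : rV_cons (y, x) ord0 ord0 = x :> R.
Proof.
rewrite /rV_cons/= (_ : ord0 = lshift n (@ord0 0)); last exact/val_inj.
by rewrite (@row_mxEl _ 1 1 n) mxE mulr1n.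
Qed.

Lemma rV_consS n (y : borel_rV R n) (x : measurableTypeR R) (i : 'I_n) :
  rV_cons (y, x) ord0 (lift ord0 i) = (y : 'rV[R]_n) ord0 i :> R.
Proof.
rewrite /rV_cons/= (_ : lift ord0 i = rshift 1 i); last exact/val_inj.
by rewrite (@row_mxEr _ 1 1 n).
Qed.

(** Parametrizes by t the line through z in the k-th direction. *)
Definition upd n (z : 'rV[R]_n) (k : 'I_n) (t : R) : 'rV[R]_n :=
  \row_j if j == k then t else z ord0 j.

Lemma upd_cons0 n (y : borel_rV R n) (x t : R) : upd (rV_cons (y, x)) ord0 t = rV_cons (y, t).
Proof.
apply/rowP => j; rewrite mxE; case: (unliftP ord0 j) => [i ->|->].
  by rewrite !rV_consS.
by rewrite !rV_cons0 eqxx.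
Qed.

Lemma upd_consS n (y : borel_rV R n) (x t : R) (k : 'I_n) :
  upd (rV_cons (y, x)) (lift ord0 k) t = rV_cons (upd y k t : borel_rV R n, x).
Proof.
apply/rowP => j; rewrite mxE; case: (unliftP ord0 j) => [i ->|->].
  by rewrite !rV_consS mxE (inj_eq lift_inj).
by rewrite !rV_cons0.
Qed.

Lemma upd_id n (z : 'rV[R]_n) k : upd z k (z ord0 k) = z.
Proof. by apply/rowP => j; rewrite mxE; case: eqP => [->|]. Qed.

Lemma measurable_upd n (k : 'I_n) :
  measurable_fun setT (fun zt : borel_rV R n * measurableTypeR R => upd zt.1 k zt.2 : borel_rV R n).
Proof.
apply: measurable_rVP => i.
have [->|ik] := eqVneq i k.
  rewrite (_ : (fun x => _) = snd); first exact: measurable_snd.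
  by apply/funext => -[z t]; rewrite /upd mxE eqxx.
rewrite (_ : (fun x => _) = (fun z : borel_rV R n => (z : 'rV[R]_n) ord0 i) \o fst).
  by apply: measurableT_comp; [exact: measurable_coord|exact: measurable_fst].
by apply/funext => -[z t]; rewrite /upd mxE (negbTE ik).
Qed.

Lemma measurable_cbox n (a b : 'rV[R]_n) : measurable (cbox a b : set (borel_rV R n)).
Proof.
rewrite (_ : cbox a b = \bigcap_(i in [set: 'I_n]) ((fun x : 'rV[R]_n => x ord0 i) @^-1` `[a ord0 i, b ord0 i]%classic)); last first.
  apply/seteqP; split=> x /= h i; first by move=> _; rewrite /= in_itv/=; exact: h.
  by have := h i Logic.I; rewrite /= in_itv.
apply: fin_bigcap_measurable => // i _; rewrite -[X in measurable X]setTI.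
exact: measurable_coord.
Qed.

Let lebesgue_segment (a b : R) : (lebesgue_measure (`[a, b]%classic : set R) < +oo)%E.
Proof. by rewrite lebesgue_measure_itv/=; case: ifP; rewrite ?ltry// -EFinD ltry. Qed.

Lemma borel_lebesgue_cbox n (a b : 'rV[R]_n) :
  (borel_lebesgue R n (cbox a b) < +oo)%E.
Proof.
elim: n a b => [|n IH] a b /=.
  by rewrite diracE; case: (_ \in _); rewrite ltry.
rewrite /image_measure /pushforward/=.
have -> : @rV_cons R n @^-1` cbox a b =
   (cbox (\row_i a ord0 (lift ord0 i)) (\row_i b ord0 (lift ord0 i)) : set (borel_rV R n)) `*` `[a ord0 ord0, b ord0 ord0]%classic.
  apply/seteqP; split=> -[y x] /= h.
    split=> [i|]; last by have := h ord0; rewrite rV_cons0 in_itv.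
    by have := h (lift ord0 i); rewrite rV_consS !mxE.
  move=> j; case: (unliftP ord0 j) => [i ->|->].
    by have := h.1 i; rewrite rV_consS !mxE.
  by rewrite rV_cons0; have := h.2; rewrite in_itv.
rewrite product_measure1E//; last exact: measurable_cbox.
apply: lte_mul_pinfty => //; last exact: lebesgue_segment.
by rewrite ge0_fin_numE.
Qed.

Lemma cbox_norm n (x : 'rV[R]_n) K : `|x| <= K -> cbox (const_mx (- K)) (const_mx K) x.
Proof.
move=> xK i; rewrite !mxE -ler_norml (le_trans _ xK)//.
rewrite [leRHS]/Num.Def.normr/= mx_normrE.
exact: (@le_bigmax _ _ _ 0 (fun ij : 'I_1 * 'I_n => `|(x : 'rV[R]_n) ij.1 ij.2|) (ord0, i)).
Qed.

Lemma sigma_finite_borel_lebesgue n : sigma_finite setT (borel_lebesgue R n).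
Proof.
exists (fun k => cbox (const_mx (- k%:R)) (const_mx k%:R)).
  apply/esym/seteqP; split=> // x _.
  have [k kx] : exists k : nat, `|x| < k%:R.
    by exists (Num.trunc `|x|).+1; rewrite truncnS_gt.
  by exists k => //; exact: cbox_norm (ltW kx).
by move=> k; split; [exact: measurable_cbox|exact: borel_lebesgue_cbox].
Qed.

(** A name of its own for the measure, to which the sigma-finiteness required by
Tonelli's theorem can be attached. *)
Definition borel_mu n : set (borel_rV R n) -> \bar R := borel_lebesgue R n.

HB.instance Definition _ n := Measure.copy (@borel_mu n) (borel_lebesgue R n).
HB.instance Definition _ n := @Measure_isSigmaFinite.Build _ (borel_rV R n) R
  (@borel_mu n) (@sigma_finite_borel_lebesgue n).

Lemma ge0_integral_borel_muS n (f : borel_rV R n.+1 -> \bar R) :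
  measurable_fun setT f -> (forall z, 0 <= f z)%E ->
  (\int[@borel_mu n.+1]_z f z =
   \int[@borel_mu n \x lebesgue_measure]_yx f (rV_cons yx))%E.
Proof.
move=> mf f0.
rewrite (_ : \int[@borel_mu n.+1]_z f z = \int[pushforward (@borel_mu n \x lebesgue_measure) (@rV_cons R n)]_z f z)%E; last by [].
by rewrite ge0_integral_pushforward//; exact: measurable_rV_cons.
Qed.

Lemma measurable_comp_cons n (f : borel_rV R n.+1 -> \bar R) :
  measurable_fun setT f -> measurable_fun setT (fun yx => f (@rV_cons R n yx)).
Proof. by move=> mf; apply: measurableT_comp mf _; exact: measurable_rV_cons. Qed.

(** [rV_cons] adds a coordinate in front.  This version integrates it first,
[tonelli_outer] integrates it last. *)
Lemma tonelli_inner n (f : borel_rV R n.+1 -> \bar R) :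
  measurable_fun setT f -> (forall z, 0 <= f z)%E ->
  (\int[@borel_mu n.+1]_z f z =
   \int[@borel_mu n]_y \int[lebesgue_measure]_x f (rV_cons (y, x)))%E.
Proof.
move=> mf f0; rewrite ge0_integral_borel_muS// fubini_tonelli1//.
exact: measurable_comp_cons.
Qed.

Lemma tonelli_outer n (f : borel_rV R n.+1 -> \bar R) :
  measurable_fun setT f -> (forall z, 0 <= f z)%E ->
  (\int[@borel_mu n.+1]_z f z =
   \int[lebesgue_measure]_x \int[@borel_mu n]_y f (rV_cons (y, x)))%E.
Proof.
move=> mf f0; rewrite ge0_integral_borel_muS// fubini_tonelli2//.
exact: measurable_comp_cons.
Qed.

Lemma measurable_slice n (f : borel_rV R n.+1 -> \bar R) (x : measurableTypeR R) :
  measurable_fun setT f -> measurable_fun setT (fun y => f (@rV_cons R n (y, x))).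
Proof.
move=> mf; apply: (measurableT_comp (measurable_comp_cons mf)).
exact: measurable_pair2.
Qed.

(** Functions with the same integral on each line in one direction have the same
integral: the other coordinates are peeled off with [tonelli_outer] until that
direction comes first. *)
Lemma eq_integral_lines n (k : 'I_n) (f g : borel_rV R n -> \bar R) :
  measurable_fun setT f -> measurable_fun setT g ->
  (forall z, 0 <= f z)%E -> (forall z, 0 <= g z)%E ->
  (forall z, \int[lebesgue_measure]_t f (upd z k t) = \int[lebesgue_measure]_t g (upd z k t))%E ->
  (\int[@borel_mu n]_z f z = \int[@borel_mu n]_z g z)%E.
Proof.
elim: n k f g => [|n IH] k f g; first by case: k.
case: (unliftP ord0 k) => [i ->|->] mf mg f0 g0 fg.
  rewrite !tonelli_outer//; apply: eq_integral => x _.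
  apply: (IH i) => // [||y]; [exact: measurable_slice|exact: measurable_slice|].
  have := fg (rV_cons (y, x)).
  by under eq_integral do rewrite upd_consS; under [in RHS]eq_integral do rewrite upd_consS.
rewrite !tonelli_inner//; apply: eq_integral => y _.
have := fg (rV_cons (y, 0 : measurableTypeR R)).
by under eq_integral do rewrite upd_cons0; under [in RHS]eq_integral do rewrite upd_cons0.
Qed.

Definition line_integral n (k : 'I_n) (g : borel_rV R n -> \bar R) (z : borel_rV R n) : \bar R :=
  (\int[lebesgue_measure]_t g (upd z k t))%E.

Lemma line_integral_ge0 n (k : 'I_n) g z : (forall z, 0 <= g z)%E -> (0 <= line_integral k g z)%E.
Proof. by move=> g0; apply: integral_ge0 => t _; exact: g0. Qed.

Lemma measurable_line_integral n (k : 'I_n) g : measurable_fun setT g -> (forall z, 0 <= g z)%E ->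
  measurable_fun setT (line_integral k g).
Proof.
move=> mg g0.
apply: (measurable_fun_fubini_tonelli_F (m2 := lebesgue_measure) (fun zt : borel_rV R n * measurableTypeR R => g (upd zt.1 k zt.2))) => //.
by apply: measurableT_comp mg _; exact: measurable_upd.
Qed.

Lemma line_integral_cons0 n (g : borel_rV R n.+1 -> \bar R) y x :
  line_integral ord0 g (rV_cons (y, x)) = (\int[lebesgue_measure]_t g (rV_cons (y, t)))%E.
Proof. by apply: eq_integral => t _; rewrite upd_cons0. Qed.

Lemma line_integral_consS n (i : 'I_n) (g : borel_rV R n.+1 -> \bar R) y x :
  line_integral (lift ord0 i) g (rV_cons (y, x)) = line_integral i (fun y => g (rV_cons (y, x))) y.
Proof. by apply: eq_integral => t _; rewrite upd_consS. Qed.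

Lemma leb_borel n (A : set (borel_rV R n)) : measurable A -> leb R n A = @borel_mu n A.
Proof. by move=> mA; rewrite /leb/= /completed_measure_extension/= measurable_mu_extE. Qed.

Lemma measurable_leb n (A : set 'rV[R]_n) :
  measurable (A : set (borel_rV R n)) -> measurable (A : set (leb_rV R n)).
Proof. exact: caratheodory_measurable_mu_ext. Qed.

Lemma measurable_fun_leb n d (T : measurableType d) (f : 'rV[R]_n -> T) :
  measurable_fun setT (f : borel_rV R n -> T) -> measurable_fun setT (f : leb_rV R n -> T).
Proof. by move=> mf _ B mB; rewrite setTI; apply: measurable_leb; rewrite -[X in measurable X]setTI; exact: mf. Qed.

(** The completed measure and the Borel measure agree on Borel sets, so Borel
functions have the same integral and the product structure can be used. *)
Lemma ge0_integral_leb n (f : 'rV[R]_n -> \bar R) :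
  measurable_fun setT (f : borel_rV R n -> \bar R) -> (forall z, 0 <= f z)%E ->
  (\int[leb R n]_z f z = \int[@borel_mu n]_z f z)%E.
Proof.
move=> mf f0.
have mid : measurable_fun setT (id : leb_rV R n -> borel_rV R n) by exact: measurable_fun_leb.
rewrite -(@ge0_integral_pushforward _ _ _ _ _ _ mid (leb R n) setT f)//.
apply: eq_measure_integral => A mA _; exact: leb_borel.
Qed.

End borel.

(** * Gagliardo's inequality on coordinate lines *)
Section geometric_mean.
Local Open Scope ereal_scope.
Context {R : realType}.

Lemma ge0_prode_eq0 N (b : 'I_N -> \bar R) i : b i = 0 -> \prod_(i < N) b i = 0.
Proof. by move=> bi; rewrite (bigD1 i)//= bi mul0e. Qed.

Lemma ge0_prode_eqy N (b : 'I_N -> \bar R) i : (forall i, 0 < b i) -> b i = +oo ->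
  \prod_(i < N) b i = +oo.
Proof.
move=> b0 bi; rewrite (bigD1 i)//= bi gt0_mulye//.
by elim/big_ind : _ => // x y; exact: mule_gt0.
Qed.

Lemma le_poweR (x y : \bar R) r : (0 <= r)%R -> 0 <= x -> x <= y -> x `^ r <= y `^ r.
Proof.
move=> r0 x0 xy; apply: gt0_ler_poweR => //; rewrite in_itv/= ?x0 leey//.
by rewrite (le_trans x0 xy).
Qed.

Lemma prode_poweRV N (x : \bar R) : 0 <= x -> \prod_(j < N.+1) (x `^ (N.+1%:R^-1)) = x.
Proof.
move=> x0; case: x x0 => [x x0| _|//].
- rewrite poweR_EFin prodEFin prodr_const card_ord -powR_mulrn ?powR_ge0// -powRrM mulVf ?pnatr_eq0//.
  by rewrite powRr1.
- by rewrite poweRyr ?invr_neq0 ?pnatr_eq0//; exact: (@ge0_prode_eqy _ _ ord0).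
Qed.

Lemma lee_prode N (a b : 'I_N -> \bar R) : (forall i, 0 <= a i) ->
  (forall i, a i <= b i) -> \prod_(i < N) a i <= \prod_(i < N) b i.
Proof.
move=> a0 ab; suff [] : 0 <= \prod_(i < N) a i /\ \prod_(i < N) a i <= \prod_(i < N) b i by [].
elim/big_ind2 : _ => // x x' y y' [x0 xx'] [y0 yy'].
by rewrite mule_ge0// lee_pmul.
Qed.

Lemma ereal_AGM N (b : 'I_N.+1 -> \bar R) : (forall i, 0 <= b i) ->
  (\prod_(i < N.+1) b i) `^ (N.+1%:R^-1) <= (N.+1%:R^-1)%:E * \sum_(i < N.+1) b i.
Proof.
move=> b0.
have N0 : (0 < N.+1%:R^-1 :> R)%R by rewrite invr_gt0.
have [[i bi]|by_] := pselect (exists i, b i = +oo).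
  rewrite [X in _ <= _ * X](bigD1 i)//= bi addye ?gt0_muley ?leey//.
  by rewrite gt_eqF// (lt_le_trans ltNy0)// sume_ge0.
have bE i : b i = (fine (b i))%:E.
  by rewrite fineK// ge0_fin_numE// ltey; apply/eqP => bi; apply: by_; exists i.
under eq_bigr do rewrite bE; under [X in _ <= _ * X]eq_bigr do rewrite bE.
rewrite prodEFin sumEFin poweR_EFin -EFinM lee_fin.
have := (@leif_AGM R 'I_N.+1 predT (fun i => fine (b i))).
have f0 : forall i, (0 <= fine (b i))%R by move=> i; exact: fine_ge0.
move=> /(_ (fun i _ => f0 i))[+ _].
rewrite (_ : #|predT| = N.+1); last exact: card_ord.
move=> h.
apply: (@le_trans _ _ ((((\sum_(i in predT) fine (b i)) / N.+1%:R) ^+ N.+1) `^ N.+1%:R^-1)%R).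
  apply: ge0_ler_powR => //.
  - by rewrite nnegrE; apply: prodr_ge0.
  - by rewrite nnegrE exprn_ge0// divr_ge0// sumr_ge0.
have s0 : (0 <= (\sum_(i in predT) fine (b i)) / N.+1%:R)%R by rewrite divr_ge0// sumr_ge0.
rewrite -powR_mulrn// -powRrM divff ?pnatr_eq0// powRr1// mulrC//.
Qed.

Context d (T : measurableType d) (mu : {measure set T -> \bar R}).

Lemma measurable_prode N (a : 'I_N -> T -> \bar R) D :
  (forall i, measurable_fun D (a i)) -> measurable_fun D (fun x => \prod_(i < N) a i x).
Proof.
move=> ma; elim: N a ma => [|N IH] a ma.
  by under eq_fun do rewrite big_ord0; exact: measurable_cst.
under eq_fun do rewrite big_ord_recl; apply: emeasurable_funM => //.
exact: IH.
Qed.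

Lemma measurable_poweR_prode N (a : 'I_N -> T -> \bar R) D r :
  (forall i, measurable_fun D (a i)) ->
  measurable_fun D (fun x => (\prod_(i < N) a i x) `^ r).
Proof.
by move=> ma; apply: (measurableT_comp (measurable_poweR _)); exact: measurable_prode.
Qed.

Lemma ge0_integral_eq0P (f : T -> \bar R) : measurable_fun setT f -> (forall x, 0 <= f x) ->
  \int[mu]_x f x = 0 -> ae_eq mu setT f (cst 0).
Proof.
move=> mf f0 i0; apply/ae_eq_integral_abs => //.
by under eq_integral do rewrite gee0_abs//.
Qed.

(** Hoelder's inequality with N + 1 equal exponents.  When the integrals are
positive and finite each function can be scaled to integral 1, and then the
geometric mean is at most the arithmetic mean, whose integral is 1. *)
Lemma integral_geometric_mean N (a : 'I_N.+1 -> T -> \bar R) :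
  (forall i, measurable_fun setT (a i)) -> (forall i x, 0 <= a i x) ->
  \int[mu]_x (\prod_(i < N.+1) a i x) `^ (N.+1%:R^-1) <=
  (\prod_(i < N.+1) \int[mu]_x a i x) `^ (N.+1%:R^-1).
Proof.
move=> ma a0.
have N0 : (0 < N.+1%:R^-1 :> R)%R by rewrite invr_gt0.
have I0 i : 0 <= \int[mu]_x a i x by exact: integral_ge0.
have mp : measurable_fun setT (fun x => (\prod_(i < N.+1) a i x) `^ (N.+1%:R^-1)).
  by apply: (measurableT_comp (measurable_poweR _)); exact: measurable_prode.
have [[i Ii]|nI0] := pselect (exists i, \int[mu]_x a i x = 0).
  rewrite (@ge0_ae_eq_integral _ _ _ _ _ _ (cst 0))//.
  - by rewrite integral0 poweR_ge0.
  - by move=> x _; exact: poweR_ge0.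
  have := ge0_integral_eq0P (ma i) (a0 i) Ii; apply: filterS => x /= h _.
  by rewrite (ge0_prode_eq0 (i := i)) ?poweR0r ?gt_eqF// h.
have Ip i : 0 < \int[mu]_x a i x.
  by rewrite lt0e I0 andbT; apply/eqP => h; apply: nI0; exists i.
have [[i Ii]|nIy] := pselect (exists i, \int[mu]_x a i x = +oo).
  by rewrite (ge0_prode_eqy (i := i))// poweRyr ?gt_eqF// leey.
pose c i := fine (\int[mu]_x a i x).
have cE i : \int[mu]_x a i x = (c i)%:E.
  by rewrite fineK// ge0_fin_numE// ltey; apply/eqP => h; apply: nIy; exists i.
have c0 i : (0 < c i)%R by rewrite -lte_fin -cE.
under eq_bigr do rewrite cE.
set C := \prod_(i < _) (c _)%:E.
have C0 : 0 <= C by apply: prode_ge0 => i _; rewrite lee_fin ltW.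
have pE x : (\prod_(i < N.+1) a i x) = C * \prod_(i < N.+1) (((c i)^-1)%:E * a i x).
  rewrite /C -big_split/=; apply: eq_bigr => i _.
  by rewrite muleA -EFinM divff ?gt_eqF// mul1e.
have b0 i x : 0 <= ((c i)^-1)%:E * a i x by rewrite mule_ge0// lee_fin invr_ge0 ltW.
have mb i : measurable_fun setT (fun x => ((c i)^-1)%:E * a i x) by exact: measurable_funeM.
apply: (@le_trans _ _ (\int[mu]_x (C `^ N.+1%:R^-1 * ((N.+1%:R^-1)%:E * \sum_(i < N.+1) (((c i)^-1)%:E * a i x))))).
  apply: ge0_le_integral => //.
  - by move=> x _; exact: poweR_ge0.
  - apply: measurable_funeM; apply: measurable_funeM; exact: emeasurable_sum.
  - move=> x _; rewrite pE poweRM//; last exact: prode_ge0.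
    by rewrite lee_wpmul2l ?poweR_ge0// ereal_AGM.
rewrite ge0_integralZl ?poweR_ge0//; first last.
- by move=> x _; apply: mule_ge0; [rewrite lee_fin ltW|exact: sume_ge0].
- by apply: measurable_funeM; exact: emeasurable_sum.
rewrite ge0_integralZl ?lee_fin ?invr_ge0//; first last.
- by move=> x _; rewrite sume_ge0.
- exact: emeasurable_sum.
rewrite ge0_integral_sum// (eq_bigr (fun=> 1)) => [|i _]; last first.
  by rewrite ge0_integralZl ?lee_fin ?invr_ge0 ?ltW// cE -EFinM mulVf ?gt_eqF.
rewrite sumEFin -EFinM sumr_const card_ord mulVf ?pnatr_eq0// mule1//.
Qed.

End geometric_mean.

Section gagliardo.
Local Open Scope ereal_scope.
Context {R : realType}.
Local Notation lam := (@lebesgue_measure R).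

Lemma integral_rV0 (f : borel_rV R 0 -> \bar R) : measurable_fun setT f ->
  \int[@borel_mu R 0]_z f z = f (0 : 'rV[R]_0)%R.
Proof.
move=> mf.
have -> : \int[@borel_mu R 0]_z f z = \int[\d_((0%R : 'rV[R]_0) : borel_rV R 0)]_z f z by [].
by rewrite integral_dirac// diracE in_setT mul1e.
Qed.

(** Gagliardo's inequality with an additional factor A that depends on all
coordinates and takes part in Hoelder's inequality on the same footing as the
line integrals.  [Q] in dimension n + 1 is [P] in dimension n on the slices
where the first coordinate is fixed, with A the integral over that coordinate;
[P] in dimension n + 1 follows from [Q] in that dimension by Hoelder's
inequality. *)
Let P n := forall (A : borel_rV R n -> \bar R) (g : 'I_n -> borel_rV R n -> \bar R),
  measurable_fun setT A -> (forall z, 0 <= A z) ->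
  (forall i, measurable_fun setT (g i)) -> (forall i z, 0 <= g i z) ->
  \int[@borel_mu R n]_z (A z * \prod_(i < n) line_integral i (g i) z) `^ (n%:R^-1) <=
  (\int[@borel_mu R n]_z A z * \prod_(i < n) \int[@borel_mu R n]_z g i z) `^ (n%:R^-1).

Let Q n := forall (g : 'I_n.+1 -> borel_rV R n.+1 -> \bar R),
  (forall i, measurable_fun setT (g i)) -> (forall i z, 0 <= g i z) ->
  \int[@borel_mu R n.+1]_z (\prod_(i < n.+1) line_integral i (g i) z) `^ (n%:R^-1) <=
  (\prod_(i < n.+1) \int[@borel_mu R n.+1]_z g i z) `^ (n%:R^-1).

Let P1_ : P 1.
Proof.
move=> A g mA A0 mg g0; rewrite invr1 big_ord1.
have gE z : line_integral ord0 (g ord0) z = \int[@borel_mu R 1]_z g ord0 z.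
  rewrite tonelli_inner//.
  rewrite integral_rV0; last first.
    apply: (measurable_fun_fubini_tonelli_F (m2 := lam) (fun yx => g ord0 (rV_cons yx))) => //.
    exact: measurable_comp_cons.
  have -> : z = rV_cons ((0%R : 'rV[R]_0) : borel_rV R 0, (z : 'rV[R]_1) ord0 ord0).
    by apply/rowP => j; rewrite (ord1 j) rV_cons0.
  exact: line_integral_cons0.
under eq_integral do rewrite big_ord1 gE.
rewrite poweRe1; last by rewrite mule_ge0// integral_ge0.
under eq_integral do rewrite poweRe1 ?mule_ge0 ?integral_ge0//.
by rewrite ge0_integralZr// integral_ge0.
Qed.

Let PQ n : P n.+1 -> Q n.+1.
Proof.
move=> Pn g mg g0.
set r : R := (n.+1%:R^-1)%R.
have ml i : measurable_fun setT (line_integral i (g i)) by exact: measurable_line_integral.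
have l0 i z : 0 <= line_integral i (g i) z by exact: line_integral_ge0.
rewrite tonelli_outer; first last.
- by move=> z; exact: poweR_ge0.
- exact: measurable_poweR_prode.
(* A is the line integral in the first direction, independent of the first
   coordinate. *)
pose A (y : borel_rV R n.+1) := \int[lam]_t g ord0 (rV_cons (y, t)).
have mA : measurable_fun setT A.
  apply: (measurable_fun_fubini_tonelli_F (m2 := lam) (fun yx => g ord0 (rV_cons yx))) => //.
  exact: measurable_comp_cons.
have A0 y : 0 <= A y by exact: integral_ge0.
pose b (i : 'I_n.+1) x := \int[@borel_mu R n.+1]_y g (lift ord0 i) (rV_cons (y, x)).
have mb i : measurable_fun setT (b i : measurableTypeR R -> \bar R).
  apply: (measurable_fun_fubini_tonelli_G (m1 := @borel_mu R n.+1) (fun yx => g (lift ord0 i) (rV_cons yx))) => //.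
  exact: measurable_comp_cons.
have b0 i x : 0 <= b i x by exact: integral_ge0.
have IA : \int[@borel_mu R n.+1]_y A y = \int[@borel_mu R n.+2]_z g ord0 z by rewrite [RHS]tonelli_inner.
have Ib i : \int[lam]_x b i x = \int[@borel_mu R n.+2]_z g (lift ord0 i) z by rewrite tonelli_outer.
have IA0 : 0 <= \int[@borel_mu R n.+1]_y A y by exact: integral_ge0.
apply: (@le_trans _ _ (\int[lam]_x ((\int[@borel_mu R n.+1]_y A y) `^ r * (\prod_(i < n.+1) b i x) `^ r))).
  apply: ge0_le_integral => //.
  - by move=> x _; apply: integral_ge0 => y _; exact: poweR_ge0.
  - apply: (measurable_fun_fubini_tonelli_G (m1 := @borel_mu R n.+1) (fun yx => (\prod_(i < n.+2) line_integral i (g i) (rV_cons yx)) `^ r)) => //.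
      apply: measurable_poweR_prode => i.
      exact: measurable_comp_cons.
    by move=> z; exact: poweR_ge0.
  - by apply: measurable_funeM; exact: measurable_poweR_prode.
  - move=> x _; rewrite -poweRM//; last exact: prode_ge0.
    have := Pn A (fun i y => g (lift ord0 i) (rV_cons (y, x))) mA A0.
    move=> /(_ (fun i => measurable_slice _ (mg _)) (fun i y => g0 _ _)).
    apply: le_trans; rewrite le_eqVlt; apply/orP; left; apply/eqP.
    apply: eq_integral => y _; congr (_ `^ _).
    rewrite big_ord_recl line_integral_cons0; congr (_ * _).
    by apply: eq_bigr => i _; rewrite line_integral_consS.
rewrite ge0_integralZl ?poweR_ge0//; first last.
- by move=> x _; exact: poweR_ge0.
- exact: measurable_poweR_prode.
rewrite big_ord_recl poweRM ?integral_ge0//; last by apply: prode_ge0 => i _; exact: integral_ge0.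
rewrite -IA lee_wpmul2l ?poweR_ge0//.
apply: le_trans; first exact: (integral_geometric_mean _ mb).
by under eq_bigr do rewrite Ib.
Qed.

Let QP n : Q n.+1 -> P n.+2.
Proof.
move=> Qn A g mA A0 mg g0.
have ml i : measurable_fun setT (line_integral i (g i)) by exact: measurable_line_integral.
have l0 i z : 0 <= line_integral i (g i) z by exact: line_integral_ge0.
pose B z := (\prod_(i < n.+2) line_integral i (g i) z) `^ (n.+1%:R^-1).
have mB : measurable_fun setT B.
  exact: measurable_poweR_prode.
have B0 z : 0 <= B z by exact: poweR_ge0.
(* B enters n + 1 times, which undoes the (n + 1)-st root in the bound that Q
   gives for its integral. *)
pose a (i : 'I_n.+2) := if unlift ord0 i is Some _ then B else A.
have aE z : A z * \prod_(i < n.+2) line_integral i (g i) z = \prod_(i < n.+2) a i z.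
  rewrite [RHS]big_ord_recl /a unlift_none; congr (_ * _).
  under [RHS]eq_bigr do rewrite liftK.
  by rewrite prode_poweRV// prode_ge0.
under eq_integral do rewrite aE.
apply: le_trans; first apply: integral_geometric_mean.
- by move=> i; rewrite /a; case: unlift.
- by move=> i z; rewrite /a; case: unlift.
apply: le_poweR; [by rewrite invr_ge0| |].
  by apply: prode_ge0 => i _; apply: integral_ge0 => z _; rewrite /a; case: unlift.
rewrite big_ord_recl /a unlift_none lee_wpmul2l ?integral_ge0//.
under eq_bigr do rewrite liftK.
have := Qn g mg g0; rewrite -/B => hB.
have p0 : 0 <= \prod_(i < n.+2) \int[@borel_mu R n.+2]_z g i z.
  by apply: prode_ge0 => i _; exact: integral_ge0.
rewrite -[leRHS](prode_poweRV n)//.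
by apply: lee_prode => i; [by apply: integral_ge0 => z _; exact: B0|exact: hB].
Qed.

Let PnQn n : P n.+1 /\ Q n.+1.
Proof. by elim: n => [|n [_ /QP Pn]]; split=> //; apply: PQ => //; exact: P1_. Qed.

(** The exponent is 1 / (n - 1) for the dimension n written as n.+2.  The i-th
factor is constant along the i-th direction. *)
Theorem gagliardo_lines n (g : 'I_n.+2 -> borel_rV R n.+2 -> \bar R) :
  (forall i, measurable_fun setT (g i)) -> (forall i z, 0 <= g i z) ->
  \int[@borel_mu R n.+2]_z (\prod_(i < n.+2) line_integral i (g i) z) `^ (n.+1%:R^-1) <=
  (\prod_(i < n.+2) \int[@borel_mu R n.+2]_z g i z) `^ (n.+1%:R^-1).
Proof. by move=> mg g0; have [_] := PnQn n; apply. Qed.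

End gagliardo.

(** * Integration by parts for test functions *)
Section lines.
Context {R : realType}.
Local Notation lam := (@lebesgue_measure R).

Lemma FTC2_everywhere (F f : R -> R) a b : a < b ->
  (forall t : R, is_derive t 1 F (f t)) -> continuous f ->
  (\int[lam]_(t in `[a, b]) (f t)%:E = (F b - F a)%:E)%E.
Proof.
move=> ab dF cf.
have cF : continuous F.
  by move=> x; apply/differentiable_continuous/derivable1_diffP; have [] := dF x.
rewrite (@continuous_FTC2 _ f F)//.
- exact/continuous_subspaceT.
- split=> [x _||]; first by have [] := dF x.
  + by apply: cvg_at_right_filter; exact: cF.
  + by apply: cvg_at_left_filter; exact: cF.
- by move=> x _; rewrite derive1E; have [] := dF x.
Qed.

Lemma measurable_continuousE (f : R -> R) D : measurable D -> continuous f ->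
  measurable_fun D (fun t : measurableTypeR R => (f t)%:E).
Proof.
move=> mD cf; apply/measurable_EFinP; apply: measurable_funS (continuous_measurable_fun cf) => //.
Qed.

(** The integral of the derivative of a function with compact support vanishes.
It is stated for positive and negative parts because Tonelli's theorem is used
for nonnegative functions ([integral_partial]). *)
Lemma integral_derive_csupp (F f : R -> R) K : 0 < K ->
  (forall t : R, is_derive t 1 F (f t)) -> continuous f ->
  (forall t, K < `|t| -> F t = 0 /\ f t = 0) ->
  (\int[lam]_t (fun t => (f t)%:E)^\+ t = \int[lam]_t (fun t => (f t)%:E)^\- t)%E.
Proof.
move=> K0 dF cf F0.
pose M := K + 1.
have MM : - M < M by rewrite /M; lra.
have I0 : (\int[lam]_(t in `[(- M)%R, M]) (f t)%:E = 0)%E.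
  rewrite (FTC2_everywhere MM dF cf) (F0 M _).1 ?(F0 (- M) _).1 ?subrr//.
  - by rewrite normrN gtr0_norm /M; lra.
  - by rewrite gtr0_norm /M; lra.
have restr (g : R -> \bar R) : (forall t, K < `|t| -> g t = 0%E) ->
    (\int[lam]_t g t = \int[lam]_(t in `[(- M)%R, M]) g t)%E.
  move=> g0; rewrite [RHS]integral_mkcond; apply: eq_integral => t _.
  rewrite patchE; case: ifPn => //; rewrite notin_setE /= in_itv/= -ler_norml => /negP.
  by rewrite -ltNge => h; apply: g0; rewrite (lt_trans _ h)// /M ltrDl.
rewrite !restr; first last.
- by move=> t /F0[_ f0]; rewrite funepos.unlock f0 maxxx.
- by move=> t /F0[_ f0]; rewrite funeneg.unlock f0 oppe0 maxxx.
have fi : lam.-integrable `[(- M)%R, M] (EFin \o f).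
  by apply: continuous_compact_integrable; [exact: segment_compact|exact/continuous_subspaceT].
move: I0; rewrite integralE => /eqP.
rewrite sube_eq ?add0e//; last by rewrite integrable_pos_fin_num.
by move=> /eqP.
Qed.

(** Integrate the derivative from a point to the left of the support. *)
Lemma le_integral_derive_csupp (F f : R -> R) K x : 0 < K ->
  (forall t : R, is_derive t 1 F (f t)) -> continuous f ->
  (forall t, K < `|t| -> F t = 0 /\ f t = 0) ->
  (`|F x|%:E <= \int[lam]_t `|f t|%:E)%E.
Proof.
move=> K0 dF cf F0.
pose a := - (K + 1 + `|x|).
have ax : a < x by rewrite /a; have := ler_norm (- x); rewrite normrN; lra.
have Fa : F a = 0 by apply: (F0 a _).1; rewrite /a normrN gtr0_norm; have := normr_ge0 x; lra.
have := FTC2_everywhere ax dF cf; rewrite Fa subr0 => E.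
rewrite -abse_EFin -E.
apply: le_trans; first apply: le_abse_integral => //.
  by apply: measurable_continuousE.
apply: ge0_subset_integral => //.
by apply: measurable_continuousE => // t; apply: continuous_comp; [exact: cf|exact: norm_continuous].
Qed.

Context {n : nat}.
Implicit Types (phi : 'rV[R]_n -> R) (k : 'I_n).

Lemma updE (z : 'rV[R]_n) k t : upd z k t = t *: (delta_mx ord0 k : 'rV[R]_n) + upd z k 0.
Proof.
apply/rowP => j; rewrite !mxE/=.
by case: eqVneq => _; rewrite ?mulr1 ?addr0 ?mulr0 ?add0r.
Qed.

Lemma continuous_upd (z : 'rV[R]_n) k : continuous (upd z k).
Proof.
move=> t; rewrite (_ : upd z k = fun t => t *: (delta_mx ord0 k : 'rV[R]_n) + upd z k 0); last first.
  by apply/funext => s; exact: updE.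
by apply: cvgD; [apply: cvgZr_tmp; exact: cvg_id|exact: cvg_cst].
Qed.

Lemma is_derive_upd phi k z (t : R) : smooth phi ->
  is_derive t 1 (fun t => phi (upd z k t)) (partial k phi (upd z k t)).
Proof.
move=> sphi.
have E : (fun h : R => h^-1 *: (((fun t => phi (upd z k t)) \o shift t) (h *: (1:R)) - phi (upd z k t))) =
   (fun h : R => h^-1 *: ((phi \o shift (upd z k t)) (h *: (delta_mx ord0 k : 'rV[R]_n)) - phi (upd z k t))).
  apply/funext => h /=; congr (_ *: (phi _ - _)).
  by rewrite updE [in RHS]updE addrA -scalerDl [h *: (1:R)]mulr1.
apply: DeriveDef; last by rewrite /partial /derive E.
by have := @smooth_derivable _ _ _ k (upd z k t) sphi; rewrite /derivable E.
Qed.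

Lemma norm_upd (z : 'rV[R]_n) k t : `|t| <= `|upd z k t|.
Proof.
rewrite [leRHS]/Num.Def.normr/= mx_normrE.
have := @le_bigmax _ _ _ 0 (fun ij : 'I_1 * 'I_n => `|upd z k t ij.1 ij.2|) (ord0, k).
by rewrite /= mxE eqxx.
Qed.

Lemma smooth_partial_continuous phi k : smooth phi -> continuous (partial k phi).
Proof. by move=> s; apply: smooth_continuous; exact: smooth_partial. Qed.

Lemma test_fun_line Omega phi k z : test_fun Omega phi -> exists2 K, 0 < K &
  forall t, K < `|t| -> phi (upd z k t) = 0 /\ partial k phi (upd z k t) = 0.
Proof.
move=> /test_fun_bounded_support[K K0 hK]; exists K => // t Kt.
have /hK[-> h] : K < `|upd z k t| by exact: lt_le_trans (norm_upd _ _ _).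
by rewrite h.
Qed.

Lemma test_fun_le_line_integral Omega phi k z : test_fun Omega phi ->
  (`|phi z|%:E <= line_integral k (fun x => `|partial k phi x|%:E) z)%E.
Proof.
move=> tphi; have [s _ _] := tphi; have [K K0 hK] := test_fun_line k z tphi.
rewrite -{1}(upd_id z k).
apply: (le_integral_derive_csupp (F := fun t => phi (upd z k t)) _ K0) => //.
- by move=> t; exact: is_derive_upd.
- move=> t; apply: continuous_comp; first exact: continuous_upd.
  exact: smooth_partial_continuous.
Qed.

Lemma integral_partial Omega phi k : measurable (Omega : set (leb_rV R n)) ->
  test_fun Omega phi -> \int[leb R n]_(x in Omega) partial k phi x = 0.
Proof.
move=> mO tphi; have [s _ _] := tphi.
have cp : continuous (partial k phi) by exact: smooth_partial_continuous.
have mp : measurable_fun setT (EFin \o partial k phi : borel_rV R n -> \bar R).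
  by apply/measurable_EFinP; exact: continuous_measurable_rV.
have E : (\int[leb R n]_(x in Omega) (fun x => (partial k phi x)%:E)^\+ x =
          \int[leb R n]_(x in Omega) (fun x => (partial k phi x)%:E)^\- x)%E.
  have restr (g : 'rV[R]_n -> \bar R) : (forall x, ~ Omega x -> g x = 0%E) ->
      (\int[leb R n]_(x in Omega) g x = \int[leb R n]_x g x)%E.
    move=> g0; rewrite integral_mkcond; apply: eq_integral => x _.
    by rewrite patchE; case: ifPn => //; rewrite notin_setE => /g0.
  rewrite !restr; first last.
  - by move=> x /(test_fun_partial0 k tphi); rewrite funepos.unlock /= => ->; rewrite maxxx.
  - by move=> x /(test_fun_partial0 k tphi); rewrite funeneg.unlock /= => ->; rewrite ?oppe0 ?oppr0 maxxx.
  rewrite !ge0_integral_leb//; [|exact: measurable_funeneg|exact: measurable_funepos].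
  apply: (eq_integral_lines (k := k)) => //; [exact: measurable_funepos|exact: measurable_funeneg|].
  move=> z; have [K K0 hK] := test_fun_line k z tphi.
  have := @integral_derive_csupp (fun t => phi (upd z k t)) (fun t => partial k phi (upd z k t)) K K0.
  rewrite funepos.unlock funeneg.unlock; apply => //.
  - by move=> t; exact: is_derive_upd.
  - by move=> t; apply: continuous_comp; [exact: continuous_upd|exact: cp].
rewrite /Rintegral integralE E.
set I := (X in (X - _)%E); change (fine (I - I) = 0).
by case: I => [r| |]//=; rewrite subrr.
Qed.

End lines.

Section test_integrals.
Context {R : realType} {n : nat}.
Local Notation mu := (leb R n).
Local Notation Rn := 'rV[R]_n.

Lemma measurable_continuous_leb (g : Rn -> R) : continuous g ->
  measurable_fun setT (g : leb_rV R n -> R).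
Proof. by move=> cg; apply: measurable_fun_leb; exact: continuous_measurable_rV. Qed.

Lemma continuous_bounded_csupp (g : Rn -> R) K : continuous g ->
  (forall x, K < `|x| -> g x = 0) -> exists2 M, 0 < M & forall x, `|g x| <= M.
Proof.
move=> cg g0.
have cK : compact [set x : Rn | `|x| <= K].
  apply: bounded_closed_compact.
    by exists K; split; [exact: num_real|move=> M KM x /= /le_trans; apply; exact: ltW].
  apply: (@closed_comp _ _ (fun x : Rn => `|x|) [set t | t <= K]); last exact: closed_le.
  by move=> x _; exact: norm_continuous.
have /compact_bounded/pinfty_ex_gt0[M M0 hM] : compact (g @` [set x : Rn | `|x| <= K]).
  apply: continuous_compact cK; exact/continuous_subspaceT.
exists M => // x; have [xK|Kx] := leP `|x| K; first by apply: hM; exists x.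
by rewrite g0// normr0 ltW.
Qed.

Lemma leb_cbox (a b : Rn) : (mu (cbox a b) < +oo)%E.
Proof. by rewrite leb_borel; [exact: borel_lebesgue_cbox|exact: measurable_cbox]. Qed.

Lemma integrable_csupp (g : Rn -> R) K (D : set (leb_rV R n)) : measurable D -> continuous g ->
  (forall x, K < `|x| -> g x = 0) -> mu.-integrable D (EFin \o g).
Proof.
move=> mD cg g0; have [M M0 hM] := continuous_bounded_csupp cg g0.
have mg := measurable_continuous_leb cg.
apply: (@integrableS _ _ _ mu setT) => //.
apply/integrableP; split; first exact/measurable_EFinP.
have mB : measurable (cbox (const_mx (- K)) (const_mx K) : set (leb_rV R n)).
  by apply: measurable_leb; exact: measurable_cbox.
apply: (@le_lt_trans _ _ (\int[mu]_x ((M%:E * (\1_(cbox (const_mx (- K)) (const_mx K)) x)%:E)))%E).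
  apply: ge0_le_integral.
  - exact: measurableT.
  - by move=> x _; rewrite /= lee_fin.
  - by apply/measurable_EFinP; apply: measurableT_comp; [exact: normr_measurable|exact: mg].
  - by apply: measurable_funeM; apply/measurable_EFinP; exact: measurable_indic.
  - move=> x _; rewrite -EFinM lee_fin indicE.
    case: (boolP (x \in _)) => [_|]; first by rewrite mulr1.
    rewrite notin_setE => nx; rewrite mulr0 g0 ?normr0//.
    by rewrite ltNge; apply/negP => /cbox_norm.
rewrite ge0_integralZl_EFin; first last.
- exact: ltW.
- by apply/measurable_EFinP; exact: measurable_indic.
- by move=> x _; rewrite lee_fin.
- exact: measurableT.
rewrite integral_indic// setIT lte_mul_pinfty//; first by rewrite lee_fin ltW.
exact: leb_cbox.
Qed.

Lemma integrable_test (Omega : set Rn) (g phi : Rn -> R) (D : set (leb_rV R n)) : measurable D ->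
  continuous g -> test_fun Omega phi -> mu.-integrable D (EFin \o (fun x => g x * phi x)).
Proof.
move=> mD cg tphi; have [K K0 hK] := test_fun_bounded_support tphi.
apply: (integrable_csupp (K := K)) => //.
  by have [s _ _] := tphi; move=> x; apply: continuousM; [exact: cg|exact: smooth_continuous].
by move=> x /hK[-> _]; rewrite mulr0.
Qed.

Lemma integrable_partial (Omega : set Rn) (g phi : Rn -> R) k (D : set (leb_rV R n)) : measurable D ->
  continuous g -> test_fun Omega phi -> mu.-integrable D (EFin \o (fun x => g x * partial k phi x)).
Proof.
move=> mD cg tphi; have [K K0 hK] := test_fun_bounded_support tphi.
apply: (integrable_csupp (K := K)) => //.
  by have [s _ _] := tphi; move=> x; apply: continuousM; [exact: cg|exact: smooth_partial_continuous].
by move=> x /hK[_ ->]; rewrite mulr0.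
Qed.

(** Integration by parts: the partial derivative of the product phi psi, again a
test function, has integral 0. *)
Lemma test_fun_weak_partial (Omega : set Rn) phi k : measurable (Omega : set (leb_rV R n)) ->
  test_fun Omega phi -> is_weak_partial Omega k phi (partial k phi).
Proof.
move=> mO tphi psi tpsi.
have [s1 _ _] := tphi; have [s2 _ _] := tpsi.
have := integral_partial k mO (test_funMl s1 tpsi).
rewrite (_ : \int[mu]_(x in Omega) partial k (fun x => phi x * psi x) x =
   \int[mu]_(x in Omega) (phi x * partial k psi x) + \int[mu]_(x in Omega) (partial k phi x * psi x)).
  by move/eqP; rewrite addr_eq0 => /eqP.
rewrite -RintegralD//.
- by apply: eq_Rintegral => x _; rewrite partialM// (mulrC (psi x)).
- by apply: integrable_partial tpsi => //; exact: smooth_continuous.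
- by apply: integrable_test tpsi => //; exact: smooth_partial_continuous.
Qed.

End test_integrals.

(** * Gagliardo's inequality for test functions *)
Section gagliardo_test.
Context {R : realType} {n : nat}.
Local Open Scope ereal_scope.

(** At each point, |phi_i| is at most the integral of |D_i phi_i| along the line
in direction i. *)
Lemma gagliardo_test (Omega : set 'rV[R]_n.+2) (phi : 'I_n.+2 -> 'rV[R]_n.+2 -> R) :
  measurable (Omega : set (leb_rV R n.+2)) -> (forall i, test_fun Omega (phi i)) ->
  \int[leb R n.+2]_(x in Omega) (\prod_(i < n.+2) `|phi i x|%:E) `^ (n.+1%:R^-1) <=
  (\prod_(i < n.+2) \int[leb R n.+2]_(x in Omega) `|partial i (phi i) x|%:E) `^ (n.+1%:R^-1).
Proof.
move=> mO tphi.
have sphi i : smooth (phi i) by have [] := tphi i.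
have restr (g : 'rV[R]_n.+2 -> \bar R) : (forall x, ~ Omega x -> g x = 0) ->
    \int[leb R n.+2]_(x in Omega) g x = \int[leb R n.+2]_x g x.
  move=> g0; rewrite integral_mkcond; apply: eq_integral => x _.
  by rewrite patchE; case: ifPn => //; rewrite notin_setE => /g0.
have m1 i : measurable_fun setT (fun x : borel_rV R n.+2 => `|phi i x|%:E).
  apply/measurable_EFinP; apply: continuous_measurable_rV => x.
  by apply: continuous_comp; [exact: smooth_continuous|exact: norm_continuous].
have m2 i : measurable_fun setT (fun x : borel_rV R n.+2 => `|partial i (phi i) x|%:E).
  apply/measurable_EFinP; apply: continuous_measurable_rV => x.
  by apply: continuous_comp; [exact: smooth_partial_continuous|exact: norm_continuous].
rewrite restr; last first.
  move=> x nO; rewrite (ge0_prode_eq0 (i := ord0)) ?poweR0r ?invr_neq0 ?pnatr_eq0//.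
  by rewrite (test_fun0 (tphi ord0) nO) normr0.
rewrite ge0_integral_leb; first last.
- by move=> z; exact: poweR_ge0.
- exact: measurable_poweR_prode.
under [X in _ <= X `^ _]eq_bigr => i _.
  rewrite restr; last by move=> x nO; rewrite (test_fun_partial0 i (tphi i) nO) normr0.
  rewrite ge0_integral_leb//.
  over.
apply: le_trans (gagliardo_lines m2 _); last by move=> i z; rewrite lee_fin.
apply: ge0_le_integral => //.
- by move=> x _; exact: poweR_ge0.
- exact: measurable_poweR_prode.
- apply: measurable_poweR_prode => i; apply: measurable_line_integral => // z; by rewrite lee_fin.
- move=> x _; apply: le_poweR; first by rewrite invr_ge0.
    by apply: prode_ge0 => i _; rewrite lee_fin.
  apply: lee_prode => i; first by rewrite lee_fin.
  exact: test_fun_le_line_integral (tphi i).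
Qed.

End gagliardo_test.

Section almost_everywhere_rV.
Context {R : realType} {n : nat}.
Local Notation mu := (leb R n).
Implicit Types P Q S : 'rV[R]_n -> Prop.

(** Sets of row vectors carry several structures; these rules fix the one with
the Lebesgue measure. *)
Lemma ae_mono P Q : {ae mu, forall x, P x} -> (forall x, P x -> Q x) -> {ae mu, forall x, Q x}.
Proof. by move=> p PQ; apply: (@filterS (leb_rV R n) (almost_everywhere mu) _ P Q PQ p). Qed.

Lemma ae_mono2 P Q S : {ae mu, forall x, P x} -> {ae mu, forall x, Q x} ->
  (forall x, P x -> Q x -> S x) -> {ae mu, forall x, S x}.
Proof.
by move=> p q PQS; apply: (@filterS2 (leb_rV R n) (almost_everywhere mu) _ P Q S PQS p q).
Qed.

Lemma ae_all P : (forall x, P x) -> {ae mu, forall x, P x}.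
Proof. by move=> p; apply: aeW. Qed.

Lemma ae_forall_ord m (P : 'I_m -> 'rV[R]_n -> Prop) :
  (forall i, {ae mu, forall x, P i x}) -> {ae mu, forall x, forall i, P i x}.
Proof.
elim: m P => [|m IH] P h; first by apply: ae_all => x [].
apply: (ae_mono2 (h ord0) (IH (fun i => P (lift ord0 i)) (fun i => h _))) => x h0 hS i.
by case: (unliftP ord0 i) => [j ->|->].
Qed.

End almost_everywhere_rV.

(** * The fundamental lemma of the calculus of variations *)
Section fundamental.
Context {R : realType} {n : nat}.
Local Notation Rn := 'rV[R]_n.
Local Notation mu := (leb R n).
Local Open Scope ereal_scope.

(** The measure is used on Borel sets only, where uniqueness of measures is
available from the generators below. *)
Lemma borel_density (f : leb_rV R n -> \bar R) :
  measurable_fun setT f -> (forall x, 0 <= f x) ->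
  exists m : {measure set (borel_rV R n) -> \bar R}, forall A, m A = \int[mu]_(x in A) f x.
Proof.
move=> mf f0.
pose dens (A : set (borel_rV R n)) := \int[mu]_(x in A) f x.
have d0 : dens set0 = 0 by exact: integral_set0.
have dge0 A : 0 <= dens A by apply: integral_ge0 => x _; exact: f0.
have dsa : semi_sigma_additive dens.
  move=> F mF tF _; rewrite /dens ge0_integral_bigcup//.
  - by apply: is_cvg_ereal_nneg_natsum => k _; exact: dge0.
  - by move=> k; apply: measurable_leb; exact: mF.
  - exact: measurable_funTS.
pose m : {measure set (borel_rV R n) -> \bar R} :=
  HB.pack_for {measure set (borel_rV R n) -> \bar R} dens (isMeasure.Build _ _ _ dens d0 dge0 dsa).
by exists m.
Qed.

(** The coordinates may be bounded below by -oo, so that the whole space is an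
orthant and orthants are closed under intersection. *)
Definition orthant (c : 'I_n -> \bar R) : set (borel_rV R n) :=
  [set x : Rn | forall i, c i < (x ord0 i)%:E].

Lemma measurable_orthantE : @measurable _ (borel_rV R n) = <<s range orthant >>.
Proof.
apply/seteqP; split; last first.
  apply: smallest_sub; first exact: sigma_algebra_measurable.
  move=> _ [c _ <-].
  rewrite (_ : orthant c = \bigcap_(i in [set: 'I_n]) ((fun x : Rn => (x ord0 i)) @^-1` [set t | c i < t%:E])); last first.
    by apply/seteqP; split=> x /= h i; [move=> _; exact: h|exact: h].
  apply: fin_bigcap_measurable => // i _; rewrite -[X in measurable X]setTI.
  apply: (@measurable_coord R n i) => //.
  case: (c i) => [r| |].
  - rewrite (_ : [set t | _] = `]r, +oo[%classic)//.
    by apply/seteqP; split=> t /=; rewrite lte_fin in_itv/= andbT.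
  - rewrite (_ : [set t | _] = set0)//.
    by apply/seteqP; split=> t.
  - rewrite (_ : [set t | _] = setT)//.
    by apply/seteqP; split=> t //= _; rewrite ltNyr.
apply: smallest_sub; first exact: smallest_sigma_algebra.
rewrite -bigcup_seq => _ [i _ [B mB <-]].
rewrite setTI.
have mc : measurable_fun setT (fun x : g_sigma_algebraType (range orthant) => (x : Rn) ord0 i : R).
  apply: (measurability _ (RGenOInfty.measurableE R)) => _ [_ [c ->] <-].
  rewrite setTI; apply: sub_sigma_algebra.
  exists (fun j => if j == i then c%:E else -oo) => //.
  apply/seteqP; split=> x /=.
    by move=> /(_ i); rewrite eqxx lte_fin in_itv/= andbT.
  by rewrite in_itv/= andbT => h j; case: eqP => [->|_]; rewrite ?lte_fin// ltNyr.
by have := mc measurableT _ mB; rewrite setTI.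
Qed.

Lemma orthantI : setI_closed (range orthant).
Proof.
move=> _ _ [c _ <-] [c' _ <-]; exists (fun i => maxe (c i) (c' i)) => //.
apply/seteqP; split=> x /= h.
  by split=> i; have := h i; rewrite gt_max => /andP[].
by move=> i; rewrite gt_max h.1 h.2.
Qed.

Lemma orthant_box c (a b : Rn) : (orthant c `&` box a b = set0) \/
  exists a' : Rn, [/\ orthant c `&` box a b = box a' b, forall i, (a' ord0 i <= b ord0 i)%R &
    cbox a' b `<=` cbox a b].
Proof.
have [[x0 [cx0 abx0]]|] := pselect (exists x, (orthant c `&` box a b) x); last first.
  by move=> h; left; apply/seteqP; split=> x // h'; apply: h; exists x.
right; pose m i := fine (maxe (c i) (a ord0 i)%:E).
have mE i : (m i)%:E = maxe (c i) (a ord0 i)%:E.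
  rewrite /m fineK// fin_numElt; apply/andP; split.
    by rewrite lt_max ltNyr orbT.
  by rewrite gt_max ltry andbT (lt_trans (cx0 i))// ltry.
have mlt i (t : R) : (m i < t)%R = (c i < t%:E) && (a ord0 i < t)%R.
  by rewrite -lte_fin mE gt_max lte_fin.
exists (\row_i m i); split.
- apply/seteqP; split=> x /=.
    by move=> [cx abx] i; rewrite mxE mlt (cx i); exact: abx.
  move=> mbx; split=> i; have := mbx i; rewrite mxE mlt => /andP[/andP[h1 h2] h3] //.
  by rewrite h2 h3.
- move=> i; have /andP[h1 h2] := abx0 i.
  by rewrite mxE ltW// mlt (lt_trans h1 h2) andbT (lt_trans (cx0 i))// lte_fin.
- move=> x /= h i; have := h i; rewrite mxE => /andP[h1 ->]; rewrite andbT.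
  by rewrite (le_trans _ h1)// -lee_fin mE le_max lexx orbT.
Qed.

(** Lebesgue sets are Caratheodory measurable for the outer measure, hence the
intersection of Borel covers whose measures approach that of E. *)
Lemma leb_hull (E : set (leb_rV R n)) : measurable E -> mu E < +oo ->
  exists H : set (borel_rV R n), [/\ measurable H, E `<=` H & mu (H `\` E) = 0].
Proof.
move=> mE Eoo.
(* Covers of E by countably many Borel sets with total measure close to mu E. *)
have /choice[H hH] : forall j : nat, exists H : set (borel_rV R n),
   [/\ measurable H, E `<=` H & mu H <= mu E + (j.+1%:R^-1)%:E].
  move=> j.
  have muE : mu E = mu_ext (borel_lebesgue R n) E by rewrite /leb/= /completed_measure_extension.
  have fE : mu E \is a fin_num by rewrite ge0_fin_numE.
  have j0 : (0 < j.+1%:R^-1 :> R)%R by rewrite invr_gt0.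
  have fE' := fE; rewrite muE /mu_ext in fE'.
  have [_ [A [mA EA] <-]] := lb_ereal_inf_adherent j0 fE'.
  rewrite -[X in _ < X + _]/(mu_ext (borel_lebesgue R n) E) -muE => hA.
  exists (\bigcup_k A k); split=> //; first exact: bigcupT_measurable.
  rewrite (le_trans _ (ltW hA))// leb_borel; last exact: bigcupT_measurable.
  by apply: (measure_sigma_subadditive _ mA) => //; exact: bigcupT_measurable.
have mH j : measurable (H j) by have [] := hH j.
have mH' : measurable (\bigcap_j H j) by exact: bigcapT_measurable.
exists (\bigcap_j H j); split => //; first by move=> x Ex j _; have [_ + _] := hH j; exact.
have le0 : mu (\bigcap_j H j) <= mu E.
  apply/lee_addgt0Pr => e e0.
  have [j je] : exists j : nat, (j.+1%:R^-1 <= e)%R.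
    have [j hj] : exists j : nat, (e^-1 < j.+1%:R)%R.
      by exists (Num.trunc e^-1); rewrite truncnS_gt.
    by exists j; rewrite invf_ple ?posrE// ltW.
  apply: (@le_trans _ _ (mu (H j))).
    by apply: le_measure; rewrite ?inE; [exact: measurable_leb|exact: measurable_leb|exact: bigcap_inf].
  by have [_ _ h] := hH j; rewrite (le_trans h)// leeD2l// lee_fin.
have mHl := measurable_leb mH'.
rewrite measureD//; last exact: (le_lt_trans le0 Eoo).
rewrite setIidr; last by move=> x Ex j _; have [_ + _] := hH j; exact.
apply/eqP; rewrite eq_le; apply/andP; split.
  by rewrite lee_subel_addr ?add0e// ge0_fin_numE//.
rewrite sube_ge0 ?ge0_fin_numE ?Eoo//.
apply: le_measure; rewrite ?inE//.
by move=> x Ex j _; have [_ + _] := hH j; exact.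
Qed.

Variable Omega : set (leb_rV R n).
Hypothesis mO : measurable Omega.

(** Limit of the orthogonality to the bumps, dominated by |g|. *)
Lemma integral_box_eq0 (g : Rn -> R) (a b : Rn) :
  mu.-integrable Omega (EFin \o g) ->
  (forall phi, test_fun Omega phi -> (\int[mu]_(x in Omega) (g x * phi x) = 0)%R) ->
  (forall i, (a ord0 i <= b ord0 i)%R) -> cbox a b `<=` Omega ->
  \int[mu]_(x in box a b) (g x)%:E = 0.
Proof.
move=> ig g0 ab abO.
have mb : measurable (box a b : set (leb_rV R n)) by apply: measurable_leb; exact: measurable_box.
have bO : box a b `<=` Omega by apply: subset_trans abO; exact: box_cbox.
have mg : measurable_fun Omega (g : leb_rV R n -> R).
  by apply/measurable_EFinP; exact: measurable_int ig.
have mbump N : measurable_fun Omega (box_bump a b N : leb_rV R n -> R).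
  apply: measurable_funTS; apply: measurable_continuous_leb; apply: smooth_continuous.
  by have [] := test_fun_box_bump N ab abO.
pose F N (x : leb_rV R n) : \bar R := (g x * box_bump a b N x)%:E.
have bnd N x : `|F N x| <= `|(g x)%:E|.
  rewrite /F /= lee_fin normrM -[leRHS]mulr1 ler_wpM2l//.
  by have /andP[h1 h2] := box_bump_ge0_le1 a b N x; rewrite ger0_norm.
have I0 N : \int[mu]_(x in Omega) F N x = 0.
  have iF : mu.-integrable Omega (F N).
    apply: (le_integrable mO _ _ ig); first by apply/measurable_EFinP; exact: measurable_funM.
    by move=> x _; exact: bnd.
  have := g0 _ (test_fun_box_bump N ab abO); rewrite /Rintegral => h.
  by rewrite -[LHS]fineK ?integrable_fin_num// h.
have mlim : measurable_fun Omega (fun x : leb_rV R n => (g x * \1_(box a b) x)%:E).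
  apply/measurable_EFinP; apply: measurable_funM => //.
have lim x : Omega x -> F N x @[N --> \oo] --> (g x * \1_(box a b) x)%:E.
  by move=> Ox; apply/cvg_EFin; [exact: nearW|]; apply: cvgMr; exact: box_bump_cvg.
have [_ _] := @dominated_convergence _ _ _ mu Omega mO F (fun x => (g x * \1_(box a b) x)%:E)
  (fun x => `|(g x)%:E|) (fun N => (measurable_EFinP _ _).2 (measurable_funM mg (mbump N))) mlim
  (aeW mu lim) (integrable_abse ig) (aeW mu (fun x N Ox => bnd N x)).
under eq_fun do rewrite I0.
move=> h; have := cvg_unique _ h (cvg_cst 0) => /(_ (@ereal_hausdorff R)) h'.
rewrite -[RHS]h' -[in LHS](setIidr bO) integral_mkcondr.
apply: eq_integral => x _; rewrite patchE indicE.
by case: ifPn => xab; rewrite ?mulr1 ?mulr0.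
Qed.

(** The positive and the negative part of g are densities of two finite measures
on the box.  They agree on intersections with orthants, which are boxes, hence
on all Borel sets. *)
Lemma integral_borel_box_eq0 (g : Rn -> R) (a b : Rn) (A : set (borel_rV R n)) :
  mu.-integrable Omega (EFin \o g) ->
  (forall phi, test_fun Omega phi -> (\int[mu]_(x in Omega) (g x * phi x) = 0)%R) ->
  cbox a b `<=` Omega -> measurable A ->
  \int[mu]_(x in A `&` box a b) (g x)%:E = 0.
Proof.
move=> ig g0 abO mA.
have mb : measurable (box a b : set (leb_rV R n)) by apply: measurable_leb; exact: measurable_box.
have bO : box a b `<=` Omega by apply: subset_trans abO; exact: box_cbox.
have igb : mu.-integrable (box a b) (EFin \o g) by exact: integrableS ig.
have mgb := measurable_int _ igb.
have [m1 hm1] := borel_density ((measurable_restrictT _ mb).1 (measurable_funepos mgb)) (erestrict_ge0 (fun x _ => funepos_ge0 _ x)).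
have [m2 hm2] := borel_density ((measurable_restrictT _ mb).1 (measurable_funeneg mgb)) (erestrict_ge0 (fun x _ => funeneg_ge0 _ x)).
have m1E C : m1 C = \int[mu]_(x in C `&` box a b) (EFin \o g)^\+ x by rewrite hm1 integral_mkcondr.
have m2E C : m2 C = \int[mu]_(x in C `&` box a b) (EFin \o g)^\- x by rewrite hm2 integral_mkcondr.
have mI C : measurable (C : set (borel_rV R n)) -> measurable (C `&` box a b : set (leb_rV R n)).
  by move=> mC; apply: measurableI => //; exact: measurable_leb.
have igI C : measurable (C : set (borel_rV R n)) -> mu.-integrable (C `&` box a b) (EFin \o g).
  by move=> mC; apply: integrableS igb => //; exact: mI.
have E C : measurable (C : set (borel_rV R n)) ->
    (m1 C = m2 C <-> \int[mu]_(x in C `&` box a b) (g x)%:E = 0).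
  move=> mC; rewrite m1E m2E [X in _ <-> X = 0]integralE; split=> [->|/eqP].
    set I := (X in (X - _)); change (I - I = 0); rewrite subee//.
    by apply: integrable_neg_fin_num; [exact: mI|exact: igI].
  rewrite sube_eq ?add0e; first by move/eqP.
    by apply: integrable_pos_fin_num; [exact: mI|exact: igI].
  rewrite fin_num_adde_defr//.
apply/E => //.
apply: (@measure_unique _ _ _ (range (@orthant)) (fun=> setT)) => //.
- exact: measurable_orthantE.
- exact: orthantI.
- by move=> _; exists (fun=> -oo) => //; apply/seteqP; split=> // x _ i; rewrite ltNyr.
- by rewrite bigcup_const//; exists 0%N.
- move=> _ [c _ <-].
  apply/E; first by rewrite measurable_orthantE; apply: sub_sigma_algebra; exists c.
  have [->|[a' [-> ab' abO']]] := orthant_box c a b; first by rewrite integral_set0.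
  by apply: integral_box_eq0 => //; exact: subset_trans abO.
- by move=> _; rewrite m1E ltey_eq integrable_pos_fin_num//; [exact: mI|exact: igI].
Qed.

(** A Lebesgue subset of a box differs by a null set from its Borel hull, so g has
integral 0 on all of them and vanishes almost everywhere in the box; countably
many boxes cover the open set. *)
Lemma du_bois_reymond (g : Rn -> R) : open (Omega : set Rn) ->
  mu.-integrable Omega (EFin \o g) ->
  (forall phi, test_fun Omega phi -> (\int[mu]_(x in Omega) (g x * phi x) = 0)%R) ->
  {ae mu, forall x, Omega x -> g x = 0%R}.
Proof.
move=> oO ig g0.
have box0 (a b : Rn) : cbox a b `<=` Omega -> {ae mu, forall x, box a b x -> g x = 0%R}.
  move=> abO.
  have mb : measurable (box a b : set (leb_rV R n)) by apply: measurable_leb; exact: measurable_box.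
  have bO : box a b `<=` Omega by apply: subset_trans abO; exact: box_cbox.
  have igb : mu.-integrable (box a b) (EFin \o g) by exact: integrableS ig.
  have : ae_eq mu (box a b) (EFin \o g) (cst 0).
    apply: integral_ae_eq => // E Eb mE.
    have Eoo : mu E < +oo.
      apply: le_lt_trans (leb_cbox a b); apply: le_measure; rewrite ?inE//.
        by apply: measurable_leb; exact: measurable_cbox.
      by apply: subset_trans Eb _; exact: box_cbox.
    have [H [mH EH HE0]] := leb_hull mE Eoo.
    have mHl := measurable_leb mH.
    rewrite integral0 -(integral_borel_box_eq0 ig g0 abO mH).
    rewrite [RHS](@negligible_integral _ _ _ mu _ (H `\` E) (fun x => (g x)%:E))//.
    - congr (integral _ _ _); apply/seteqP; split=> x /=.
        by move=> Ex; split; [split; [exact: EH|exact: Eb]|case].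
      by move=> [[Hx bx]] /not_andP[//|/contrapT].
    - exact: measurableD.
    - exact: measurableI.
    - by apply: integrableS igb => //; exact: measurableI.
  by move=> /ae_mono; apply => x h bx; have := h bx => -[].
pose D (ab : 'rV[rat]_n * 'rV[rat]_n) := cbox (map_mx ratr ab.1 : Rn) (map_mx ratr ab.2) `<=` Omega.
pose B (k : nat) : set Rn := if unpickle k is Some ab then
   if `[< D ab >] then box (map_mx ratr ab.1) (map_mx ratr ab.2) else set0 else set0.
have : {ae mu, forall x, forall k, B k x -> g x = 0%R}.
  apply: ae_foralln => k; rewrite /B; case: unpickle => [ab|]; last exact: nearW.
  by case: asboolP => [Dab|_]; [exact: box0|exact: nearW].
move=> /ae_mono; apply => x h Ox.
have [a [b [_ abx abO]]] := open_box oO Ox.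
by apply: (h (pickle (a, b))); rewrite /B pickleK; case: asboolP => // /(_ abO).
Qed.

End fundamental.

(** * Lebesgue spaces on an open set *)
Section Lp_spaces.
Context {R : realType} {n : nat}.
Local Notation Rn := 'rV[R]_n.
Local Notation mu := (leb R n).
Variable Omega : set (leb_rV R n).
Hypothesis mO : measurable Omega.

Lemma Lp1P (f : Rn -> R) : Lp Omega 1 f <-> mu.-integrable Omega (EFin \o f).
Proof.
rewrite /Lp/= (integrable_mkcond (EFin \o f : leb_rV R n -> \bar R) mO) restrict_EFin.
exact: Lfun1_integrable.
Qed.

Lemma LpP (r : R) (f : Rn -> R) : 0 < r -> Lp Omega r f <->
  meas_on Omega f /\ (\int[mu]_(x in Omega) (`|f x| `^ r)%:E < +oo)%E.
Proof.
move=> r0.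
have E : ('N[mu]_r%:E[EFin \o (f \_ Omega)] < +oo <-> \int[mu]_(x in Omega) (`|f x| `^ r)%:E < +oo)%E.
  rewrite unlock.
  have -> : (\int[mu]_x `|(EFin \o f \_ Omega) x| `^ r = \int[mu]_(x in Omega) (`|f x| `^ r)%:E)%E.
    rewrite [RHS]integral_mkcond; apply: eq_integral => x _.
    rewrite /= !patchE; case: ifPn => _ //.
    by rewrite normr0 powR0 ?gt_eqF.
  split; first by move=> /lty_poweRy; apply; rewrite invr_neq0// gt_eqF.
  exact: poweR_lty.
rewrite /Lp/= /meas_on; split.
  rewrite inE => /andP[]; rewrite !inE /= => mf /E If; split=> //.
  exact/(measurable_restrictT _ mO).
move=> [mf /E If]; rewrite inE; apply/andP; split; rewrite inE//=.
exact/(measurable_restrictT _ mO).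
Qed.

End Lp_spaces.

(** * Weak derivatives and the space W^{1,1}_0 *)
Section vanishing.
Context {R : realType}.
Local Open Scope ereal_scope.

(** Convergence to 0 for nonnegative extended reals, in the form in which it is
used in estimates ([vanishingP]). *)
Definition vanishing (a : nat -> \bar R) :=
  forall e : R, (0 < e)%R -> exists N, forall j, (N <= j)%N -> a j <= e%:E.

Lemma vanishingP (a : nat -> \bar R) : (forall j, 0 <= a j) ->
  a j @[j --> \oo] --> 0 <-> vanishing a.
Proof.
move=> a0; split=> [h e e0|h].
  have /h[N _ hN] : nbhs (0 : \bar R) [set x | x < e%:E].
    by apply: open_nbhs_nbhs; split; [exact: open_ereal_lt_ereal|rewrite /= lte_fin].
  by exists N => j Nj; apply: ltW; exact: hN.
apply/fine_cvgP; split.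
  have [N hN] := h 1%R ltr01; exists N => // j /= Nj.
  by rewrite ge0_fin_numE// (le_lt_trans (hN _ Nj))// ltry.
apply/cvgrPdist_le => e e0; have [N hN] := h e e0; exists N => // j /= Nj.
have aj : a j = (fine (a j))%:E.
  by rewrite fineK// ge0_fin_numE// (le_lt_trans (hN _ Nj))// ltry.
rewrite sub0r normrN ger0_norm ?fine_ge0// -lee_fin -aj; exact: hN.
Qed.

Lemma vanishing_le (a b : nat -> \bar R) : (forall j, a j <= b j) ->
  vanishing b -> vanishing a.
Proof.
by move=> ab h e /h[N hN]; exists N => j /hN; apply: le_trans.
Qed.

Lemma vanishingD (a b : nat -> \bar R) : vanishing a -> vanishing b ->
  vanishing (fun j => a j + b j).
Proof.
move=> ha hb e e0; have e2 : (0 < e / 2)%R by rewrite divr_gt0.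
have [N hN] := ha _ e2; have [M hM] := hb _ e2.
exists (maxn N M) => j; rewrite geq_max => /andP[/hN h1 /hM h2].
by rewrite [e]splitr EFinD leeD.
Qed.

Lemma vanishingZ (C : R) (a : nat -> \bar R) : (0 <= C)%R -> vanishing a ->
  vanishing (fun j => C%:E * a j).
Proof.
move=> C0 ha e e0; have [N hN] := ha (e / (C + 1))%R (divr_gt0 e0 (ltr_wpDl C0 ltr01)).
exists N => j /hN h; apply: (le_trans (lee_wpmul2l _ h)); first by rewrite lee_fin.
by rewrite -EFinM lee_fin mulrCA ger_pMr// ler_pdivrMr ?mul1r; lra.
Qed.

Lemma vanishing_sum m (a : 'I_m -> nat -> \bar R) : (forall k, vanishing (a k)) ->
  vanishing (fun j => \sum_(k < m) a k j).
Proof.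
move=> ha; elim: m a ha => [|m IH] a ha.
  by move=> e e0; exists 0%N => j _; rewrite big_ord0 lee_fin ltW.
apply: (vanishing_le (b := fun j => a ord0 j + \sum_(k < m) a (lift ord0 k) j)).
  by move=> j; rewrite big_ord_recl.
by apply: vanishingD => //; exact: IH.
Qed.

Lemma vanishing_comp (s : nat -> nat) (a : nat -> \bar R) : (forall j, (j <= s j)%N) ->
  vanishing a -> vanishing (fun j => a (s j)).
Proof.
move=> hs ha e /ha[N hN]; exists N => j Nj; apply: hN; exact: leq_trans (hs j).
Qed.

Context d (T : measurableType d) (mu : {measure set T -> \bar R}) (D : set T).
Hypothesis mD : measurable D.

(** Along a subsequence the L^1 distances are summable; then the sum of the
pointwise distances is integrable, hence finite almost everywhere. *)
Lemma L1_subseq_ae (f_ : nat -> T -> R) (f : T -> R) :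
  (forall j, measurable_fun D (f_ j)) -> measurable_fun D f ->
  vanishing (fun j => \int[mu]_(x in D) `|f_ j x - f x|%:E) ->
  exists s : nat -> nat, (forall j, (j <= s j)%N) /\
    {ae mu, forall x, D x -> f_ (s j) x @[j --> \oo] --> f x}.
Proof.
move=> mf_ mf h.
have /choice[s hs] : forall j : nat, exists s, (j <= s)%N /\
    \int[mu]_(x in D) `|f_ s x - f x|%:E <= (1 / (2 ^ j.+1)%:R)%:E.
  move=> j; have [|N hN] := h (1 / (2 ^ j.+1)%:R)%R; first by rewrite divr_gt0// ltr0n expn_gt0.
  by exists (maxn N j); rewrite leq_maxr; split=> //; apply: hN; rewrite leq_maxl.
exists s; split; first by move=> j; have [] := hs j.
pose u j (x : T) : \bar R := `|f_ (s j) x - f x|%:E.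
have mu_ j : measurable_fun D (u j).
  apply/measurable_EFinP; apply: measurableT_comp; first exact: normr_measurable.
  exact: measurable_funB.
have u0 j x : 0 <= u j x by rewrite lee_fin.
have isum : \int[mu]_(x in D) (\sum_(0 <= j <oo) u j x) < +oo.
  rewrite integral_nneseries//.
  apply: (@le_lt_trans _ _ (\sum_(0 <= j <oo) (1 / (2 ^ j.+1)%:R)%:E)).
    by apply: lee_nneseries => j _; [move=> _; exact: integral_ge0|have [] := hs j].
  by apply: le_lt_trans (epsilon_trick0 _ ler01) _; rewrite ltry.
have msum : measurable_fun D (fun x => \sum_(0 <= j <oo) u j x).
  by apply: ge0_emeasurable_sum => // k x _ _; exact: u0.
have : mu.-integrable D (fun x => \sum_(0 <= j <oo) u j x).
  apply/integrableP; split => //.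
  by under eq_integral do rewrite gee0_abs ?nneseries_ge0//.
move=> /(integrable_ae mD); apply: filterS => x hx /hx {hx}.
set S := \sum_(0 <= j <oo) u j x => Sfin.
have cs : cvgn (series (fun j => `|f_ (s j) x - f x|%R)).
  apply: nondecreasing_is_cvgn.
    by apply/nondecreasing_seqP => k; rewrite !seriesEnat/= big_nat_recr//= lerDl.
  exists (fine S) => _ [k _ <-]; rewrite -lee_fin fineK// seriesEnat/= -sumEFin.
  exact: nneseries_lim_ge.
have := cvg_series_cvg_0 cs.
move=> /cvgr0Pnorm_le c; apply/cvgrPdist_le => e e0.
have := c e e0; apply: filterS => k /=.
by rewrite normr_id distrC.
Qed.

End vanishing.

Section weak_derivatives.
Context {R : realType} {n : nat}.
Local Notation Rn := 'rV[R]_n.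
Local Notation mu := (leb R n).
Variable Omega : set (leb_rV R n).
Hypothesis oO : open (Omega : set Rn).
Implicit Types (v w g : Rn -> R) (k : 'I_n).

Let mO : measurable Omega.
Proof. by apply: measurable_leb; exact: open_measurable_rV. Qed.

Local Notation L1 f := (mu.-integrable Omega (EFin \o f)).

Lemma L1_measurable v : L1 v -> measurable_fun Omega v.
Proof. by move=> /measurable_int/measurable_EFinP. Qed.

Lemma measurable_abs v : measurable_fun Omega v ->
  measurable_fun Omega (fun x => `|v x|%:E).
Proof.
move=> mv; apply/measurable_EFinP.
exact: (measurableT_comp (@normr_measurable R setT) mv).
Qed.

Lemma L1_bddM g (h : Rn -> R) M : L1 g -> measurable_fun Omega h ->
  (forall x, `|h x| <= M) -> L1 (fun x => g x * h x).
Proof.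
move=> ig mh hM; have M0 : 0 <= M by exact: le_trans (hM 0).
apply: (le_integrable mO (g := fun x => (M%:E * (EFin \o g) x)%E)).
- by apply/measurable_EFinP; apply: measurable_funM => //; exact: L1_measurable.
- by move=> x _; rewrite /= lee_fin !normrM (ger0_norm M0) mulrC ler_wpM2r.
- exact: integrableZl.
Qed.

Lemma test_bounded phi : test_fun Omega phi -> exists2 M, 0 < M & forall x, `|phi x| <= M.
Proof.
move=> tphi; have [s _ _] := tphi; have [K K0 hK] := test_fun_bounded_support tphi.
apply: (continuous_bounded_csupp (K := K)); first exact: smooth_continuous.
by move=> x /hK[].
Qed.

Lemma partial_bounded k phi : test_fun Omega phi ->
  exists2 M, 0 < M & forall x, `|partial k phi x| <= M.
Proof.
move=> tphi; have [s _ _] := tphi; have [K K0 hK] := test_fun_bounded_support tphi.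
apply: (continuous_bounded_csupp (K := K)); first exact: smooth_partial_continuous.
by move=> x /hK[].
Qed.

Lemma measurable_test phi : test_fun Omega phi -> measurable_fun Omega phi.
Proof.
by move=> [s _ _]; apply: measurable_funTS; apply: measurable_continuous_leb; exact: smooth_continuous.
Qed.

Lemma measurable_partial k phi : test_fun Omega phi -> measurable_fun Omega (partial k phi).
Proof.
move=> [s _ _]; apply: measurable_funTS; apply: measurable_continuous_leb.
exact: smooth_partial_continuous.
Qed.

Lemma L1_Mtest g phi : L1 g -> test_fun Omega phi -> L1 (fun x => g x * phi x).
Proof.
move=> ig tphi; have [M _ hM] := test_bounded tphi.
exact: (L1_bddM ig (measurable_test tphi) hM).
Qed.

Lemma L1_Mpartial k g phi : L1 g -> test_fun Omega phi -> L1 (fun x => g x * partial k phi x).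
Proof.
move=> ig tphi; have [M _ hM] := partial_bounded k tphi.
exact: (L1_bddM ig (measurable_partial k tphi) hM).
Qed.

Lemma L1_lin c v w : L1 v -> L1 w -> L1 (fun x => v x + c * w x).
Proof.
move=> iv iw.
rewrite (_ : EFin \o _ = (fun x => ((EFin \o v) x + c%:E * (EFin \o w) x)%E)); last first.
  by apply/funext => x; rewrite /= EFinD EFinM.
by apply: integrableD => //; exact: integrableZl.
Qed.

Lemma eq_Rintegral_ae v w : measurable_fun Omega v -> measurable_fun Omega w ->
  {ae mu, forall x, Omega x -> v x = w x} ->
  \int[mu]_(x in Omega) v x = \int[mu]_(x in Omega) w x.
Proof.
move=> mv mw vw; rewrite /Rintegral; congr fine; apply: ae_eq_integral.
- exact: mO.
- exact/measurable_EFinP.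
- exact/measurable_EFinP.
- by apply: (ae_mono vw) => x h Ox; rewrite h.
Qed.

Lemma wD_spec k v : (exists2 g, Lp Omega 1 g & is_weak_partial Omega k v g) ->
  L1 (wD Omega k v) /\ is_weak_partial Omega k v (wD Omega k v).
Proof.
move=> [g g1 g2]; have := @xgetPex _ (cst 0) [set g | Lp Omega 1 g /\ is_weak_partial Omega k v g].
rewrite -/(wD Omega k v) => -[|/(Lp1P mO) h1 h2]; last by [].
by exists g.
Qed.

Lemma weak_partial_unique k v g g' : L1 g -> L1 g' ->
  is_weak_partial Omega k v g -> is_weak_partial Omega k v g' ->
  {ae mu, forall x, Omega x -> g x = g' x}.
Proof.
move=> ig ig' wg wg'.
have : {ae mu, forall x, Omega x -> g x + (-1) * g' x = 0}.
  apply: (du_bois_reymond mO oO); first exact: L1_lin.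
  move=> phi tphi.
  rewrite (_ : \int[mu]_(x in Omega) _ = \int[mu]_(x in Omega) (g x * phi x) + (-1) * \int[mu]_(x in Omega) (g' x * phi x)).
    have := wg _ tphi; have := wg' _ tphi => -> /oppr_inj ->.
    by rewrite mulN1r subrr.
  rewrite -RintegralZl//; last exact: L1_Mtest.
  rewrite -RintegralD//; last 2 first.
  - exact: L1_Mtest.
  - rewrite (_ : EFin \o _ = (fun x => ((-1)%:E * (EFin \o (fun x => g' x * phi x)%R) x)%E))//.
    by apply: integrableZl => //; exact: L1_Mtest.
  by apply: eq_Rintegral => x _; rewrite mulrDl mulrA.
move=> h; apply: (ae_mono h) => x {}h /h /eqP.
by rewrite mulN1r subr_eq0 => /eqP.
Qed.

(** The chosen weak derivative is the given one because the difference of two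
weak derivatives annihilates every test function. *)
Lemma wD_unique k v g : L1 g -> is_weak_partial Omega k v g ->
  {ae mu, forall x, Omega x -> wD Omega k v x = g x}.
Proof.
move=> ig wg; have [|i1 w1] := @wD_spec k v; first by exists g => //; apply/Lp1P.
exact: weak_partial_unique w1 wg.
Qed.

Lemma weak_partial_lin k c v w g g' : L1 v -> L1 w -> L1 g -> L1 g' ->
  is_weak_partial Omega k v g -> is_weak_partial Omega k w g' ->
  is_weak_partial Omega k (fun x => v x + c * w x) (fun x => g x + c * g' x).
Proof.
move=> iv iw ig ig' wv ww phi tphi.
have lin (f h e : Rn -> R) : L1 (fun x => f x * e x) -> L1 (fun x => h x * e x) ->
    \int[mu]_(x in Omega) ((f x + c * h x) * e x) =
    \int[mu]_(x in Omega) (f x * e x) + c * \int[mu]_(x in Omega) (h x * e x).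
  move=> if_ ih; rewrite -RintegralZl// -RintegralD//; last first.
    rewrite (_ : EFin \o _ = (fun x => (c%:E * (EFin \o (fun x => h x * e x)%R) x)%E))//.
    exact: integrableZl.
  by apply: eq_Rintegral => x _; rewrite mulrDl mulrA.
rewrite !lin; [|exact: L1_Mtest|exact: L1_Mtest|exact: L1_Mpartial|exact: L1_Mpartial].
by rewrite wv// ww// mulrN opprD.
Qed.

Lemma weak_partial_ae k v w g : measurable_fun Omega v -> measurable_fun Omega w ->
  {ae mu, forall x, Omega x -> v x = w x} -> is_weak_partial Omega k v g -> is_weak_partial Omega k w g.
Proof.
move=> mv mw vw wv phi tphi; rewrite -wv//.
apply: eq_Rintegral_ae.
- by apply: measurable_funM => //; exact: measurable_partial.
- by apply: measurable_funM => //; exact: measurable_partial.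
- by apply: (ae_mono vw) => x h Ox; rewrite h.
Qed.

Lemma L1_test phi : test_fun Omega phi -> L1 phi.
Proof.
move=> tphi; have := integrable_test mO (@cst_continuous Rn R 1) tphi.
by rewrite (_ : EFin \o _ = EFin \o phi)//; apply/funext => x; rewrite /= mul1r.
Qed.

Lemma L1_partial k phi : test_fun Omega phi -> L1 (partial k phi).
Proof.
move=> tphi; have := integrable_partial k mO (@cst_continuous Rn R 1) tphi.
by rewrite (_ : EFin \o _ = EFin \o partial k phi)//; apply/funext => x; rewrite /= mul1r.
Qed.

Lemma vanishing_Rintegral (f : nat -> Rn -> R) (h : Rn -> R) M :
  measurable_fun Omega h -> (forall x, `|h x| <= M) -> (forall j, L1 (f j)) ->
  vanishing (fun j => \int[mu]_(x in Omega) `|f j x|%:E)%E ->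
  vanishing (fun j => `|\int[mu]_(x in Omega) (f j x * h x)|%:E).
Proof.
move=> mh hM if_ vf; have M0 : 0 <= M by exact: le_trans (hM 0).
apply: (vanishing_le _ (vanishingZ M0 vf)) => j.
have ifh := L1_bddM (if_ j) mh hM.
have mfh := L1_measurable ifh.
have mf := measurable_abs (L1_measurable (if_ j)).
rewrite (EFin_normr_Rintegral mO ifh); apply: le_trans.
  exact: (le_abse_integral mu mO (measurable_int _ ifh)).
rewrite -(ge0_integralZl_EFin mu mO (fun x _ => normr_ge0 (f j x) : (0 <= _%:E)%E) mf M0).
apply: ge0_le_integral.
- exact: mO.
- by move=> x _; exact: abse_ge0.
- exact: measurable_abs.
- exact: measurable_funeM.
- by move=> x _; rewrite -EFinM lee_fin normrM mulrC ler_wpM2r.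
Qed.

Let subE v w : (fun x => v x - w x) = (fun x => v x + (-1) * w x).
Proof. by apply/funext => x; rewrite mulN1r. Qed.

Lemma L1B v w : L1 v -> L1 w -> L1 (fun x => v x - w x).
Proof. by move=> iv iw; rewrite subE; exact: L1_lin. Qed.

(** Both sides of the definition of weak derivative are continuous in L^1, since
test functions and their derivatives are bounded. *)
Lemma weak_partial_lim k w g (phi : nat -> Rn -> R) : L1 w -> L1 g ->
  (forall j, test_fun Omega (phi j)) ->
  vanishing (fun j => \int[mu]_(x in Omega) `|phi j x - w x|%:E)%E ->
  vanishing (fun j => \int[mu]_(x in Omega) `|partial k (phi j) x - g x|%:E)%E ->
  is_weak_partial Omega k w g.
Proof.
move=> iw ig tphi vw vg psi tpsi.
have [M M0 hM] := partial_bounded k tpsi; have [M' M'0 hM'] := test_bounded tpsi.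
have v1 := vanishing_Rintegral (measurable_partial k tpsi) hM (fun j => L1B (L1_test (tphi j)) iw) vw.
have v2 := vanishing_Rintegral (measurable_test tpsi) hM' (fun j => L1B (L1_partial k (tphi j)) ig) vg.
apply/eqP; rewrite -addr_eq0 -normr_le0; apply/ler_addgt0Pr => e e0; rewrite add0r.
have [N hN] := vanishingD v1 v2 e0; have := hN N (leqnn N); rewrite -EFinD lee_fin; apply: le_trans.
have bil (u f h : Rn -> R) : L1 (fun x => u x * h x) -> L1 (fun x => f x * h x) ->
    \int[mu]_(x in Omega) ((u x - f x) * h x) =
    \int[mu]_(x in Omega) (u x * h x) - \int[mu]_(x in Omega) (f x * h x).
  by move=> iu i_f; rewrite -RintegralB//; apply: eq_Rintegral => x _; rewrite mulrBl.
rewrite !bil; [|exact: L1_Mtest (L1_partial k (tphi N)) tpsi|exact: L1_Mtest|exact: L1_Mpartial (L1_test (tphi N)) tpsi|exact: L1_Mpartial].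
have := test_fun_weak_partial k mO (tphi N) tpsi => ->.
set A := \int[mu]_(x in Omega) (partial _ _ _ * _); set B := \int[mu]_(x in Omega) (w _ * _).
set C := \int[mu]_(x in Omega) (g _ * _).
rewrite -[leLHS]normrN (_ : - (B + C) = (- A - B) + (A - C)); last by ring.
exact: ler_normD.
Qed.

Lemma W11_wD k v : W11 Omega v -> L1 (wD Omega k v) /\ is_weak_partial Omega k v (wD Omega k v).
Proof. by move=> [_ /(_ k)] => /wD_spec. Qed.

Lemma W11_L1 v : W11 Omega v -> L1 v.
Proof. by move=> [/(Lp1P mO)]. Qed.

Lemma W11_intro v (g : 'I_n -> Rn -> R) : L1 v -> (forall k, L1 (g k)) ->
  (forall k, is_weak_partial Omega k v (g k)) ->
  W11 Omega v /\ forall k, {ae mu, forall x, Omega x -> wD Omega k v x = g k x}.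
Proof.
move=> iv ig wg; split; last by move=> k; exact: wD_unique.
by split; [exact/Lp1P|move=> k; exists (g k) => //; exact/Lp1P].
Qed.

Lemma W11_lin c v w : W11 Omega v -> W11 Omega w ->
  W11 Omega (fun x => v x + c * w x) /\ forall k,
  {ae mu, forall x, Omega x -> wD Omega k (fun x => v x + c * w x) x = wD Omega k v x + c * wD Omega k w x}.
Proof.
move=> Wv Ww; have iv := W11_L1 Wv; have iw := W11_L1 Ww.
apply: (@W11_intro _ (fun k x => wD Omega k v x + c * wD Omega k w x)).
- exact: L1_lin.
- by move=> k; have [? _] := W11_wD k Wv; have [? _] := W11_wD k Ww; exact: L1_lin.
- by move=> k; have [? ?] := W11_wD k Wv; have [? ?] := W11_wD k Ww; exact: weak_partial_lin.
Qed.

Lemma W11_test phi : test_fun Omega phi -> W11 Omega phi /\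
  forall k, {ae mu, forall x, Omega x -> wD Omega k phi x = partial k phi x}.
Proof.
move=> tphi; apply: (@W11_intro _ (fun k => partial k phi)).
- exact: L1_test.
- by move=> k; exact: L1_partial.
- by move=> k; exact: test_fun_weak_partial.
Qed.

Lemma W11_norm_testB phi w (g : 'I_n -> Rn -> R) : test_fun Omega phi -> W11 Omega w ->
  (forall k, L1 (g k)) ->
  (forall k, {ae mu, forall x, Omega x -> wD Omega k w x = g k x}) ->
  W11_norm Omega (fun x => phi x - w x) =
  (\int[mu]_(x in Omega) `|phi x - w x|%:E +
   \sum_(k < n) \int[mu]_(x in Omega) `|partial k phi x - g k x|%:E)%E.
Proof.
move=> tphi Ww ig wg; rewrite /W11_norm; congr (_ + _)%E; apply: eq_bigr => k _.
have [Wp wp] := W11_test tphi; have [Wpw wpw] := W11_lin (-1) Wp Ww.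
rewrite -subE in Wpw wpw.
have [i1 _] := W11_wD k Wpw.
have i2 := L1B (L1_partial k tphi) (ig k).
apply: ae_eq_integral.
- exact: mO.
- exact: measurable_abs (L1_measurable i1).
- exact: measurable_abs (L1_measurable i2).
- apply: (ae_mono2 (wpw k) (ae_mono2 (wp k) (wg k) (fun x h1 h2 => conj h1 h2))) => x h [h1 h2] Ox.
  by rewrite h// h1// h2// mulN1r.
Qed.

(** The limits g_k of the partial derivatives are identified as weak derivatives
of w by [weak_partial_lim]. *)
Lemma W11_0_intro w (g : 'I_n -> Rn -> R) (phi : nat -> Rn -> R) : L1 w ->
  (forall k, L1 (g k)) -> (forall j, test_fun Omega (phi j)) ->
  vanishing (fun j => \int[mu]_(x in Omega) `|phi j x - w x|%:E)%E ->
  (forall k, vanishing (fun j => \int[mu]_(x in Omega) `|partial k (phi j) x - g k x|%:E)%E) ->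
  W11_0 Omega w /\ forall k, {ae mu, forall x, Omega x -> wD Omega k w x = g k x}.
Proof.
move=> iw ig tphi vw vg.
have [Ww wg] := W11_intro iw ig (fun k => weak_partial_lim iw (ig k) tphi vw (vg k)).
split=> //; split=> //; exists phi => //.
have E j := W11_norm_testB (tphi j) Ww ig wg.
under eq_fun do rewrite E.
apply/vanishingP.
  by move=> j; rewrite adde_ge0 ?integral_ge0// sume_ge0// => k _; exact: integral_ge0.
by apply: vanishingD => //; exact: vanishing_sum.
Qed.

(** The almost everywhere convergence is what passes to the limit under nonlinear
operations. *)
Lemma W11_0_elim w : W11_0 Omega w -> exists phi : nat -> Rn -> R,
  [/\ forall j, test_fun Omega (phi j),
   vanishing (fun j => \int[mu]_(x in Omega) `|phi j x - w x|%:E)%E,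
   (forall k, vanishing (fun j => \int[mu]_(x in Omega) `|partial k (phi j) x - wD Omega k w x|%:E)%E) &
   {ae mu, forall x, Omega x -> phi j x @[j --> \oo] --> w x}].
Proof.
move=> [Ww [phi tphi]]; have iw := W11_L1 Ww.
have E j := W11_norm_testB (tphi j) Ww (fun k => (W11_wD k Ww).1) (fun k => ae_all (fun x _ => erefl)).
under eq_fun do rewrite E.
have s0 (P : pred 'I_n) j : (0 <= \sum_(k < n | P k) \int[mu]_(x in Omega) `|partial k (phi j) x - wD Omega k w x|%:E)%E.
  by apply: sume_ge0 => k _; exact: integral_ge0.
move/vanishingP => v.
have {}v := v (fun j => adde_ge0 (integral_ge0 _ (fun x _ => normr_ge0 _ : (0%E <= _%:E)%E)) (s0 predT j)).
have vw : vanishing (fun j => \int[mu]_(x in Omega) `|phi j x - w x|%:E)%E.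
  by apply: vanishing_le v => j; rewrite leeDl.
have vg k : vanishing (fun j => \int[mu]_(x in Omega) `|partial k (phi j) x - wD Omega k w x|%:E)%E.
  apply: vanishing_le v => j; rewrite (bigD1 k)//= addeCA leeDl//.
  by apply: adde_ge0; [exact: integral_ge0|exact: s0].
have [s [hs ae_s]] := L1_subseq_ae mO (fun j => measurable_test (tphi j)) (L1_measurable iw) vw.
exists (phi \o s); split.
- by move=> j; exact: tphi.
- exact: (vanishing_comp hs vw).
- by move=> k; exact: (vanishing_comp hs (vg k)).
- exact: ae_s.
Qed.

Lemma ge0_integralD_norm v w : measurable_fun Omega v -> measurable_fun Omega w ->
  (\int[mu]_(x in Omega) (`|v x| + `|w x|)%:E =
   \int[mu]_(x in Omega) `|v x|%:E + \int[mu]_(x in Omega) `|w x|%:E)%E.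
Proof.
move=> mv mw; under eq_integral do rewrite EFinD.
apply: ge0_integralD; [exact: mO| | | |]; try by move=> x _; rewrite lee_fin.
- exact: measurable_abs.
- exact: measurable_abs.
Qed.

Lemma ge0_integralZ_norm c v : 0 <= c -> measurable_fun Omega v ->
  (\int[mu]_(x in Omega) (c * `|v x|)%:E = c%:E * \int[mu]_(x in Omega) `|v x|%:E)%E.
Proof.
move=> c0 mv; under eq_integral do rewrite EFinM.
exact: (ge0_integralZl_EFin mu mO (fun x _ => normr_ge0 (v x) : (0 <= _%:E)%E) (measurable_abs mv) c0).
Qed.

Lemma le_integral_norm v (h : Rn -> R) : measurable_fun Omega v -> measurable_fun Omega h ->
  (forall x, Omega x -> `|v x| <= h x) ->
  (\int[mu]_(x in Omega) `|v x|%:E <= \int[mu]_(x in Omega) (h x)%:E)%E.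
Proof.
move=> mv mh vh; apply: ge0_le_integral.
- exact: mO.
- by move=> x _; rewrite lee_fin.
- exact: measurable_abs.
- exact/measurable_EFinP.
- by move=> x /vh; rewrite lee_fin.
Qed.

Lemma vanishing_lin c (f g : nat -> Rn -> R) :
  (forall j, measurable_fun Omega (f j)) -> (forall j, measurable_fun Omega (g j)) ->
  vanishing (fun j => \int[mu]_(x in Omega) `|f j x|%:E)%E ->
  vanishing (fun j => \int[mu]_(x in Omega) `|g j x|%:E)%E ->
  vanishing (fun j => \int[mu]_(x in Omega) `|f j x + c * g j x|%:E)%E.
Proof.
move=> mf mg vf vg; apply: vanishing_le (vanishingD vf (vanishingZ (normr_ge0 c) vg)) => j.
have mcg : measurable_fun Omega (fun x => c * g j x) by exact: measurable_funM (measurable_cst c) (mg j).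
rewrite -ge0_integralZ_norm// .
under [X in (_ <= _ + X)%E]eq_integral do rewrite -normrM.
rewrite -ge0_integralD_norm//.
apply: le_integral_norm.
- exact: measurable_funD.
- apply: measurable_funD; exact: (measurableT_comp (@normr_measurable R setT)).
- by move=> x _; exact: ler_normD.
Qed.

Lemma W11_0_lin c v w : W11_0 Omega v -> W11_0 Omega w ->
  W11_0 Omega (fun x => v x + c * w x).
Proof.
move=> Wv Ww; have [W1v _] := Wv; have [W1w _] := Ww.
have [f [tf vf vdf _]] := W11_0_elim Wv; have [g [tg vg vdg _]] := W11_0_elim Ww.
have iv := W11_L1 W1v; have iw := W11_L1 W1w.
apply: (proj1 (@W11_0_intro _ (fun k x => wD Omega k v x + c * wD Omega k w x)
  (fun j x => f j x + c * g j x) _ _ _ _ _)).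
- exact: L1_lin.
- by move=> k; have [? _] := W11_wD k W1v; have [? _] := W11_wD k W1w; exact: L1_lin.
- by move=> j; exact: test_fun_lin.
- rewrite (_ : (fun j => _) = fun j => (\int[mu]_(x in Omega) `|(f j x - v x) + c * (g j x - w x)|%:E)%E); last first.
    by apply/funext => j; apply: eq_integral => x _; congr (`|_|%:E); ring.
  apply: (vanishing_lin (f := fun j x => f j x - v x) (g := fun j x => g j x - w x) _ _ _ vf vg) => j; apply: L1_measurable.
    by apply: L1B; [exact: L1_test|exact: iv].
  by apply: L1B; [exact: L1_test|exact: iw].
- move=> k; have [i1 _] := W11_wD k W1v; have [i2 _] := W11_wD k W1w.
  rewrite (_ : (fun j => _) = fun j => (\int[mu]_(x in Omega) `|(partial k (f j) x - wD Omega k v x) + c * (partial k (g j) x - wD Omega k w x)|%:E)%E); last first.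
    apply/funext => j; apply: eq_integral => x _; congr (`|_|%:E).
    have [sf _ _] := tf j; have [sg _ _] := tg j.
    by rewrite partial_lin//; ring.
  apply: (vanishing_lin (f := fun j x => partial k (f j) x - wD Omega k v x) (g := fun j x => partial k (g j) x - wD Omega k w x) _ _ _ (vdf k) (vdg k)) => j; apply: L1_measurable.
    by apply: L1B; [exact: L1_partial|exact: i1].
  by apply: L1B; [exact: L1_partial|exact: i2].
Qed.

(** If test functions phi_j approximate w, then the test functions G o phi_j
approximate G o w, since G is Lipschitz.  Their derivatives G'(phi_j) D phi_j
converge because G'(phi_j) D w does so by dominated convergence, and the
remainder is bounded by C |D phi_j - D w|. *)
Lemma W11_0_comp (G G' : R -> R) C w : (forall y : R, is_derive y 1 G (G' y)) ->
  continuous G' -> (forall y, `|G' y| <= C) -> G 0 = 0 ->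
  (forall f : Rn -> R, smooth f -> smooth (G \o f)) -> W11_0 Omega w ->
  W11_0 Omega (G \o w) /\
  forall k, {ae mu, forall x, Omega x -> wD Omega k (G \o w) x = wD Omega k w x * G' (w x)}.
Proof.
move=> dG cG' G'C G0 sG Ww; have [W1w _] := Ww.
have iw := W11_L1 W1w; have mw := L1_measurable iw.
have [f [tf vf vdf aef]] := W11_0_elim Ww.
have C0 : 0 <= C by exact: le_trans (G'C 0).
have cG : continuous G.
  by move=> x; apply/differentiable_continuous/derivable1_diffP; have [] := dG x.
have mG : measurable_fun setT G by exact: continuous_measurable_fun.
have mG' : measurable_fun setT G' by exact: continuous_measurable_fun.
have lip a b : `|G a - G b| <= C * `|a - b|.
  wlog ab : a b / b <= a.
    move=> h; have [/h//|/ltW/h] := leP b a.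
    by rewrite distrC (distrC b).
  have [c _ ->] := MVT_segment ab (fun x _ => dG x) (continuous_subspaceT cG).
  by rewrite normrM ler_wpM2r.
have mGu u : measurable_fun Omega u -> measurable_fun Omega (G \o u) by move=> mu_; exact: measurableT_comp mG mu_.
have mG'u u : measurable_fun Omega u -> measurable_fun Omega (G' \o u) by move=> mu_; exact: measurableT_comp mG' mu_.
have mDw k : measurable_fun Omega (wD Omega k w) by exact: L1_measurable (W11_wD k W1w).1.
apply: (@W11_0_intro _ (fun k x => wD Omega k w x * G' (w x)) (fun j => G \o f j)).
- apply: (le_integrable mO (g := fun x => (C%:E * (EFin \o w) x)%E)).
  + by apply/measurable_EFinP; exact: mGu.
  + by move=> x _; rewrite /= lee_fin -(subr0 (G _)) -G0 (le_trans (lip _ _))// subr0 normrM (ger0_norm C0).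
  + exact: integrableZl.
- by move=> k; apply: (L1_bddM (W11_wD k W1w).1 (mG'u _ mw)) => x; exact: G'C.
- by move=> j; exact: test_fun_comp.
- apply: vanishing_le (vanishingZ C0 vf) => j.
  have mfw := L1_measurable (L1B (L1_test (tf j)) iw).
  rewrite -ge0_integralZ_norm//.
  apply: le_integral_norm => [||x _]; last exact: lip.
    by apply: measurable_funB; [apply: mGu; exact: measurable_test|exact: mGu].
  by apply: measurable_funM; [exact: measurable_cst|exact: (measurableT_comp (@normr_measurable R setT))].
- move=> k.
  (* The part of the difference that dominated convergence makes small. *)
  pose e j x := wD Omega k w x * (G' (f j x) - G' (w x)).
  have me j : measurable_fun Omega (e j).
    apply: measurable_funM; first exact: mDw.
    by apply: measurable_funB; [apply: mG'u; exact: measurable_test|exact: mG'u].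
  have ve : vanishing (fun j => \int[mu]_(x in Omega) `|e j x|%:E)%E.
    apply/vanishingP; first by move=> j; exact: integral_ge0.
    have := @dominated_convergence _ _ _ mu Omega mO (fun j x => (e j x)%:E) (cst 0%E)
       (fun x => ((2 * C)%:E * `|(EFin \o wD Omega k w) x|)%E)
       (fun j => (measurable_EFinP _ _).2 (me j)) (measurable_cst _).
    have ae1 : {ae mu, forall x, Omega x -> (e j x)%:E @[j --> \oo] --> 0%E}.
      apply: (ae_mono aef) => x h Ox; apply/cvg_EFin; first exact: nearW.
      rewrite -(mulr0 (wD Omega k w x)); apply: cvgMr; rewrite -(subrr (G' (w x))).
      apply: cvgB; last exact: cvg_cst.
      by apply: (cvg_comp _ _ (h Ox)); exact: cG'.
    have int1 : mu.-integrable Omega (fun x => ((2 * C)%:E * `|(EFin \o wD Omega k w) x|)%E).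
      apply: integrableZl; first exact: mO.
      exact: integrable_abse (W11_wD k W1w).1.
    have ae2 : {ae mu, forall x, forall j, Omega x -> (`|(e j x)%:E| <= (2 * C)%:E * `|(EFin \o wD Omega k w) x|)%E}.
      apply: ae_all => x j _; rewrite /= -EFinM lee_fin normrM mulrC ler_wpM2r//.
      by rewrite (le_trans (ler_normB _ _))// mulr_natl mulr2n lerD.
    move=> /(_ ae1 int1 ae2)[_ + _].
    by under eq_fun do under eq_integral do rewrite sube0.
  have -> : (fun j => \int[mu]_(x in Omega) `|partial k (G \o f j) x - wD Omega k w x * G' (w x)|%:E)%E =
     (fun j => \int[mu]_(x in Omega) `|e j x + 1 * ((partial k (f j) x - wD Omega k w x) * G' (f j x))|%:E)%E.
    apply/funext => j; apply: eq_integral => x _; congr (`|_|%:E).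
    have [sf _ _] := tf j; rewrite (partial_comp k x sf dG) /e; ring.
  have mfd j := L1_measurable (L1B (L1_partial k (tf j)) (W11_wD k W1w).1).
  have mG'f j : measurable_fun Omega (fun x => G' (f j x)) by apply: mG'u; exact: measurable_test.
  apply: (vanishing_lin _ me _ ve) => [j|]; first exact: measurable_funM (mfd j) (mG'f j).
  apply: vanishing_le (vanishingZ C0 (vdf k)) => j; rewrite -ge0_integralZ_norm//.
  apply: le_integral_norm; first exact: measurable_funM (mfd j) (mG'f j).
    by apply: measurable_funM; [exact: measurable_cst|exact: (measurableT_comp (@normr_measurable R setT))].
  by move=> x _; rewrite normrM mulrC ler_wpM2r.
Qed.

End weak_derivatives.

(** * Gagliardo's inequality in W^{1,1}_0 *)
Section fatou_bound.
Context d (T : measurableType d) {R : realType} (mu : {measure set T -> \bar R}) (D : set T).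
Hypothesis mD : measurable D.
Local Open Scope ereal_scope.

(** Fatou's lemma for a sequence that converges almost everywhere. *)
Lemma fatou_le (f : nat -> T -> \bar R) (g : T -> \bar R) c :
  (forall j, measurable_fun D (f j)) -> (forall j x, D x -> 0 <= f j x) ->
  measurable_fun D g ->
  {ae mu, forall x, D x -> f j x @[j --> \oo] --> g x} ->
  (forall j, \int[mu]_(x in D) f j x <= c) -> \int[mu]_(x in D) g x <= c.
Proof.
move=> mf f0 mg fg fc.
have meinf : measurable_fun D (fun x => limn_einf (f ^~ x)).
  rewrite /limn_einf; apply: measurableT_comp; first exact: oppe_measurable.
  apply: (@measurable_fun_limn_esup _ _ _ D (fun j x => - f j x)) => j.
  by apply: measurableT_comp; [exact: oppe_measurable|exact: mf].
have -> : \int[mu]_(x in D) g x = \int[mu]_(x in D) limn_einf (f ^~ x).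
  apply: ae_eq_integral => //; apply: filterS fg => x h Dx.
  by have [-> _] := cvg_limn_einf_sup (h Dx).
apply: (le_trans (fatou mu mD mf f0)).
rewrite limn_einf_lim; apply: lime_le; first exact: is_cvg_einfs.
apply: nearW => j; apply: le_trans (fc j); apply: ereal_inf_lbound.
by exists j => /=.
Qed.

End fatou_bound.

Section gagliardo_W11_0.
Context {R : realType} {n : nat}.
Local Notation Rn := 'rV[R]_n.+2.
Local Notation mu := (leb R n.+2).

Lemma cvg_powR (y_ : nat -> R) (y r : R) : 0 < r -> (forall j, 0 <= y_ j) ->
  y_ j @[j --> \oo] --> y -> (y_ j `^ r) @[j --> \oo] --> y `^ r.
Proof.
move=> r0 y_0 yy.
have y0 : 0 <= y by by apply: (ler_cvg_to (cvg_cst (0 : R)) yy); exact: nearW.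
move: y0; rewrite le_eqVlt => /orP[/eqP y0|y0].
  rewrite -y0 powR0 ?gt_eqF//; apply/cvgrPdist_le => e e0.
  have e'0 : 0 < e `^ r^-1 by rewrite powR_gt0.
  rewrite -y0 in yy; have /cvgr0Pnorm_le/(_ _ e'0) := yy; apply: filterS => j.
  rewrite sub0r normrN !ger0_norm ?powR_ge0// => h.
  have := @ge0_ler_powR R r (ltW r0) (y_ j) (e `^ r^-1); rewrite !nnegrE powR_ge0 y_0.
  move=> /(_ isT isT h); rewrite -powRrM mulVf ?gt_eqF// powRr1// ltW//.
have cy : {for y, continuous (fun t : R => t `^ r)}.
  by apply/differentiable_continuous/derivable1_diffP; have [] := is_derive1_powR r y0.
exact: (cvg_comp y_ (fun t => t `^ r) yy cy).
Qed.

(** Each v_i is the limit of test functions, in W^{1,1} and almost everywhere.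
The integrals of the partial derivatives are at most their limits plus e, and
Fatou's lemma handles the left side; then e tends to 0. *)
Lemma W11_0_gagliardo (Omega : set (leb_rV R n.+2)) (v : 'I_n.+2 -> Rn -> R) :
  open (Omega : set Rn) -> (forall i, W11_0 Omega (v i)) ->
  (\int[mu]_(x in Omega) (\prod_(i < n.+2) `|v i x|%:E) `^ (n.+1%:R^-1) <=
   (\prod_(i < n.+2) \int[mu]_(x in Omega) `|wD Omega i (v i) x|%:E) `^ (n.+1%:R^-1))%E.
Proof.
move=> oO Wv.
have mO : measurable Omega by apply: measurable_leb; exact: open_measurable_rV.
have r0 : 0 < (n.+1%:R^-1 : R) by rewrite invr_gt0.
have /choice[f hf] := fun i => W11_0_elim oO (Wv i).
have W1v i : W11 Omega (v i) by have [] := Wv i.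
have iD i := (W11_wD oO i (W1v i)).1.
have mv i := L1_measurable (W11_L1 oO (W1v i)).
pose I i := fine (\int[mu]_(x in Omega) `|wD Omega i (v i) x|%:E)%E.
have IE i : (\int[mu]_(x in Omega) `|wD Omega i (v i) x|%:E)%E = (I i)%:E.
  rewrite fineK// ge0_fin_numE ?integral_ge0//.
  by have /integrableP[_] := iD i.
have I0 i : 0 <= I i by apply: fine_ge0; exact: integral_ge0.
under [X in (_ <= X `^ _)%E]eq_bigr do rewrite IE.
rewrite prodEFin poweR_EFin.
have key e : 0 < e -> (\int[mu]_(x in Omega) (\prod_(i < n.+2) `|v i x|%:E) `^ (n.+1%:R^-1) <=
   ((\prod_(i < n.+2) (I i + e)) `^ (n.+1%:R^-1))%:E)%E.
  move=> e0.
  have tf i j : test_fun Omega (f i j) by have [] := hf i.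
  have /choice[N hN] : forall i, exists N, forall j, (N <= j)%N ->
     (\int[mu]_(x in Omega) `|partial i (f i j) x|%:E <= (I i + e)%:E)%E.
    move=> i; have [_ _ /(_ i)/(_ _ e0)[N hN] _] := hf i; exists N => j /hN h.
    have mp := L1_measurable (L1_partial oO i (tf i j)).
    have md := L1_measurable (L1B oO (L1_partial oO i (tf i j)) (iD i)).
    rewrite EFinD -IE; apply: le_trans (leeD2l _ h).
    rewrite -ge0_integralD_norm//; last exact: L1_measurable (iD i).
    apply: (le_integral_norm oO mp).
      by apply: measurable_funD; apply: (measurableT_comp (@normr_measurable R setT)) => //; exact: L1_measurable (iD i).
    by move=> x _; rewrite -{1}(subrKC (wD Omega i (v i) x) (partial i (f i j) x)) ler_normD.
  pose M := \max_(i < n.+2) N i.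
  apply: (@fatou_le _ _ _ mu Omega mO (fun j x => (\prod_(i < n.+2) `|f i (M + j)%N x|%:E) `^ (n.+1%:R^-1))%E).
  - move=> j; apply: measurable_poweR_prode => i; apply: measurable_abs; exact: measurable_test.
  - by move=> j x _; exact: poweR_ge0.
  - by apply: measurable_poweR_prode => i; exact: measurable_abs.
  - have : {ae mu, forall x, forall i, Omega x -> f i j x @[j --> \oo] --> v i x}.
      by apply: ae_forall_ord => i; have [] := hf i.
    move=> /ae_mono; apply => x h Ox.
    under eq_fun do rewrite prodEFin poweR_EFin.
    rewrite prodEFin poweR_EFin; apply/cvg_EFin; first exact: nearW.
    apply: cvg_powR => //; first by move=> j; exact: prodr_ge0.
    apply: cvg_big => [|i _]; first exact: mul_continuous.
    apply: cvg_norm; have := h i Ox => hi.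
    exact: (cvg_comp _ _ (cvg_addnl M) hi).
  - move=> j; apply: le_trans (gagliardo_test mO (fun i => tf i (M + j)%N)) _.
    rewrite -poweR_EFin -prodEFin; apply: le_poweR; first exact: ltW.
      by apply: prode_ge0 => i _; exact: integral_ge0.
    apply: lee_prode => i; first exact: integral_ge0.
    by apply: hN; rewrite (leq_trans _ (leq_addr _ _))// /M; exact: leq_bigmax.
have c1 : ((\prod_(i < n.+2) (I i + j.+1%:R^-1)) `^ (n.+1%:R^-1)) @[j --> \oo] --> (\prod_(i < n.+2) I i) `^ (n.+1%:R^-1).
  apply: cvg_powR => //; first by move=> j; apply: prodr_ge0 => i _; rewrite addr_ge0.
  apply: cvg_big => [|i _]; first exact: mul_continuous.
  by rewrite -[X in _ --> X]addr0; apply: cvgD; [exact: cvg_cst|exact: cvg_harmonic].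
have := key 1 ltr01.
case: (X in (X <= _)%E) key => [s||] key; rewrite ?leNye// ?lee_fin//.
move=> _; apply: (@ler_cvg_to _ _ _ _ (fun=> s) _ s _ (cvg_cst _) c1).
by apply: nearW => j; rewrite -lee_fin; apply: key; rewrite invr_gt0.
Qed.

End gagliardo_W11_0.

(** * Truncations and cutoffs at a level *)
Section profiles.
Context {R : realType}.

Lemma powR_le1 (x r : R) : 0 <= x <= 1 -> 0 <= r -> x `^ r <= 1.
Proof.
move=> /andP[x0 x1] r0; have := @ge0_ler_powR R r r0 x 1.
by rewrite powR1 !nnegrE; apply.
Qed.

(** For L > 0, nonpositive exactly when |s| <= L, and smooth in s, unlike |s| itself. *)
Definition level (L s : R) : R := (s / L) ^+ 2 - 1.

(** Powers of one function: [cutoff L g] is the g-th power of [cutoff L 1]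
([cutoff_powR]), but in this form it is visibly smooth for every g > 0. *)
Definition cutoff (L g s : R) : R := flat 0 (level L s / g).
Definition cutoff' (L g s : R) : R := flat 2 (level L s / g) * (2 * s / (L ^+ 2 * g)).

(** A smooth substitute for the part of s above the level L: it vanishes for
|s| <= L and lies between 0 and s. *)
Definition trunc (L s : R) : R := s * flat 0 (level L s).
Definition trunc' (L s : R) : R := flat 0 (level L s) + 2 * (s / L) ^+ 2 * flat 2 (level L s).

Lemma is_derive_level L g (s : R) : L != 0 -> g != 0 ->
  is_derive s 1 (fun s => level L s / g) (2 * s / (L ^+ 2 * g)).
Proof.
move=> L0 g0; rewrite /level.
rewrite (_ : (fun s => _) = fun s : R => (s * s) * (L ^- 2 / g) + (- g^-1)); last first.
  by apply/funext => t; field; rewrite L0 g0.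
apply: is_derive_eq.
by rewrite /GRing.scale/=; field; rewrite L0 g0.
Qed.

Lemma is_derive_flat0 (y : R) : is_derive y 1 (flat 0) (flat 2 y).
Proof. by have := is_derive_flat 0 y; rewrite oppr0 mul0r add0r. Qed.

Lemma is_derive_cutoff L g (s : R) : L != 0 -> g != 0 ->
  is_derive s 1 (cutoff L g) (cutoff' L g s).
Proof.
by move=> L0 g0; apply: is_derive1_comp; [exact: is_derive_flat0|exact: is_derive_level].
Qed.

Lemma is_derive_trunc L (s : R) : L != 0 -> is_derive s 1 (trunc L) (trunc' L s).
Proof.
move=> L0.
have d1 : is_derive s 1 (fun s => flat 0 (level L s)) (flat 2 (level L s) * (2 * s / (L ^+ 2 * 1))).
  have := is_derive_cutoff s L0 (oner_neq0 R); rewrite /cutoff /cutoff' !divr1.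
  by under eq_fun do rewrite divr1.
have := @is_deriveM _ _ (id : R -> R) (fun s => flat 0 (level L s)) s 1 _ _ (is_derive_id _ _) d1.
set D := _ + _; suff -> : trunc' L s = D by [].
rewrite /D /trunc' /GRing.scale /=; field; exact: L0.
Qed.

(** With y = level L s, the factor y + 1 is (s / L)^2, so this controls the
powers of s / L in the derivatives of both profiles. *)
Lemma flat2_le (q : R) : (q + 1) * flat 2 q <= 48.
Proof.
have [q0|q0] := leP q 0; first by rewrite /flat ltNge q0/= mulr0.
have [q1|q1] := leP q 1.
  have := flat_le 2 q; rewrite (_ : 4`!%:R = 24 :> R)// => h.
  have f0 := flat_ge0 2 q.
  by nra.
rewrite /flat q0 mulrA -[leRHS]mulr1; apply: ler_pM => //.
- by rewrite mulr_ge0 ?exprn_ge0 ?invr_ge0 ?addr_ge0// ltW.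
- by rewrite exprVn ler_pdivrMr ?exprn_gt0//; nra.
- by rewrite -[leRHS]expR0 ler_expR oppr_le0 invr_ge0 ltW.
Qed.

Lemma level_le0 L s : 0 < L -> `|s| <= L -> level L s <= 0.
Proof.
move=> L0 sL; rewrite /level subr_le0 -real_normK ?num_real// expr_le1// normrM normfV.
by rewrite (gtr0_norm L0) ler_pdivrMr// mul1r.
Qed.

Lemma level_ge3 L s : 0 < L -> 2 * L <= `|s| -> 3 <= level L s.
Proof.
move=> L0 sL; rewrite /level -real_normK ?num_real// normrM normfV (gtr0_norm L0).
have : 2 <= `|s| / L by rewrite ler_pdivlMr.
by nra.
Qed.

Lemma flat_le0 m (q : R) : q <= 0 -> flat m q = 0.
Proof. by move=> q0; rewrite /flat ltNge q0. Qed.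

Lemma flat0_mono (x y : R) : x <= y -> flat 0 x <= flat 0 y.
Proof.
move=> xy; rewrite /flat; case: ifPn => x0; last by case: ifPn => // _; rewrite mulr_ge0 ?expR_ge0.
rewrite (lt_le_trans x0 xy) !expr0 !mul1r ler_expR lerN2 lef_pV2 ?posrE//.
exact: lt_le_trans xy.
Qed.

Lemma trunc'_ge0 L s : 0 <= trunc' L s.
Proof. by rewrite addr_ge0 ?flat_ge0// mulr_ge0 ?flat_ge0// mulr_ge0// sqr_ge0. Qed.

Lemma trunc'_le L s : `|trunc' L s| <= 97.
Proof.
rewrite ger0_norm ?trunc'_ge0// /trunc'.
have := flat2_le (level L s); have /andP[_] := flat0_le1 (level L s).
by rewrite {2}/level subrK; nra.
Qed.

Lemma trunc'_small L s : 0 < L -> `|s| <= L -> trunc' L s = 0.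
Proof. by move=> L0 sL; rewrite /trunc' !flat_le0 ?mulr0 ?addr0// level_le0. Qed.

Lemma trunc'_large L s : 0 < L -> 2 * L <= `|s| -> flat 0 3 <= trunc' L s.
Proof.
move=> L0 sL; rewrite /trunc' -[leLHS]addr0 lerD//.
  by apply: flat0_mono; exact: level_ge3.
by rewrite mulr_ge0 ?flat_ge0// mulr_ge0// sqr_ge0.
Qed.

Lemma flat0_3_gt0 : 0 < flat 0 3 :> R.
Proof. by rewrite /flat ltr0n/= expr0 mul1r expR_gt0. Qed.

Lemma continuous_level L : continuous (level L).
Proof.
move=> s; apply: cvgB; last exact: cvg_cst.
by under eq_fun do rewrite expr2; apply: cvgM; apply: cvgMl; exact: cvg_id.
Qed.

Lemma continuous_trunc' L : continuous (trunc' L).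
Proof.
move=> s; apply: cvgD.
  by apply: continuous_comp; [exact: continuous_level|exact: continuous_flat].
apply: cvgM; last by apply: continuous_comp; [exact: continuous_level|exact: continuous_flat].
apply: cvgMr; under eq_fun do rewrite expr2; apply: cvgM; apply: cvgMl; exact: cvg_id.
Qed.

Lemma continuous_cutoff' L g : continuous (cutoff' L g).
Proof.
move=> s; apply: cvgM.
  apply: (continuous_comp (f := fun s => level L s / g)); last exact: continuous_flat.
  by apply: cvgMl; exact: continuous_level.
by apply: cvgMl; apply: cvgMr; exact: cvg_id.
Qed.

Lemma cutoff_powR L g s : 0 < g -> cutoff L g s = flat 0 (level L s) `^ g.
Proof.
move=> g0; rewrite /cutoff /flat pmulr_lgt0 ?invr_gt0//; case: ifPn => l0.
  by rewrite !expr0 !mul1r -expRM mulNr invf_div mulrC.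
by rewrite powR0 ?gt_eqF.
Qed.

Lemma cutoff'_le L g s : 0 < L -> 1 <= g ->
  `|cutoff' L g s| <= 96 * g / L * flat 0 (level L s) `^ (g - 1).
Proof.
move=> L0 g1; have g0 : 0 < g by exact: lt_le_trans g1.
rewrite /cutoff'; have [l0|l0] := leP (level L s) 0.
  by rewrite flat_le0 ?mul0r ?normr0 ?mulr_ge0 ?powR_ge0 ?invr_ge0// ?(ltW L0) ?(ltW g0)// pmulr_lle0 ?invr_gt0.
have -> : flat 2 (level L s / g) = g ^+ 2 * flat 2 (level L s) * flat 0 (level L s) `^ (g - 1).
  rewrite /flat pmulr_lgt0 ?invr_gt0// l0 expr0 mul1r -expRM.
  have -> : - (level L s / g)^-1 = - (level L s)^-1 + - (level L s)^-1 * (g - 1) by field; rewrite !gt_eqF.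
  by rewrite expRD; field; rewrite !gt_eqF.
set P := _ `^ _; have P0 : 0 <= P by exact: powR_ge0.
have f2 := flat_ge0 2 (level L s).
have -> : g ^+ 2 * flat 2 (level L s) * P * (2 * s / (L ^+ 2 * g)) = (2 * g / L * P) * (flat 2 (level L s) * (s / L)).
  by field; rewrite !gt_eqF.
have c0 : 0 <= 2 * g / L * P by rewrite !mulr_ge0 ?invr_ge0// ltW.
rewrite normrM (ger0_norm c0) (_ : 96 * g / L * P = (2 * g / L * P) * 48); last by field; rewrite gt_eqF.
apply: ler_wpM2l => //; rewrite normrM (ger0_norm f2) mulrC.
apply: le_trans (flat2_le (level L s)); apply: ler_wpM2r => //.
have sL : (s / L) ^+ 2 = level L s + 1 by rewrite /level subrK.
rewrite -(@ler_pXn2r _ 2) ?nnegrE//; last by rewrite addr_ge0// ltW.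
by rewrite real_normK ?num_real// sL; nra.
Qed.

Lemma cutoff'_le_cst L g s : 0 < L -> 1 <= g -> `|cutoff' L g s| <= 96 * g / L.
Proof.
move=> L0 g1; apply: le_trans (cutoff'_le s L0 g1) _.
rewrite -[leRHS]mulr1; apply: ler_wpM2l.
  by rewrite !mulr_ge0 ?invr_ge0 ?(ltW L0)// (le_trans _ g1).
have /andP[f0 f1] := flat0_le1 (level L s).
by apply: powR_le1; rewrite ?f0// subr_ge0.
Qed.

Context {n : nat}.

Lemma smooth_level L (f : 'rV[R]_n -> R) : smooth f -> smooth_alg (fun x => level L (f x)).
Proof.
move=> sf.
rewrite (_ : (fun x => _) = fun x => L ^- 2 * (f x * f x) + (-1)); last first.
  by apply/funext => x; rewrite /level exprMn exprVn expr2 mulrC.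
apply: alg_add; last exact: alg_cst.
by apply: alg_mul; [exact: alg_cst|apply: alg_mul; exact: alg_smooth].
Qed.

Lemma smooth_trunc L (f : 'rV[R]_n -> R) : smooth f -> smooth (trunc L \o f).
Proof.
move=> sf; apply: smooth_alg_smooth.
apply: (@alg_mul _ _ f (fun x => flat 0 (level L (f x)))); first exact: alg_smooth.
by apply: alg_flat; exact: smooth_level.
Qed.

Lemma smooth_cutoff L g (f : 'rV[R]_n -> R) : smooth f -> smooth (cutoff L g \o f).
Proof.
move=> sf; apply: smooth_alg_smooth.
apply: (@alg_flat _ _ 0 (fun x => level L (f x) / g)).
by apply: (@alg_mul _ _ _ (fun=> g^-1)); [exact: smooth_level|exact: alg_cst].
Qed.

Lemma cutoff0 L g : 0 < g -> cutoff L g 0 = 0.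
Proof.
by move=> g0; rewrite /cutoff flat_le0// /level mul0r expr0n/= sub0r pmulr_lle0 ?invr_gt0// oppr_le0.
Qed.

End profiles.

(** * Stampacchia's iteration *)
Section stampacchia.
Context {R : realType}.

(** For t = s / (1 - b) the bound phi L <= K / L^t at L implies the same bound at
4 L, provided that C 4^t K^b <= K, which holds for large K as b < 1.  For
L <= 1 it follows from the boundedness of phi. *)
Lemma decay_iteration (phi : R -> R) (C B s b : R) : 0 < s -> 0 <= b -> b < 1 ->
  0 <= C -> (forall L, 0 <= phi L <= B) ->
  (forall L, 0 < L -> phi (4 * L) <= C * L `^ (- s) * phi L `^ b) ->
  exists2 K, 0 < K & forall L, 0 < L -> phi L <= K / L `^ (s / (1 - b)).
Proof.
move=> s0 b0 b1 C0 phiB h; set t := s / (1 - b).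
have b1' : 0 < 1 - b by rewrite subr_gt0.
have t0 : 0 < t by rewrite divr_gt0.
pose K := 1 + B + (C * 4 `^ t) `^ (1 - b)^-1.
have B0 : 0 <= B by have /andP[h1 h2] := phiB 0; exact: le_trans h2.
have K1 : 1 <= K by rewrite /K -addrA lerDl addr_ge0 ?powR_ge0.
have K0 : 0 < K by exact: lt_le_trans K1.
have KB : B <= K by rewrite /K; have := powR_ge0 (C * 4 `^ t) (1 - b)^-1; lra.
have hK : C * 4 `^ t * K `^ b <= K.
  have c40 : 0 <= C * 4 `^ t by rewrite mulr_ge0 ?powR_ge0.
  have : C * 4 `^ t <= K `^ (1 - b).
    have -> : C * 4 `^ t = ((C * 4 `^ t) `^ (1 - b)^-1) `^ (1 - b).
      by rewrite -powRrM mulVf ?gt_eqF// powRr1.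
    apply: ge0_ler_powR; rewrite ?nnegrE ?powR_ge0 ?(ltW b1') ?(ltW K0)//.
    by rewrite /K; lra.
  move=> /(ler_wpM2r (powR_ge0 K b)); rewrite -powRD; last by rewrite (gt_eqF K0) implybT.
  by rewrite subrK powRr1// ltW.
exists K => // L L0.
(* Descend from L to a level below 1 in steps of ratio 4. *)
have [m Lm] : exists m : nat, L <= 4 ^+ m.
  exists (Num.trunc L).+1; apply: (@le_trans _ _ (Num.trunc L).+1%:R); first by rewrite ltW// truncnS_gt.
  by rewrite -natrX ler_nat ltnW// ltn_expl.
elim: m L L0 Lm => [|m IH] L L0 Lm.
  rewrite expr0 in Lm; have /andP[_ h2] := phiB L; apply: (le_trans h2).
  rewrite ler_pdivlMr ?powR_gt0// -[leRHS]mulr1; apply: ler_pM => //; first exact: powR_ge0.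
  by apply: powR_le1; rewrite ?(ltW t0) ?(ltW L0).
have L4 : 0 < L / 4 by rewrite divr_gt0.
have := h _ L4; rewrite mulrCA divff// mulr1 => /le_trans; apply.
have /IH : L / 4 <= 4 ^+ m by rewrite ler_pdivrMr// -exprSr.
move=> /(_ L4) h4.
apply: (@le_trans _ _ (C * (L / 4) `^ (- s) * (K / (L / 4) `^ t) `^ b)).
  apply: ler_wpM2l; first by rewrite mulr_ge0 ?powR_ge0.
  apply: ge0_ler_powR; rewrite ?nnegrE//; first by have /andP[] := phiB (L / 4).
  by rewrite divr_ge0 ?powR_ge0 ?(ltW K0).
rewrite -powRN powRM ?powR_ge0 ?(ltW K0)// -powRrM.
rewrite (_ : C * _ * _ = C * K `^ b * ((L / 4) `^ (- s) * (L / 4) `^ (- t * b))); last by ring.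
rewrite -powRD; last by rewrite (gt_eqF L4) implybT.
rewrite (_ : - s + - t * b = - t); last first.
  by rewrite /t; field; rewrite gt_eqF.
have -> : (L / 4) `^ (- t) = 4 `^ t / L `^ t.
  have {2}-> : L = L / 4 * 4 by rewrite divfK.
  by rewrite powRN (powRM _ (ltW L4))//; field; rewrite !gt_eqF ?powR_gt0.
move: hK (powR_gt0 t L0); move: (4 `^ t) (K `^ b) (L `^ t) => X Y Z hK Z0.
rewrite mulrA (mulrAC C).
by rewrite ler_pM2r ?invr_gt0.
Qed.

End stampacchia.

(** * Integral inequalities on a measure space *)
Section ae_comparison.
Context d (T : measurableType d) {R : realType} (mu : {measure set T -> \bar R}) (D : set T).
Hypothesis mD : measurable D.
Local Open Scope ereal_scope.
Import HBNNSimple.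

(** For an arbitrary nonnegative f: its integral is the supremum over the simple
functions below it, and these are below g almost everywhere. *)
Lemma le_integral_ub (f g : T -> \bar R) : (forall x, D x -> 0 <= f x) ->
  (forall x, D x -> 0 <= g x) -> measurable_fun D g ->
  {ae mu, forall x, D x -> f x <= g x} ->
  \int[mu]_(x in D) f x <= \int[mu]_(x in D) g x.
Proof.
move=> f0 g0 mg fg.
rewrite (ge0_integralE _ f0); apply: ge_ereal_sup => _ [h hf <-].
rewrite -integralT_nnsfun [leRHS]integral_mkcond.
apply: ae_ge0_le_integral.
- exact: measurableT.
- by move=> x _; rewrite lee_fin; exact: fun_ge0.
- exact/measurable_EFinP/measurable_funTS.
- by move=> x _; exact: erestrict_ge0.
- exact/(measurable_restrictT _ mD).
- apply: filterS fg => x fg _; apply: le_trans (hf x) _.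
  by rewrite !patchE; case: ifPn => // /set_mem.
Qed.

(** On the complement of a measurable null set, g lies below f everywhere and the
simple functions below g are below f. *)
Lemma ge_integral_lb (f g : T -> \bar R) : (forall x, D x -> 0 <= f x) ->
  (forall x, D x -> 0 <= g x) -> measurable_fun D g ->
  {ae mu, forall x, D x -> g x <= f x} ->
  \int[mu]_(x in D) g x <= \int[mu]_(x in D) f x.
Proof.
move=> f0 g0 mg [N [mN N0 gf]].
have g0' x : (D `\` N) x -> 0 <= g x by move=> [Dx _]; exact: g0.
rewrite (ge0_negligible_integral mN mD mg g0 N0) (ge0_integralE _ g0') (ge0_integralE _ f0).
apply: le_ereal_sup => _ [h hg <-]; exists h => //= x.
apply: le_trans (hg x) _; rewrite !patchE; case: ifPn => [/set_mem[Dx Nx]|_].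
  rewrite mem_set//; apply: contrapT => gfx; apply: Nx; apply: gf => /= h1.
  by apply: gfx; exact: h1.
by case: ifPn => // /set_mem; exact: f0.
Qed.

(** The function f is arbitrary: the lemma is applied to x |-> a_i(x, Du(x)) times
a derivative.  An integrable lower bound h is required because otherwise the
negative part of f could have an infinite integral, and the real-valued
integral would be the default value 0. *)
Lemma le_Rintegral_ae (f g h : T -> R) :
  mu.-integrable D (EFin \o g) -> mu.-integrable D (EFin \o h) ->
  {ae mu, forall x, D x -> (h x <= f x)%R /\ (f x <= g x)%R} ->
  (Rintegral mu D f <= Rintegral mu D g)%R.
Proof.
move=> ig ih hfg.
have [mg mh] := (measurable_int _ ig, measurable_int _ ih).
have ipos (k : T -> R) : mu.-integrable D (EFin \o k) -> \int[mu]_(x in D) (EFin \o k)^\+ x < +oo.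
  by move=> /integrable_funepos => /(_ mD)/integrableP[_]; under eq_integral do rewrite gee0_abs//.
have ineg (k : T -> R) : mu.-integrable D (EFin \o k) -> \int[mu]_(x in D) (EFin \o k)^\- x < +oo.
  by move=> /integrable_funeneg => /(_ mD)/integrableP[_]; under eq_integral do rewrite gee0_abs//.
have p1 : \int[mu]_(x in D) (EFin \o f)^\+ x <= \int[mu]_(x in D) (EFin \o g)^\+ x.
  apply: le_integral_ub => //; first exact: measurable_funepos.
  apply: filterS hfg => x fg /fg[_ fgx]; rewrite !funeposE /=.
  by rewrite -!EFin_max lee_fin ge_max !le_max lexx fgx orbT.
have p2 : \int[mu]_(x in D) (EFin \o f)^\- x <= \int[mu]_(x in D) (EFin \o h)^\- x.
  apply: le_integral_ub => //; first exact: measurable_funeneg.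
  apply: filterS hfg => x fg /fg[hfx _]; rewrite !funenegE /=.
  by rewrite -!EFin_max lee_fin ge_max !le_max lexx lerN2 hfx orbT.
have p3 : \int[mu]_(x in D) (EFin \o g)^\- x <= \int[mu]_(x in D) (EFin \o f)^\- x.
  apply: ge_integral_lb => //; first exact: measurable_funeneg.
  apply: filterS hfg => x fg /fg[_ fgx]; rewrite !funenegE /=.
  by rewrite -!EFin_max lee_fin ge_max !le_max lexx lerN2 fgx orbT.
have fin (k : T -> \bar R) : \int[mu]_(x in D) k^\+ x < +oo -> \int[mu]_(x in D) k^\+ x \is a fin_num.
  by move=> h1; rewrite ge0_fin_numE// integral_ge0.
have finN (k : T -> \bar R) : \int[mu]_(x in D) k^\- x < +oo -> \int[mu]_(x in D) k^\- x \is a fin_num.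
  by move=> h1; rewrite ge0_fin_numE// integral_ge0.
have Fp := fin (EFin \o f) (le_lt_trans p1 (ipos _ ig)).
have Fn := finN (EFin \o f) (le_lt_trans p2 (ineg _ ih)).
have Gp := fin (EFin \o g) (ipos _ ig).
have Gn := finN (EFin \o g) (ineg _ ig).
rewrite /Rintegral integralE [in leRHS]integralE.
apply: fine_le; [by rewrite fin_numB; apply/andP|by rewrite fin_numB; apply/andP|exact: leeB].
Qed.

Lemma hoelder_int (f g : T -> R) (p q : R) :
  measurable_fun D f -> measurable_fun D g ->
  (0 < p)%R -> (0 < q)%R -> (p^-1 + q^-1 = 1)%R ->
  \int[mu]_(x in D) (`|f x * g x|)%:E <=
  (\int[mu]_(x in D) (`|f x| `^ p)%:E) `^ p^-1 * (\int[mu]_(x in D) (`|g x| `^ q)%:E) `^ q^-1.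
Proof.
move=> mf mg p0 q0 pq.
have := @hoelder _ _ _ mu (f \_ D) (g \_ D) p q.
move=> /(_ (proj1 (measurable_restrictT _ mD) mf) (proj1 (measurable_restrictT _ mD) mg) p0 q0 pq).
rewrite Lnorm1 unlock.
have E (k : T -> R) r : (0 < r)%R -> \int[mu]_x `|(EFin \o k \_ D) x| `^ r = \int[mu]_(x in D) (`|k x| `^ r)%:E.
  move=> r0; rewrite [RHS]integral_mkcond; apply: eq_integral => x _.
  rewrite /= !patchE; case: ifPn => _ //.
  by rewrite normr0 powR0 ?gt_eqF.
rewrite !E//; congr (_ <= _).
rewrite [RHS]integral_mkcond; apply: eq_integral => x _.
by rewrite /= !patchE; case: ifPn => _ //; rewrite mulr0 normr0.
Qed.

(** Pointwise |f|^s <= 1 + |f|^r. *)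
Lemma integrable_powR_le (f : T -> R) (r s : R) : mu D < +oo ->
  measurable_fun D f -> (0 <= s)%R -> (s <= r)%R ->
  \int[mu]_(x in D) (`|f x| `^ r)%:E < +oo -> \int[mu]_(x in D) (`|f x| `^ s)%:E < +oo.
Proof.
move=> mD_oo mf s0 sr ifr.
have mp (t : R) : measurable_fun D (fun x => `|f x| `^ t)%R.
  by apply: (measurableT_comp (measurable_powR t)); apply: (measurableT_comp (@normr_measurable R setT)).
apply: (@le_lt_trans _ _ (\int[mu]_(x in D) (1 + (`|f x| `^ r)%:E))).
  apply: ge0_le_integral.
  - exact: mD.
  - by move=> x _; rewrite lee_fin powR_ge0.
  - exact/measurable_EFinP.
  - by apply: emeasurable_funD; [exact: measurable_cst|exact/measurable_EFinP].
  - move=> x _; rewrite -EFinD lee_fin.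
    have [f1|f1] := leP `|f x|%R 1%R.
      by rewrite (le_trans (powR_le1 _ s0))// ?normr_ge0// lerDl powR_ge0.
    by rewrite -[leLHS]add0r lerD// ler_powR// ltW.
rewrite ge0_integralD//.
- rewrite integral_cst// mul1e lte_add_pinfty//.
- exact/measurable_EFinP.
Qed.

Lemma integral_powR_add (f g : T -> R) (r : R) : (0 <= r)%R ->
  measurable_fun D f -> measurable_fun D g ->
  \int[mu]_(x in D) (`|f x| `^ r)%:E < +oo -> \int[mu]_(x in D) (`|g x| `^ r)%:E < +oo ->
  \int[mu]_(x in D) (`|f x + g x| `^ r)%:E < +oo.
Proof.
move=> r0 mf mg lf lg.
have mp (k : T -> R) : measurable_fun D k -> measurable_fun D (fun x => `|k x| `^ r)%R.
  by move=> mk; apply: (measurableT_comp (measurable_powR r)); apply: (measurableT_comp (@normr_measurable R setT)).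
have c0 : (0 <= 2 `^ r :> R)%R by exact: powR_ge0.
apply: (@le_lt_trans _ _ (\int[mu]_(x in D) ((2 `^ r)%:E * ((`|f x| `^ r)%:E + (`|g x| `^ r)%:E)))).
  apply: ge0_le_integral.
  - exact: mD.
  - by move=> x _; rewrite lee_fin powR_ge0.
  - by apply/measurable_EFinP/mp; exact: measurable_funD.
  - by apply: measurable_funeM; apply: emeasurable_funD; apply/measurable_EFinP; exact: mp.
  - move=> x _; rewrite -EFinD -EFinM lee_fin.
    have key (a c : R) : (`|a| <= `|c| -> `|a + c| `^ r <= 2 `^ r * (`|a| `^ r + `|c| `^ r))%R.
      move=> ac; apply: (@le_trans _ _ ((2 * `|c|) `^ r)%R).
        apply: ge0_ler_powR; rewrite ?nnegrE ?mulr_ge0//.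
        by rewrite (le_trans (ler_normD _ _))// mulrDl mul1r lerD.
      by rewrite powRM// ler_wpM2l// lerDr powR_ge0.
    have [ac|/ltW ac] := leP `|f x|%R `|g x|%R; first exact: key.
    by rewrite addrC [X in (_ * X)%R]addrC; exact: key.
have mf' : measurable_fun D (fun x => (`|f x| `^ r)%:E) by apply/measurable_EFinP/mp.
have mg' : measurable_fun D (fun x => (`|g x| `^ r)%:E) by apply/measurable_EFinP/mp.
rewrite ge0_integralZl_EFin//.
- rewrite ge0_integralD//.
  apply: lte_mul_pinfty.
  - by rewrite lee_fin.
  - by rewrite fin_numE.
  - exact: (lte_add_pinfty lf lg).
- by move=> x _; rewrite -EFinD lee_fin addr_ge0 ?powR_ge0.
- exact: emeasurable_funD.
Qed.

Lemma integral_powR_sum m (f : 'I_m -> T -> R) (r : R) : (0 < r)%R ->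
  (forall i, measurable_fun D (f i)) ->
  (forall i, \int[mu]_(x in D) (`|f i x| `^ r)%:E < +oo) ->
  \int[mu]_(x in D) (`|\sum_(i < m) f i x| `^ r)%:E < +oo.
Proof.
move=> r0; elim: m f => [|m IH] f mf lf.
  under eq_integral do rewrite big_ord0 normr0 powR0 ?gt_eqF//.
  by rewrite integral0.
under eq_integral do rewrite big_ord_recl.
apply: integral_powR_add => //; first exact: ltW.
- exact: measurable_sum.
- by apply: IH.
Qed.

End ae_comparison.

(** * Decay of the superlevel sets *)
Section sobolev_algebra.
Context {R : realType}.

Lemma prod_powR N (r : 'I_N.+1 -> R) (x : R) : 0 <= x -> (forall i, 0 < r i) ->
  \prod_(i < N.+1) x `^ r i = x `^ (\sum_(i < N.+1) r i).
Proof.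
rewrite le_eqVlt => /orP[/eqP<- r0|x0 _].
  rewrite big_ord_recl powR0 ?gt_eqF// mul0r powR0// gt_eqF// big_ord_recl.
  by apply: ltr_wpDr => //; apply: sumr_ge0 => i _; exact: ltW.
elim/big_rec2 : _ => [|i y z _ ->]; first by rewrite powRr0.
by rewrite powRD// (gt_eqF x0) implybT.
Qed.

(** After raising to the power N + 1, the exponents of X on the two sides are
N + 1 and N + 2 - sigma; the difference
sigma - 1 is positive and X can be divided out. *)
Lemma sobolev_algebra N (c r : 'I_N.+2 -> R) (X E L : R) (sigma := \sum_(i < N.+2) r i) :
  0 <= X -> 0 <= E -> 0 < L -> (forall i, 0 < c i) -> (forall i, 0 < r i < 1) -> 1 < sigma ->
  X <= (\prod_(i < N.+2) (c i / L * (X `^ (1 - r i) * E `^ r i))) `^ (N.+1%:R^-1) ->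
  X <= (\prod_(i < N.+2) c i) `^ (sigma - 1)^-1 * L `^ (- (N.+2%:R / (sigma - 1))) *
       E `^ (sigma / (sigma - 1)).
Proof.
rewrite le_eqVlt => /orP[/eqP<- *|X0 E0 L0 c0 r01 s1]; first by rewrite !mulr_ge0 ?powR_ge0.
have r0 i : 0 < r i by have /andP[] := r01 i.
have r1 i : 0 < 1 - r i by rewrite subr_gt0; have /andP[] := r01 i.
rewrite !big_split/= (prod_powR (ltW X0) r1) (prod_powR E0 r0) -/sigma.
rewrite prodr_const card_ord sumrB -/sigma sumr_const card_ord.
set P := \prod_(i < N.+2) c i => h.
have P0 : 0 < P by exact: prodr_gt0.
have d0 : 0 < sigma - 1 by rewrite subr_gt0.
have N0 : 0 < N.+1%:R :> R by [].
set A := P * L^-1 ^+ N.+2 * (X `^ (1 *+ N.+2 - sigma) * E `^ sigma) in h.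
have A0 : 0 <= A.
  rewrite /A; apply: mulr_ge0; last by rewrite mulr_ge0 ?powR_ge0.
  by apply: mulr_ge0; [exact: ltW|rewrite exprn_ge0// invr_ge0 ltW].
have h1 : X `^ N.+1%:R <= A.
  have := ge0_ler_powR (ltW N0) _ _ h; rewrite !nnegrE powR_ge0 (ltW X0) => /(_ isT isT).
  by rewrite -powRrM mulVf ?gt_eqF// powRr1.
have h2 : X `^ (sigma - 1) <= P * L `^ (- N.+2%:R) * E `^ sigma.
  have -> : sigma - 1 = N.+1%:R - (1 *+ N.+2 - sigma) by rewrite -[1 *+ _]natr1; ring.
  rewrite powRD; last by rewrite (gt_eqF X0) implybT.
  rewrite powRN ler_pdivrMr ?powR_gt0//; apply: (le_trans h1).
  by rewrite /A exprVn powRN powR_mulrn ?(ltW L0)//; lra.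
have := ge0_ler_powR (_ : 0 <= (sigma - 1)^-1) _ _ h2.
rewrite invr_ge0 (ltW d0) !nnegrE powR_ge0 !mulr_ge0 ?powR_ge0 ?(ltW P0)// => /(_ isT isT isT).
rewrite -powRrM mulfV ?gt_eqF// powRr1 ?(ltW X0)// => /le_trans; apply.
rewrite powRM ?mulr_ge0 ?powR_ge0 ?(ltW P0)// powRM ?powR_ge0 ?(ltW P0)//.
by rewrite -!powRrM mulNr.
Qed.

End sobolev_algebra.

Section level_sets.
Context d (T : measurableType d) {R : realType} (mu : {measure set T -> \bar R}) (D : set T).
Hypothesis mD : measurable D.
Hypothesis muD : (mu D < +oo)%E.
Variables (n : nat) (p : 'I_n.+2 -> R) (w : T -> R) (dw : 'I_n.+2 -> T -> R) (F : T -> R).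
Hypothesis p1 : forall i, 1 < p i.
Hypothesis mw : measurable_fun D w.
Hypothesis mdw : forall i, measurable_fun D (dw i).
Hypothesis idw : forall i, (\int[mu]_(x in D) (`|dw i x| `^ p i)%:E < +oo)%E.
Let sigma := \sum_(i < n.+2) (p i)^-1.
Hypothesis sigma1 : 1 < sigma.
Let s := n.+2%:R / (sigma - 1).
Let gam i := 1 + s * (1 - (p i)^-1).

Definition superlevel (L : R) := D `&` [set x | L < `|w x|].
Definition tail_measure (L : R) := fine (mu (superlevel L)).
Let grad_pow x := \sum_(i < n.+2) `|dw i x| `^ p i.
Let tail_energy L := fine (\int[mu]_(x in superlevel L) (grad_pow x)%:E)%E.
Let cutoff_mass L := fine (\int[mu]_(x in D) (flat 0 (level L (w x)) `^ s)%:E)%E.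

Lemma measurable_superlevel L : measurable (superlevel L).
Proof.
have mnw : measurable_fun D (fun x => `|w x|) by apply: (measurableT_comp (@normr_measurable R setT)).
rewrite /superlevel (_ : [set x | L < `|w x|] = (fun x => `|w x|) @^-1` `]L, +oo[); first exact: mnw.
by apply/seteqP; split => x /=; rewrite in_itv/= andbT.
Qed.

Lemma superlevel_sub L : superlevel L `<=` D.
Proof. by move=> x []. Qed.

Lemma tail_measureE L : (tail_measure L)%:E = mu (superlevel L).
Proof.
rewrite /tail_measure fineK// ge0_fin_numE// (le_lt_trans _ muD)// le_measure ?inE//.
  exact: measurable_superlevel.
exact: superlevel_sub.
Qed.

Lemma tail_measure_ge0 L : 0 <= tail_measure L. Proof. exact: fine_ge0. Qed.

Lemma tail_measure_bounded : exists B, forall L, 0 <= tail_measure L <= B.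
Proof.
exists (fine (mu D)) => L; rewrite tail_measure_ge0 /= -lee_fin tail_measureE fineK ?ge0_fin_numE//.
by rewrite le_measure ?inE//; [exact: measurable_superlevel|exact: superlevel_sub].
Qed.

Let s0 : 0 < s. Proof. by rewrite divr_gt0// subr_gt0. Qed.

Let mdwp i : measurable_fun D (fun x => `|dw i x| `^ p i).
Proof. by apply: (measurableT_comp (measurable_powR _)); apply: (measurableT_comp (@normr_measurable R setT)). Qed.

Let mgrad_pow : measurable_fun D grad_pow. Proof. exact: measurable_sum. Qed.

Let grad_pow_ge0 x : 0 <= grad_pow x. Proof. by apply: sumr_ge0 => i _; exact: powR_ge0. Qed.

Lemma integral_grad_pow_lty : (\int[mu]_(x in D) (grad_pow x)%:E < +oo)%E.
Proof.
under eq_integral do rewrite /grad_pow -sumEFin.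
rewrite ge0_integral_sum//.
- by apply/lte_sum_pinfty => i _.
- by move=> i; exact/measurable_EFinP.
Qed.

Lemma le_integral_sub A (f : T -> R) : measurable A -> A `<=` D -> measurable_fun D f ->
  (forall x, 0 <= f x) -> (\int[mu]_(x in A) (f x)%:E <= \int[mu]_(x in D) (f x)%:E)%E.
Proof.
move=> mA AD mf f0; apply: ge0_subset_integral => //; last by move=> x _; rewrite lee_fin.
exact/measurable_EFinP.
Qed.

Lemma tail_energyE L : (tail_energy L)%:E = (\int[mu]_(x in superlevel L) (grad_pow x)%:E)%E.
Proof.
rewrite /tail_energy fineK// ge0_fin_numE; last by apply: integral_ge0 => x _; rewrite lee_fin.
apply: le_lt_trans integral_grad_pow_lty; apply: le_integral_sub => //.
  exact: measurable_superlevel.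
exact: superlevel_sub.
Qed.

Lemma tail_energy_ge0 L : 0 <= tail_energy L.
Proof. by apply/fine_ge0/integral_ge0 => x _; rewrite lee_fin. Qed.

Let mcut L : measurable_fun D (fun x => flat 0 (level L (w x))).
Proof.
apply: (measurableT_comp (f := fun y : R => flat 0 (level L y))) => //.
apply: continuous_measurable_fun => y.
by apply: continuous_comp; [exact: continuous_level|exact: continuous_flat].
Qed.

Let mcutp L r : measurable_fun D (fun x => flat 0 (level L (w x)) `^ r).
Proof. exact: (measurableT_comp (measurable_powR r) (mcut L)). Qed.

Lemma cutoff_massE L : (cutoff_mass L)%:E = (\int[mu]_(x in D) (flat 0 (level L (w x)) `^ s)%:E)%E.
Proof.
rewrite /cutoff_mass fineK// ge0_fin_numE; last by apply: integral_ge0 => x _; rewrite lee_fin powR_ge0.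
apply: (@le_lt_trans _ _ (\int[mu]_(x in D) 1)%E); last by rewrite integral_cst// mul1e.
apply: ge0_le_integral => //.
- by move=> x _; rewrite lee_fin powR_ge0.
- exact/measurable_EFinP.
- by move=> x _; rewrite lee_fin powR_le1 ?(ltW s0)// flat0_le1.
Qed.

Lemma cutoff_mass_ge0 L : 0 <= cutoff_mass L.
Proof. by apply/fine_ge0/integral_ge0 => x _; rewrite lee_fin powR_ge0. Qed.

(** On {|w| > 2L} the profile is at least flat 0 3, since level L w >= 3 there. *)
Lemma tail_measure_le_mass L : 0 < L -> flat 0 3 `^ s * tail_measure (2 * L) <= cutoff_mass L.
Proof.
move=> L0; rewrite -lee_fin EFinM tail_measureE cutoff_massE -(integral_cst mu (measurable_superlevel _)).
apply: (@le_trans _ _ (\int[mu]_(x in superlevel (2 * L)) (flat 0 (level L (w x)) `^ s)%:E)%E).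
  apply: ge0_le_integral.
  - exact: measurable_superlevel.
  - by move=> x _; rewrite lee_fin powR_ge0.
  - exact: measurable_cst.
  - by apply/measurable_EFinP; apply: measurable_funS (mcutp L s) => //; exact: superlevel_sub.
  - move=> x [_ /= wx]; rewrite lee_fin; apply: ge0_ler_powR; rewrite ?nnegrE ?flat_ge0 ?(ltW s0)//.
    by apply: flat0_mono; apply: level_ge3 => //; exact: ltW.
apply: le_integral_sub => //; [exact: measurable_superlevel|exact: superlevel_sub|].
by move=> x; exact: powR_ge0.
Qed.

Lemma gam_ge1 i : 1 <= gam i.
Proof. by rewrite /gam lerDl mulr_ge0 ?(ltW s0)// subr_ge0 invf_le1// ?ltW// (lt_trans ltr01). Qed.

Let p0 i : 0 < p i. Proof. exact: lt_trans (p1 i). Qed.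

(** The derivative of the cutoff vanishes outside of {|w| > L} and is bounded by
1 / L times the power s (1 - 1 / p_i) of the profile, up to a constant.  In
Hoelder's inequality the exponent conjugate to p_i turns it into the power s. *)
Lemma integral_cutoff' L i : 0 < L ->
  (\int[mu]_(x in D) `|cutoff' L (gam i) (w x) * dw i x|%:E <=
   (96 * gam i / L * (cutoff_mass L `^ (1 - (p i)^-1) * tail_energy L `^ (p i)^-1))%:E)%E.
Proof.
move=> L0; have mE := measurable_superlevel L; have ED := @superlevel_sub L.
set q := (1 - (p i)^-1)^-1.
have iq : q^-1 = 1 - (p i)^-1 by rewrite invrK.
have q0 : 0 < q by rewrite invr_gt0 subr_gt0 invf_lt1.
have c0 : 0 <= 96 * gam i / L by rewrite !mulr_ge0 ?invr_ge0 ?(ltW L0)// (le_trans _ (gam_ge1 i)).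
have mc' : measurable_fun D (fun x => cutoff' L (gam i) (w x)).
  apply: (measurableT_comp (f := cutoff' L (gam i))) => //.
  by apply: continuous_measurable_fun => y; exact: continuous_cutoff'.
have mcd : measurable_fun D (fun x => `|cutoff' L (gam i) (w x) * dw i x|).
  by apply: (measurableT_comp (@normr_measurable R setT)); exact: measurable_funM.
rewrite (_ : \int[mu]_(x in D) _ = \int[mu]_(x in superlevel L) `|cutoff' L (gam i) (w x) * dw i x|%:E)%E; last first.
  rewrite [LHS]integral_mkcond [RHS]integral_mkcond; apply: eq_integral => x _.
  rewrite !patchE; case: ifPn => Dx; case: ifPn => Ex //.
    have wL : `|w x| <= L.
      by rewrite leNgt; apply: contra Ex => wx; rewrite inE; split; [exact/set_mem|].
    rewrite /cutoff' flat_le0 ?mul0r ?normr0// pmulr_lle0 ?level_le0// invr_gt0.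
    exact: lt_le_trans (gam_ge1 i).
  by move: Dx; rewrite notin_setE => -[]; apply: ED; exact/set_mem.
have mE' f : measurable_fun D f -> measurable_fun (superlevel L) f by apply: measurable_funS.
apply: (@le_trans _ _ (\int[mu]_(x in superlevel L) ((96 * gam i / L)%:E *
    `|flat 0 (level L (w x)) `^ (s * (1 - (p i)^-1)) * dw i x|%:E))%E).
  apply: ge0_le_integral.
  - exact: mE.
  - by move=> x _; rewrite lee_fin.
  - by apply/measurable_EFinP; exact: measurable_funS mcd.
  - apply: measurable_funeM; apply/measurable_EFinP; apply: (measurable_funS mD) => //.
    by apply: (measurableT_comp (@normr_measurable R setT)); exact: measurable_funM.
  - move=> x _; rewrite -EFinM lee_fin (normrM (cutoff' _ _ _)) (normrM (_ `^ _)) [leRHS]mulrA; apply: ler_wpM2r => //.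
    rewrite (ger0_norm (powR_ge0 _ _)).
    by have := cutoff'_le (w x) L0 (gam_ge1 i); rewrite {3}/gam addrAC subrr add0r.
rewrite ge0_integralZl_EFin//; last first.
  apply/measurable_EFinP; apply: (measurable_funS mD) => //.
  by apply: (measurableT_comp (@normr_measurable R setT)); exact: measurable_funM.
rewrite [leRHS]EFinM; apply: lee_wpmul2l; first by rewrite lee_fin.
have pq : q^-1 + (p i)^-1 = 1 by rewrite iq subrK.
apply: le_trans (hoelder_int mu mE (measurable_funS mD ED (mcutp L _)) (measurable_funS mD ED (mdw i)) q0 (p0 i) pq) _.
rewrite iq EFinM -!poweR_EFin cutoff_massE tail_energyE.
apply: lee_pmul; rewrite ?poweR_ge0//.
- apply: le_poweR; first by rewrite -iq invr_ge0 ltW.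
    by apply: integral_ge0 => x _; rewrite lee_fin powR_ge0.
  under eq_integral do rewrite (ger0_norm (powR_ge0 _ _)) -powRrM -mulrA mulfV ?mulr1 ?gt_eqF// ?subr_gt0 ?invf_lt1//.
  by apply: le_integral_sub => // x; exact: powR_ge0.
- apply: le_poweR; first by rewrite invr_ge0 ltW.
    by apply: integral_ge0 => x _; rewrite lee_fin powR_ge0.
  apply: ge0_le_integral => //.
  + by apply/measurable_EFinP; exact: measurable_funS (mdwp i).
  + by apply/measurable_EFinP; exact: measurable_funS mgrad_pow.
  + move=> x _; rewrite lee_fin /grad_pow (bigD1 i)//= lerDl.
    by apply: sumr_ge0 => j _; exact: powR_ge0.
Qed.

Hypothesis gagliardo : forall L, 0 < L ->
  (\int[mu]_(x in D) (\prod_(i < n.+2) `|cutoff L (gam i) (w x)|%:E) `^ (n.+1%:R^-1) <=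
   (\prod_(i < n.+2) \int[mu]_(x in D) `|cutoff' L (gam i) (w x) * dw i x|%:E) `^ (n.+1%:R^-1))%E.

Let gam0 i : 0 < gam i. Proof. exact: lt_le_trans (gam_ge1 i). Qed.

(** The value of s is chosen for this identity: the (N - 1)-st root of the product
of the N cutoffs is then the power s of the profile, N being the dimension. *)
Lemma sum_gam : \sum_(i < n.+2) gam i = n.+1%:R * s.
Proof.
rewrite big_split/= -mulr_sumr sumrB !sumr_const !card_ord -/sigma /s.
rewrite -[1 *+ n.+2]natr1; field.
by rewrite gt_eqF// subr_gt0.
Qed.

Lemma prod_cutoff L x :
  (\prod_(i < n.+2) `|cutoff L (gam i) (w x)|) `^ (n.+1%:R^-1) = flat 0 (level L (w x)) `^ s.
Proof.
under eq_bigr do rewrite cutoff_powR// ger0_norm ?powR_ge0//.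
rewrite prod_powR ?flat_ge0// sum_gam -powRrM mulrAC mulfV ?mul1r// pnatr_eq0//.
Qed.

Lemma cutoff_mass_le L : 0 < L ->
  cutoff_mass L <= (\prod_(i < n.+2) (96 * gam i)) `^ (sigma - 1)^-1 * L `^ (- s) * tail_energy L `^ (sigma / (sigma - 1)).
Proof.
move=> L0; apply: sobolev_algebra => //.
- exact: cutoff_mass_ge0.
- exact: tail_energy_ge0.
- by move=> i; rewrite mulr_gt0.
- by move=> i; rewrite invr_gt0 p0/= invf_lt1.
rewrite -lee_fin cutoff_massE.
under eq_integral do rewrite -prod_cutoff -poweR_EFin -prodEFin.
apply: le_trans (gagliardo L0) _; rewrite -poweR_EFin -prodEFin.
apply: le_poweR; first by rewrite invr_ge0.
  by apply: prode_ge0 => i _; exact: integral_ge0.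
apply: lee_prode => i; first exact: integral_ge0.
exact: integral_cutoff'.
Qed.

Variables (kappa C : R).
Hypothesis kappa01 : 0 < kappa < 1.
Hypothesis kappa_sigma : kappa * (sigma / (sigma - 1)) < 1.
Hypothesis C0 : 0 <= C.
Hypothesis mF : measurable_fun D F.
Hypothesis F0 : forall x, 0 <= F x.
Hypothesis iF : (\int[mu]_(x in D) (F x `^ (1 - kappa)^-1)%:E < +oo)%E.
Hypothesis energy : forall L, 0 < L ->
  (\int[mu]_(x in D) (trunc' L (w x) * grad_pow x)%:E <= C%:E * \int[mu]_(x in D) (trunc' L (w x) * F x)%:E)%E.

Let A := fine (\int[mu]_(x in D) (F x `^ (1 - kappa)^-1)%:E)%E.

Let mtr L : measurable_fun D (fun x => trunc' L (w x)).
Proof.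
apply: (measurableT_comp (f := trunc' L)) => //.
by apply: continuous_measurable_fun => y; exact: continuous_trunc'.
Qed.

Lemma integral_F_le L : 
  (\int[mu]_(x in superlevel L) (F x)%:E <= (A `^ (1 - kappa) * tail_measure L `^ kappa)%:E)%E.
Proof.
have /andP[k0 k1] := kappa01; have k1' : 0 < 1 - kappa by rewrite subr_gt0.
have mE := measurable_superlevel L; have ED := @superlevel_sub L.
have A0 : 0 <= A by apply/fine_ge0/integral_ge0 => x _; rewrite lee_fin powR_ge0.
have AE : A%:E = (\int[mu]_(x in D) (F x `^ (1 - kappa)^-1)%:E)%E.
  by rewrite /A fineK// ge0_fin_numE// integral_ge0// => x _; rewrite lee_fin powR_ge0.
have pq : (1 - kappa)^-1^-1 + kappa^-1^-1 = 1 by rewrite !invrK subrK.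
have k0' : 0 < kappa^-1 by rewrite invr_gt0.
have k1'' : 0 < (1 - kappa)^-1 by rewrite invr_gt0.
have := hoelder_int mu mE (measurable_funS mD ED mF) (measurable_cst (1 : R)) k1'' k0' pq.
under eq_integral do rewrite mulr1 ger0_norm//.
move=> /le_trans; apply.
rewrite EFinM -!poweR_EFin AE tail_measureE !invrK; apply: lee_pmul; rewrite ?poweR_ge0//.
- apply: le_poweR; first exact: ltW.
    by apply: integral_ge0 => x _; rewrite lee_fin powR_ge0.
  under eq_integral do rewrite ger0_norm//.
  apply: le_integral_sub => //; last by move=> x; exact: powR_ge0.
  exact: (measurableT_comp (measurable_powR _)).
- under eq_integral do rewrite normr1 powR1/=.
  by rewrite integral_cst// mul1e.
Qed.

(** T_L' is at least flat 0 3 on {|w| > 2L} and is supported in {|w| > L}. *)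
Lemma tail_energy_le L : 0 < L ->
  tail_energy (2 * L) <= (C * 97 * A `^ (1 - kappa) / flat 0 3) * tail_measure L `^ kappa.
Proof.
move=> L0; have f3 := @flat0_3_gt0 R.
have mE := measurable_superlevel (2 * L); have ED := @superlevel_sub (2 * L).
have mE1 := measurable_superlevel L; have ED1 := @superlevel_sub L.
have nn x : 0 <= trunc' L (w x) * grad_pow x by rewrite mulr_ge0// trunc'_ge0.
have m1 : measurable_fun D (fun x => trunc' L (w x) * grad_pow x) by exact: measurable_funM.
have m2 : measurable_fun D (fun x => trunc' L (w x) * F x) by exact: measurable_funM.
suff : flat 0 3 * tail_energy (2 * L) <= C * 97 * (A `^ (1 - kappa) * tail_measure L `^ kappa).
  by move=> h; rewrite mulrAC ler_pdivlMr// mulrC (le_trans h)// !mulrA.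
rewrite -lee_fin EFinM tail_energyE.
apply: (@le_trans _ _ (\int[mu]_(x in D) (trunc' L (w x) * grad_pow x)%:E)%E).
  apply: le_trans (le_integral_sub mE ED m1 nn).
  rewrite -ge0_integralZl_EFin//; last 3 first.
  - by move=> x _; rewrite lee_fin.
  - by apply/measurable_EFinP; exact: measurable_funS mgrad_pow.
  - exact: ltW.
  apply: ge0_le_integral.
  - exact: mE.
  - by move=> x _; rewrite -EFinM lee_fin mulr_ge0// ltW.
  - by apply: measurable_funeM; apply/measurable_EFinP; exact: measurable_funS mgrad_pow.
  - by apply/measurable_EFinP; exact: measurable_funS m1.
  - move=> x [_ /= wx]; rewrite -EFinM lee_fin ler_wpM2r//.
    by apply: trunc'_large => //; exact: ltW.
apply: le_trans (energy L0) _.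
rewrite -mulrA EFinM; apply: lee_wpmul2l; first by rewrite lee_fin.
apply: (@le_trans _ _ (97%:E * \int[mu]_(x in superlevel L) (F x)%:E)%E); last first.
  by rewrite [leRHS]EFinM; apply: lee_wpmul2l => //; exact: integral_F_le.
rewrite -ge0_integralZl_EFin//; last 2 first.
- by move=> x _; rewrite lee_fin.
- by apply/measurable_EFinP; exact: measurable_funS mF.
rewrite [leLHS](_ : _ = \int[mu]_(x in superlevel L) (trunc' L (w x) * F x)%:E)%E.
  apply: ge0_le_integral.
  - exact: mE1.
  - by move=> x _; rewrite lee_fin mulr_ge0// trunc'_ge0.
  - by apply/measurable_EFinP; exact: measurable_funS m2.
  - by apply: measurable_funeM; apply/measurable_EFinP; exact: measurable_funS mF.
  - move=> x _; rewrite -EFinM lee_fin ler_wpM2r//.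
    by have := trunc'_le L (w x); rewrite ger0_norm// trunc'_ge0.
rewrite [LHS]integral_mkcond [RHS]integral_mkcond; apply: eq_integral => x _.
rewrite !patchE; case: ifPn => Dx; case: ifPn => Ex //.
  have wL : `|w x| <= L.
    by rewrite leNgt; apply: contra Ex => wx; rewrite inE; split; [exact/set_mem|].
  by rewrite trunc'_small// mul0r.
by move: Dx; rewrite notin_setE => -[]; apply: ED1; exact/set_mem.
Qed.

(** The Sobolev estimate is used at the level 2L, where the energy estimate
bounds its right side by the measure of the superlevel set at L. *)
Lemma superlevel_decay : exists2 K, 0 < K & forall L, 0 < L ->
  tail_measure L <= K / L `^ (s / (1 - kappa * (sigma / (sigma - 1)))).
Proof.
have f3 := @flat0_3_gt0 R; have f3s : 0 < flat 0 3 `^ s :> R by rewrite powR_gt0.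
have /andP[k0 k1] := kappa01.
have sg : 0 < sigma / (sigma - 1) by rewrite divr_gt0 ?subr_gt0// (lt_trans ltr01).
have [B hB] := tail_measure_bounded.
set P := (\prod_(i < n.+2) (96 * gam i)) `^ (sigma - 1)^-1.
have P0 : 0 <= P by exact: powR_ge0.
set Q := C * 97 * A `^ (1 - kappa) / flat 0 3.
have Q0 : 0 <= Q by rewrite /Q !mulr_ge0 ?powR_ge0// invr_ge0 ltW.
apply: (@decay_iteration _ _ (P * 2 `^ (- s) * Q `^ (sigma / (sigma - 1)) / flat 0 3 `^ s) B) => //.
- by rewrite mulr_ge0 ?ltW.
- by rewrite mulr_ge0 ?invr_ge0 ?(ltW f3s)// !mulr_ge0 ?powR_ge0.
move=> L L0; have L20 : 0 < 2 * L by rewrite mulr_gt0.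
have h1 := tail_measure_le_mass L20; have h2 := cutoff_mass_le L20; have h3 := tail_energy_le L0.
rewrite mulrA -natrM in h1.
have h4 : tail_energy (2 * L) `^ (sigma / (sigma - 1)) <= Q `^ (sigma / (sigma - 1)) * tail_measure L `^ (kappa * (sigma / (sigma - 1))).
  rewrite powRrM -powRM ?powR_ge0//; apply: ge0_ler_powR; rewrite ?nnegrE ?tail_energy_ge0 ?(ltW sg)//.
  by rewrite mulr_ge0 ?powR_ge0.
have h5 : flat 0 3 `^ s * tail_measure (4 * L) <= P * (2 `^ (- s) * L `^ (- s)) *
    (Q `^ (sigma / (sigma - 1)) * tail_measure L `^ (kappa * (sigma / (sigma - 1)))).
  apply: (le_trans h1); apply: (le_trans h2); rewrite -/P (powRM _ _ (ltW L0))//.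
  by apply: ler_wpM2l => //; rewrite !mulr_ge0 ?powR_ge0.
rewrite -(ler_pM2l f3s); apply: (le_trans h5); rewrite le_eqVlt; apply/orP; left; apply/eqP.
move: f3s; move: (flat 0 3 `^ s) (2 `^ _) (L `^ _) (Q `^ _) (tail_measure L `^ _) => a0 a1 a2 a3 a4 a00.
by field; rewrite gt_eqF.
Qed.

End level_sets.

(** * Coercivity of the structure conditions *)
Section coercivity.
Context {R : realType}.

Definition young_cst (e p : R) : R := (e `^ (- p^-1)) `^ (1 - p^-1)^-1.

(** Young's inequality with weights e^{-1/p} and e^{1/p} on the two factors. *)
Lemma young_eps (x y e p : R) : 0 <= x -> 0 <= y -> 0 < e -> 1 < p ->
  x * y <= young_cst e p * x `^ (1 - p^-1)^-1 + e * y `^ p.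
Proof.
move=> x0 y0 e0 p1; have p0 : 0 < p by exact: lt_trans p1.
have q0 : 0 < (1 - p^-1)^-1 by rewrite invr_gt0 subr_gt0 invf_lt1.
have pq : (1 - p^-1)^-1^-1 + p^-1 = 1 by rewrite invrK subrK.
have -> : x * y = (e `^ (- p^-1) * x) * (e `^ p^-1 * y).
  by rewrite mulrACA -powRD ?(gt_eqF e0) ?implybT// addNr powRr0 mul1r.
have := conjugate_powR (mulr_ge0 (powR_ge0 e (- p^-1)) x0) (mulr_ge0 (powR_ge0 e p^-1) y0) q0 p0 pq.
move=> /le_trans; apply.
rewrite (powRM _ (powR_ge0 _ _) x0) (powRM _ (powR_ge0 _ _) y0) -[X in _ + X * _ / _]powRrM mulVf ?gt_eqF// powRr1 ?(ltW e0)//.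
apply: lerD.
  rewrite /young_cst invrK -[leRHS]mulr1; apply: ler_wpM2l; first by rewrite mulr_ge0 ?powR_ge0.
  by rewrite gerBl invr_ge0 ltW.
rewrite -[leRHS]mulr1; apply: ler_wpM2l; first by rewrite mulr_ge0 ?powR_ge0 ?(ltW e0).
by rewrite invf_le1// ltW.
Qed.

Lemma powR_conj_ge0 (x p : R) : 0 <= x -> 1 < p -> (x `^ (1 - p^-1)) `^ (1 - p^-1)^-1 = x.
Proof.
move=> x0 p1; have p0 : 0 < p by exact: lt_trans p1.
by rewrite -powRrM mulfV ?powRr1// gt_eqF// subr_gt0 invf_lt1.
Qed.

(** Here az, aw stand for a_i(x, Du) and a_i(x, D theta_star), and d for the
difference of the two gradients.  Monotonicity gives nu times the energy, and the terms
with aw and the data are estimated by Young's inequality with weight nu / 4,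
so that half of the energy remains. *)
Lemma coercive_bound m (p : 'I_m -> R) (c nu H F : R) (az aw fx d : 'I_m -> R) :
  (forall i, 1 < p i) -> 0 < c -> 0 < nu -> 0 <= H -> H <= F ->
  (forall i, `|fx i| `^ (1 - (p i)^-1)^-1 <= F) ->
  (forall i, `|aw i| <= c * H `^ (1 - (p i)^-1)) ->
  nu * (\sum_i `|d i| `^ p i) <= \sum_i (az i - aw i) * d i ->
  nu / 2 * (\sum_i `|d i| `^ p i) <=
  \sum_i (az i - fx i) * d i +
  (\sum_i young_cst (nu / 4) (p i) * (c `^ (1 - (p i)^-1)^-1 + 1)) * F.
Proof.
move=> p1 c0 nu0 H0 HF fF ha hm.
have e0 : 0 < nu / 4 by rewrite divr_gt0.
have key : - \sum_i (aw i - fx i) * d i <= nu / 2 * (\sum_i `|d i| `^ p i) +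
    (\sum_i young_cst (nu / 4) (p i) * (c `^ (1 - (p i)^-1)^-1 + 1)) * F.
  rewrite -sumrN mulr_sumr mulr_suml -big_split/=; apply: ler_sum => i _.
  have y1 := young_eps (mulr_ge0 (ltW c0) (powR_ge0 H (1 - (p i)^-1))) (normr_ge0 (d i)) e0 (p1 i).
  have y2 := young_eps (normr_ge0 (fx i)) (normr_ge0 (d i)) e0 (p1 i).
  rewrite (powRM _ (ltW c0) (powR_ge0 _ _)) powR_conj_ge0// in y1.
  have y0 : 0 <= young_cst (nu / 4) (p i) by exact: powR_ge0.
  have y3 : `|aw i| * `|d i| <= c * H `^ (1 - (p i)^-1) * `|d i| by exact: ler_wpM2r.
  have y4 : young_cst (nu / 4) (p i) * (c `^ (1 - (p i)^-1)^-1 * H) <= young_cst (nu / 4) (p i) * (c `^ (1 - (p i)^-1)^-1 * F).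
    by apply: ler_wpM2l => //; apply: ler_wpM2l => //; exact: powR_ge0.
  have y5 : young_cst (nu / 4) (p i) * (`|fx i| `^ (1 - (p i)^-1)^-1) <= young_cst (nu / 4) (p i) * F.
    exact: ler_wpM2l.
  have y6 : - ((aw i - fx i) * d i) <= `|aw i| * `|d i| + `|fx i| * `|d i|.
    rewrite -mulrDl; apply: le_trans (ler_norm _) _; rewrite normrN normrM ler_wpM2r//.
    exact: ler_normB.
  apply: (le_trans y6); lra.
have -> : \sum_i (az i - fx i) * d i = \sum_i (az i - aw i) * d i + \sum_i (aw i - fx i) * d i.
  by rewrite -big_split/=; apply: eq_bigr => i _; ring.
move: hm key; set A := \sum_i (_ - _) * _; set S := \sum_i _ `^ _; set B := \sum_i (aw i - _) * _; lra.
Qed.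

(** Used for the integrable lower bound in [le_Rintegral_ae]. *)
Lemma growth_bound m (p : 'I_m -> R) (c H : R) (az d : 'I_m -> R) :
  (forall i, 1 < p i) -> 0 < c -> 0 <= H -> (forall i, `|az i| <= c * H `^ (1 - (p i)^-1)) ->
  `|\sum_i az i * d i| <= c * \sum_i (young_cst 1 (p i) * H + `|d i| `^ p i).
Proof.
move=> p1 c0 H0 ha; apply: le_trans (ler_norm_sum _ _ _) _; rewrite mulr_sumr; apply: ler_sum => i _.
rewrite normrM; apply: le_trans (ler_wpM2r (normr_ge0 _) (ha i)) _; rewrite -mulrA ler_wpM2l ?(ltW c0)//.
have := young_eps (powR_ge0 H (1 - (p i)^-1)) (normr_ge0 (d i)) ltr01 (p1 i).
by rewrite powR_conj_ge0// mul1r.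
Qed.

Lemma trunc_ge0 (L s : R) : 0 <= s -> 0 <= trunc L s <= s.
Proof.
move=> s0; have /andP[f0 f1] := flat0_le1 (level L s).
by rewrite /trunc mulr_ge0//= -[leRHS]mulr1 ler_wpM2l.
Qed.

Lemma trunc_le0 (L s : R) : s <= 0 -> trunc L s <= 0.
Proof. by move=> s0; rewrite /trunc mulr_le0_ge0// flat_ge0. Qed.

End coercivity.

(** * Operations in L^p and in anisotropic Sobolev spaces *)
Section Lp_calculus.
Context {R : realType} {n : nat}.
Local Notation Rn := 'rV[R]_n.
Local Notation mu := (leb R n).
Variable Omega : set (leb_rV R n).
Hypothesis mO : measurable Omega.

Lemma leb_bounded : bounded_set (Omega : set Rn) -> (mu Omega < +oo)%E.
Proof.
move=> [M [_ /(_ (M + 1))]]; rewrite ltrDl ltr01 => /(_ isT) hM.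
apply: (@le_lt_trans _ _ (mu (cbox (const_mx (- (M + 1))) (const_mx (M + 1))))); last exact: leb_cbox.
apply: le_measure.
- by rewrite inE.
- by rewrite inE; apply: measurable_leb; exact: measurable_cbox.
- by move=> x /hM; exact: cbox_norm.
Qed.

Lemma measurable_powR_abs (f : Rn -> R) r : measurable_fun Omega f ->
  measurable_fun Omega (fun x => `|f x| `^ r).
Proof.
move=> mf; apply: (measurableT_comp (measurable_powR r)).
exact: (measurableT_comp (@normr_measurable R setT)).
Qed.

Lemma Lp_measurable r f : 0 < r -> Lp Omega r f -> measurable_fun Omega f.
Proof. by move=> r0 /(LpP mO _ r0)[]. Qed.

Lemma Lp_integral r f : 0 < r -> Lp Omega r f -> (\int[mu]_(x in Omega) (`|f x| `^ r)%:E < +oo)%E.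
Proof. by move=> r0 /(LpP mO _ r0)[]. Qed.

Lemma Lp_ae r f g : 0 < r -> measurable_fun Omega f -> Lp Omega r g ->
  {ae mu, forall x, Omega x -> f x = g x} -> Lp Omega r f.
Proof.
move=> r0 mf Lg fg; apply/(LpP mO _ r0); split; first exact: mf.
have mg := Lp_measurable r0 Lg.
rewrite (_ : \int[mu]_(x in Omega) _ = \int[mu]_(x in Omega) (`|g x| `^ r)%:E)%E; first exact: Lp_integral.
apply: ae_eq_integral.
- exact: mO.
- by apply/measurable_EFinP; exact: measurable_powR_abs.
- by apply/measurable_EFinP; exact: measurable_powR_abs.
- by apply: (ae_mono fg) => x /[apply] ->.
Qed.

Lemma Lp_bddM r f (h : Rn -> R) M : 0 < r -> Lp Omega r f -> measurable_fun Omega h ->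
  (forall x, `|h x| <= M) -> Lp Omega r (fun x => f x * h x).
Proof.
move=> r0 Lf mh hM; have mf := Lp_measurable r0 Lf.
have M0 : 0 <= M by apply: le_trans (hM 0).
apply/(LpP mO _ r0); split; first exact: measurable_funM.
apply: (@le_lt_trans _ _ ((M `^ r)%:E * \int[mu]_(x in Omega) (`|f x| `^ r)%:E)%E); last first.
  by apply: lte_mul_pinfty; rewrite ?lee_fin ?powR_ge0//; exact: Lp_integral.
have mfr : measurable_fun Omega (fun x => (`|f x| `^ r)%:E).
  by apply/measurable_EFinP; exact: measurable_powR_abs.
have f0 x : Omega x -> (0 <= (`|f x| `^ r)%:E)%E by rewrite lee_fin powR_ge0.
rewrite -(ge0_integralZl_EFin mu mO f0 mfr (powR_ge0 M r)).
apply: ge0_le_integral.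
- exact: mO.
- by move=> x _; rewrite lee_fin powR_ge0.
- by apply/measurable_EFinP; apply: measurable_powR_abs; exact: measurable_funM.
- exact: measurable_funeM.
- move=> x _; rewrite -EFinM lee_fin normrM powRM// mulrC ler_wpM2r ?powR_ge0//.
  by apply: ge0_ler_powR; rewrite ?nnegrE ?(ltW r0).
Qed.

Lemma Lp_lin r c f g : 0 < r -> Lp Omega r f -> Lp Omega r g -> Lp Omega r (fun x => f x + c * g x).
Proof.
move=> r0 Lf Lg; have mf := Lp_measurable r0 Lf.
have Lg' : Lp Omega r (fun x => g x * c) by apply: (@Lp_bddM _ _ _ `|c|).
have mg := Lp_measurable r0 Lg'.
under eq_fun do rewrite mulrC.
apply/(LpP mO _ r0); split; first exact: measurable_funD.
apply: (integral_powR_add mO (ltW r0)) => //; exact: Lp_integral.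
Qed.

Lemma Lp_le r t f : (mu Omega < +oo)%E -> 0 < t -> t <= r -> Lp Omega r f -> Lp Omega t f.
Proof.
move=> fO t0 tr Lf; have r0 := lt_le_trans t0 tr.
apply/(LpP mO _ t0); split; first exact: Lp_measurable Lf.
apply: (integrable_powR_le mO fO _ (ltW t0) tr); first exact: Lp_measurable Lf.
exact: Lp_integral.
Qed.

Lemma Lp_mul_integrable p f g : 1 < p -> Lp Omega (1 - p^-1)^-1 f -> Lp Omega p g ->
  mu.-integrable Omega (EFin \o (fun x => f x * g x)).
Proof.
move=> p1 Lf Lg; have p0 : 0 < p by exact: lt_trans p1.
have q0 : 0 < (1 - p^-1)^-1 by rewrite invr_gt0 subr_gt0 invf_lt1.
have mf := Lp_measurable q0 Lf; have mg := Lp_measurable p0 Lg.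
apply/integrableP; split; first by apply/measurable_EFinP; exact: measurable_funM.
have pq : (1 - p^-1)^-1^-1 + p^-1 = 1 by rewrite invrK subrK.
apply: le_lt_trans (hoelder_int mu mO mf mg q0 p0 pq) _.
apply: lte_mul_pinfty; rewrite ?poweR_ge0//.
  rewrite ge0_fin_numE ?poweR_ge0//; apply: poweR_lty; exact: Lp_integral.
by apply: poweR_lty; exact: Lp_integral.
Qed.

Lemma Lp_integrable r f : 0 < r -> Lp Omega r f -> mu.-integrable Omega (EFin \o (fun x => `|f x| `^ r)).
Proof.
move=> r0 Lf; apply/integrableP; split.
  by apply/measurable_EFinP; apply: measurable_powR_abs; exact: Lp_measurable Lf.
under eq_integral do rewrite gee0_abs ?lee_fin ?powR_ge0//.
exact: Lp_integral.
Qed.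

End Lp_calculus.

Section W1_calculus.
Context {R : realType} {n : nat}.
Local Notation Rn := 'rV[R]_n.
Local Notation mu := (leb R n).
Variable Omega : set (leb_rV R n).
Hypothesis oO : open (Omega : set Rn).
Let mO : measurable Omega.
Proof. by apply: measurable_leb; exact: open_measurable_rV. Qed.

Lemma measurable_wD k v : W11 Omega v -> measurable_fun Omega (wD Omega k v).
Proof. by move=> /(W11_wD oO k)[/(L1_measurable)]. Qed.

Lemma measurable_W11 v : W11 Omega v -> measurable_fun Omega v.
Proof. by move=> /(W11_L1 oO)/L1_measurable. Qed.

Lemma wD_ae k v w : W11 Omega v -> W11 Omega w ->
  {ae mu, forall x, Omega x -> v x = w x} ->
  {ae mu, forall x, Omega x -> wD Omega k v x = wD Omega k w x}.
Proof.
move=> Wv Ww vw; have [i1 h1] := W11_wD oO k Ww.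
apply: (wD_unique oO i1); apply: (weak_partial_ae oO (measurable_W11 Ww) (measurable_W11 Wv) _ h1).
by apply: (ae_mono vw) => x /[apply].
Qed.

Lemma W1_lin (r : 'I_n -> R) c v w : (forall k, 0 < r k) -> W1 Omega r v -> W1 Omega r w ->
  W1 Omega r (fun x => v x + c * w x).
Proof.
move=> r0 [Wv Lv] [Ww Lw]; have [Wl El] := W11_lin oO c Wv Ww.
split=> // k; apply: (Lp_ae mO (r0 k) (measurable_wD k Wl) _ (El k)).
exact: Lp_lin.
Qed.

Lemma W1_0_lin (r : 'I_n -> R) c v w : (forall k, 0 < r k) -> W1_0 Omega r v -> W1_0 Omega r w ->
  W1_0 Omega r (fun x => v x + c * w x).
Proof.
move=> r0 [Wv Lv] [Ww Lw]; split; first exact: W11_0_lin.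
by have [] := @W1_lin r c v w r0 (conj Wv.1 Lv) (conj Ww.1 Lw).
Qed.

Lemma W1_0_comp (r : 'I_n -> R) (G G' : R -> R) C w : (forall k, 0 < r k) ->
  (forall y : R, is_derive y 1 G (G' y)) ->
  continuous G' -> (forall y, `|G' y| <= C) -> G 0 = 0 ->
  (forall f : Rn -> R, smooth f -> smooth (G \o f)) -> W1_0 Omega r w ->
  W1_0 Omega r (G \o w).
Proof.
move=> r0 dG cG' G'C G0 sG [Ww Lw]; have [WG EG] := W11_0_comp oO dG cG' G'C G0 sG Ww.
split=> // k; apply: (Lp_ae mO (r0 k) (measurable_wD k WG.1) _ (EG k)).
apply: (Lp_bddM mO (r0 k) (Lw k) _ (fun x => G'C (w x))).
apply: (measurableT_comp (f := G')); first exact: continuous_measurable_fun.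
exact: measurable_W11 Ww.1.
Qed.

Lemma W1_0_le (r t : 'I_n -> R) w : (mu Omega < +oo)%E -> (forall k, 0 < t k) ->
  (forall k, t k <= r k) -> W1_0 Omega r w -> W1_0 Omega t w.
Proof. by move=> fO t0 tr [Ww Lw]; split=> // k; exact: Lp_le (Lw k). Qed.

End W1_calculus.

(** * The energy estimate for the obstacle problem *)
Section obstacle_energy.
Context {R : realType} {n : nat}.
Local Notation Rn := 'rV[R]_n.
Local Notation mu := (leb R n).
Variable Omega : set (leb_rV R n).
Hypothesis oO : open (Omega : set Rn).
Hypothesis fO : (mu Omega < +oo)%E.
Variables (p q : 'I_n -> R) (h : Rn -> R) (a : 'I_n -> Rn -> Rn -> R) (c nu : R)
  (theta : Rn -> R) (psi : Rn -> \bar R) (f : 'I_n -> Rn -> R) (u w0 w1 : Rn -> R).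
Hypotheses (p1 : forall k, 1 < p k) (pq : forall k, p k < q k).
Hypothesis h0 : {ae mu, forall x, Omega x -> 0 <= h x}.
Hypotheses (c0 : 0 < c) (nu0 : 0 < nu).
Hypothesis growth : {ae mu, forall x, Omega x -> forall (z : Rn) i,
  `|a i x z| <= c * (h x + \sum_(j < n) `|z ord0 j| `^ p j) `^ (1 - (p i)^-1)}.
Hypothesis monotone : {ae mu, forall x, Omega x -> forall z z' : Rn,
  nu * (\sum_(i < n) `|z ord0 i - z' ord0 i| `^ p i) <=
  \sum_(i < n) (a i x z - a i x z') * (z ord0 i - z' ord0 i)}.
Hypothesis h1 : Lp Omega 1 h.
Hypothesis fLp : forall i, Lp Omega (1 - (p i)^-1)^-1 (f i).
Hypothesis Wth : W1 Omega q theta.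
Hypothesis Ww0 : W1_0 Omega q w0.
Hypothesis Ww1 : W1_0 Omega p w1.
Hypothesis theta_star : {ae mu, forall x, Omega x ->
  Order.max (psi x) (theta x)%:E = ((theta x)%:E + (w0 x)%:E)%E}.
Hypothesis u_theta : {ae mu, forall x, Omega x -> (u x)%:E = ((theta x)%:E + (w1 x)%:E)%E}.
Hypothesis u_sol : obstacle_solution Omega p a f psi theta u.

Let mO : measurable Omega.
Proof. by apply: measurable_leb; exact: open_measurable_rV. Qed.

(** The excess u - theta_star, up to a null set.  The scalar factors here and in
Dts are those of [W11_lin]. *)
Let w x := w1 x + -1 * w0 x.
Let d k x := wD Omega k w x.
Let Dts k x := wD Omega k theta x + 1 * wD Omega k w0 x.
Let S x := \sum_(i < n) `|d i x| `^ p i.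
(** The function F of the energy estimate; the second term is built from the
gradient of theta_star = theta + w0. *)
Definition energy_bound x := `|h x| + \sum_(j < n) `|Dts j x| `^ p j +
  \sum_(i < n) `|f i x| `^ (1 - (p i)^-1)^-1.
Let F := energy_bound.

Let p0 k : 0 < p k. Proof. exact: lt_trans (p1 k). Qed.
Let q0 k : 0 < q k. Proof. exact: lt_trans (pq k). Qed.
Let p'0 k : 0 < (1 - (p k)^-1)^-1. Proof. by rewrite invr_gt0 subr_gt0 invf_lt1. Qed.

Let Wu : W1 Omega p u. Proof. by have [[]] := u_sol. Qed.

Let Ww0p : W1_0 Omega p w0.
Proof. by apply: (W1_0_le oO fO p0 _ Ww0) => k; exact: ltW. Qed.

Lemma W1_0_excess : W1_0 Omega p w.
Proof. exact: W1_0_lin. Qed.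

Let Ww := W1_0_excess.

(** u = theta_star + w almost everywhere. *)
Lemma wD_solution k : {ae mu, forall x, Omega x -> wD Omega k u x = Dts k x + d k x}.
Proof.
have [Wl El] := W11_lin oO 1 Wth.1 Ww1.1.1.
have [_ Ew] := W11_lin oO (-1) Ww1.1.1 Ww0.1.1.
have E1 : {ae mu, forall x, Omega x -> wD Omega k u x = wD Omega k (fun x => theta x + 1 * w1 x) x}.
  apply: wD_ae => //; first by have [] := Wu.
  by apply: (ae_mono u_theta) => x /[apply]; rewrite mul1r -EFinD => -[].
have E2 : {ae mu, forall x, Omega x -> wD Omega k u x = wD Omega k theta x + 1 * wD Omega k w1 x}.
  by apply: (ae_mono2 E1 (El k)) => x e1 e2 Ox; rewrite e1// e2.
apply: (ae_mono2 E2 (Ew k)) => x e2 e3 Ox.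
by rewrite e2// /d e3// /Dts; ring.
Qed.

Let tw L := trunc L \o w.
Let v L x := u x + -1 * tw L x.

Lemma W1_0_truncated_excess L : 0 < L -> W1_0 Omega p (tw L).
Proof.
move=> L0; apply: (@W1_0_comp _ _ _ oO p (trunc L) (trunc' L) 97 w p0).
- by move=> y; apply: is_derive_trunc; rewrite gt_eqF.
- exact: continuous_trunc'.
- by move=> y; exact: trunc'_le.
- by rewrite /trunc mul0r.
- by move=> g; exact: smooth_trunc.
- exact: Ww.
Qed.

Lemma wD_truncated_excess L k : 0 < L -> {ae mu, forall x, Omega x -> wD Omega k (tw L) x = d k x * trunc' L (w x)}.
Proof.
move=> L0; apply: (proj2 (@W11_0_comp _ _ _ oO (trunc L) (trunc' L) 97 w _ _ _ _ _ _)).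
- by move=> y; apply: is_derive_trunc; rewrite gt_eqF.
- exact: continuous_trunc'.
- by move=> y; exact: trunc'_le.
- by rewrite /trunc mul0r.
- by move=> g; exact: smooth_trunc.
- exact: Ww.1.
Qed.

Lemma wD_competitor L k : 0 < L ->
  {ae mu, forall x, Omega x -> wD Omega k (v L) x - wD Omega k u x = - (trunc' L (w x) * d k x)}.
Proof.
move=> L0; have [_ El] := W11_lin oO (-1) Wu.1 (W1_0_truncated_excess L0).1.1.
apply: (ae_mono2 (El k) (wD_truncated_excess k L0)) => x e1 e2 Ox.
by rewrite /v e1// e2//; ring.
Qed.

(** If w >= 0 then u - T_L(w) >= u - w = theta_star, and if w < 0 then
u - T_L(w) >= u; both lie above the obstacle. *)
Lemma competitor_admissible L : 0 < L -> obstacle_class Omega p psi theta (v L).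
Proof.
move=> L0; have Wt := W1_0_truncated_excess L0; have [[_ psi_u _] _] := u_sol; split.
- exact: (W1_lin oO (-1) p0 Wu (conj Wt.1.1 Wt.2)).
- have U : {ae mu, forall x, Omega x -> (psi x <= (u x)%:E)%E /\ (u x)%:E = ((theta x)%:E + (w1 x)%:E)%E}.
    by apply: (ae_mono2 psi_u u_theta) => x e1 e2 Ox; split; [exact: e1|exact: e2].
  apply: (ae_mono2 theta_star U) => x e1 e2 Ox.
  have [pu uE] := e2 Ox; have {e1}e1 := e1 Ox.
  rewrite -EFinD in uE; case: uE => uE.
  have [w0x|/ltW w0x] := leP 0 (w x).
    have pt : (psi x <= ((theta x)%:E + (w0 x)%:E))%E by rewrite -e1 le_max lexx.
    apply: (le_trans pt); rewrite -EFinD lee_fin /v uE /tw /=.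
    by have /andP[_] := trunc_ge0 L w0x; rewrite /w; lra.
  apply: (le_trans pu); rewrite lee_fin /v /tw /=.
  by have := trunc_le0 L w0x; lra.
- exists (fun x => w1 x + -1 * tw L x); first exact: (W1_0_lin oO (-1) p0 Ww1 Wt).
  apply: (ae_mono u_theta) => x /[apply]; rewrite -EFinD => -[uE].
  by rewrite /= /v uE -EFinD; congr (_%:E); ring.
Qed.

Lemma Lp_Dts k : Lp Omega (q k) (Dts k).
Proof. by apply: (Lp_lin mO 1 (q0 k)); [exact: Wth.2|exact: Ww0.2]. Qed.

Let LpDts k : Lp Omega (p k) (Dts k).
Proof. by apply: (Lp_le mO fO (p0 k) (ltW (pq k))); exact: Lp_Dts. Qed.

Let Lpd k : Lp Omega (p k) (d k). Proof. exact: Ww.2. Qed.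

Let Lpu k : Lp Omega (p k) (wD Omega k u). Proof. exact: Wu.2. Qed.

Let mh : measurable_fun Omega h. Proof. exact: Lp_measurable h1. Qed.

Let ih : mu.-integrable Omega (EFin \o (fun x => `|h x|)).
Proof. by have /(Lp1P mO)/integrable_abse := h1. Qed.

Let iS : mu.-integrable Omega (EFin \o S).
Proof.
rewrite (_ : EFin \o S = fun x => (\sum_(i < n) (`|d i x| `^ p i)%:E)%E); last first.
  by apply/funext => x; rewrite /= /S sumEFin.
apply: integrable_sum => [|i _]; [exact: mO|exact: (Lp_integrable mO (p0 i) (Lpd i))].
Qed.

Let iF : mu.-integrable Omega (EFin \o F).
Proof.
rewrite (_ : EFin \o F = fun x => ((`|h x|)%:E + \sum_(i < n) (`|Dts i x| `^ p i)%:E +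
   \sum_(i < n) (`|f i x| `^ (1 - (p i)^-1)^-1)%:E)%E); last first.
  by apply/funext => x; rewrite /= /F /energy_bound !sumEFin.
apply: integrableD => //; first apply: integrableD => //.
- by apply: integrable_sum => [|i _]; [exact: mO|exact: (Lp_integrable mO (p0 i) (LpDts i))].
- by apply: integrable_sum => [|i _]; [exact: mO|exact: (Lp_integrable mO (p'0 i) (fLp i))].
Qed.

Let mw : measurable_fun Omega w. Proof. exact: measurable_W11 Ww.1.1. Qed.

Let mtr L : measurable_fun Omega (fun x => trunc' L (w x)).
Proof.
apply: (measurableT_comp (f := trunc' L)) => //.
by apply: continuous_measurable_fun => y; exact: continuous_trunc'.
Qed.

Let itr L g : mu.-integrable Omega (EFin \o g) ->
  mu.-integrable Omega (EFin \o (fun x => trunc' L (w x) * g x)).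
Proof.
move=> ig; rewrite (_ : (fun x => _) = fun x => g x * trunc' L (w x)); last first.
  by apply/funext => x; rewrite mulrC.
by apply: (L1_bddM oO ig (mtr L)) => x; exact: trunc'_le.
Qed.

Let A L x := \sum_(i < n) a i x (wgrad Omega u x) * (wD Omega i (v L) x - wD Omega i u x).
Let B L x := \sum_(i < n) f i x * (wD Omega i (v L) x - wD Omega i u x).

Let CF := \sum_i young_cst (nu / 4) (p i) * (c `^ (1 - (p i)^-1)^-1 + 1).
Let G x := CF * F x - nu / 2 * S x.
Let V x := 97 * (c * \sum_i (young_cst 1 (p i) * (`|h x| + \sum_(j < n) `|wD Omega j u x| `^ p j) + `|d i x| `^ p i)).

Lemma energy_bound_ge0 x : 0 <= F x.
Proof. by rewrite /F /energy_bound !addr_ge0// sumr_ge0// => i _; rewrite powR_ge0. Qed.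

(** Since D_i v - D_i u = - T_L'(w) D_i w, the coercivity estimate becomes an upper
bound for the left side of the variational inequality. *)
Lemma structure_inequalities L : 0 < L -> {ae mu, forall x, Omega x ->
  - V x <= A L x /\ A L x <= B L x + trunc' L (w x) * G x}.
Proof.
move=> L0.
have H1 := ae_mono2 growth monotone (fun x e1 e2 => conj e1 e2).
have H2 := ae_mono2 H1 h0 (fun x e1 e2 => conj e1 e2).
have H3 := ae_mono2 (ae_forall_ord wD_solution) (ae_forall_ord (fun k => wD_competitor k L0)) (fun x e1 e2 => conj e1 e2).
apply: (ae_mono2 H2 H3) => x [[gr mn] hx] [e1 e2] Ox.
have {}gr := gr Ox; have {}mn := mn Ox; have {}hx := hx Ox.
set g := trunc' L (w x); have g0 : 0 <= g by exact: trunc'_ge0.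
have g97 : g <= 97 by have := trunc'_le L (w x); rewrite ger0_norm.
set Du := wgrad Omega u x.
have DuE j : Du ord0 j = wD Omega j u x by rewrite mxE.
pose Zx : Rn := \row_j Dts j x.
have ZE j : Zx ord0 j = Dts j x by rewrite mxE.
have AE : A L x = - g * \sum_i a i x Du * d i x.
  by rewrite mulr_sumr; apply: eq_bigr => i _; rewrite e2// -/g; ring.
have BE : B L x = - g * \sum_i f i x * d i x.
  by rewrite mulr_sumr; apply: eq_bigr => i _; rewrite e2// -/g; ring.
split.
  have H0 : 0 <= h x + \sum_(j < n) `|Du ord0 j| `^ p j.
    by rewrite addr_ge0// sumr_ge0// => j _; exact: powR_ge0.
  have := @growth_bound _ n p c _ (fun i => a i x Du) (fun i => d i x) p1 c0 H0 (gr Du).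
  have -> : \sum_(j < n) `|Du ord0 j| `^ p j = \sum_(j < n) `|wD Omega j u x| `^ p j.
    by apply: eq_bigr => j _; rewrite DuE.
  rewrite -(ger0_norm hx) => hb; rewrite AE /V lerNl mulNr opprK.
  apply: (@le_trans _ _ (97 * `|\sum_i a i x Du * d i x|)); last by rewrite ler_pM2l.
  apply: (le_trans (ler_norm _)); rewrite normrM (ger0_norm g0).
  exact: ler_wpM2r.
have H0 : 0 <= h x + \sum_(j < n) `|Zx ord0 j| `^ p j.
  by rewrite addr_ge0// sumr_ge0// => j _; exact: powR_ge0.
have HF : h x + \sum_(j < n) `|Zx ord0 j| `^ p j <= F x.
  rewrite /F /energy_bound (ger0_norm hx); under eq_bigr do rewrite ZE.
  by rewrite lerDl sumr_ge0// => j _; exact: powR_ge0.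
have fF i : `|f i x| `^ (1 - (p i)^-1)^-1 <= F x.
  rewrite /F /energy_bound [X in _ <= _ + X](bigD1 i)//= addrCA lerDl !addr_ge0// sumr_ge0// => j _; exact: powR_ge0.
have mn' : nu * (\sum_i `|d i x| `^ p i) <= \sum_i (a i x Du - a i x Zx) * d i x.
  have := mn Du Zx; have -> : \sum_(i < n) `|Du ord0 i - Zx ord0 i| `^ p i = \sum_i `|d i x| `^ p i.
    by apply: eq_bigr => i _; rewrite DuE ZE e1// addrC addKr.
  move=> /le_trans; apply; rewrite le_eqVlt; apply/orP; left; apply/eqP.
  by apply: eq_bigr => i _; rewrite DuE ZE e1// [Dts i x + _]addrC addrK.
have := @coercive_bound _ n p c nu _ (F x) (fun i => a i x Du) (fun i => a i x Zx)
   (fun i => f i x) (fun i => d i x) p1 c0 nu0 H0 HF fF (gr Zx) mn'.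
rewrite -/CF -/(S x) => hc.
have -> : A L x = B L x - g * \sum_i (a i x Du - f i x) * d i x.
  rewrite AE BE -[X in _ = X]opprK; under [X in _ = - - (_ - _ * X)]eq_bigr do rewrite mulrBl.
  by rewrite sumrB; ring.
rewrite lerD2l -mulrN; apply: ler_wpM2l => //; rewrite /G; lra.
Qed.

Let iB L : 0 < L -> mu.-integrable Omega (EFin \o B L).
Proof.
move=> L0; rewrite (_ : EFin \o B L = fun x => (\sum_(i < n) (f i x * (wD Omega i (v L) x + -1 * wD Omega i u x))%:E)%E); last first.
  by apply/funext => x; rewrite /= /B sumEFin; congr (_%:E); apply: eq_bigr => i _; rewrite mulN1r.
apply: integrable_sum => [|i _]; first exact: mO.
apply: (Lp_mul_integrable mO (p1 i) (fLp i)); apply: (Lp_lin mO (-1) (p0 i) _ (Lpu i)).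
by have [[_ h2] _ _] := competitor_admissible L0; exact: h2.
Qed.

Let iG : mu.-integrable Omega (EFin \o G).
Proof.
rewrite (_ : EFin \o G = (fun x => (CF%:E * (EFin \o F) x + (- (nu / 2))%:E * (EFin \o S) x)%E)); last first.
  by apply/funext => x; rewrite /= /G -mulNr.
by apply: integrableD => //; apply: integrableZl.
Qed.

Let iV : mu.-integrable Omega (EFin \o (fun x => - V x)).
Proof.
pose T x := \sum_i (young_cst 1 (p i) * (`|h x| + \sum_(j < n) `|wD Omega j u x| `^ p j) + `|d i x| `^ p i).
have iT : mu.-integrable Omega (EFin \o T).
  rewrite (_ : EFin \o T = fun x => (\sum_i ((young_cst 1 (p i))%:E * (`|h x|%:E + \sum_(j < n) (`|wD Omega j u x| `^ p j)%:E) + (`|d i x| `^ p i)%:E))%E); last first.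
    by apply/funext => x; rewrite /= /T -sumEFin; apply: eq_bigr => i _; rewrite sumEFin.
  apply: integrable_sum => [|i _]; first exact: mO.
  apply: integrableD; [exact: mO| |exact: (Lp_integrable mO (p0 i) (Lpd i))].
  apply: integrableZl; first exact: mO.
  apply: integrableD; [exact: mO|exact: ih|].
  by apply: integrable_sum => [|j _]; [exact: mO|exact: (Lp_integrable mO (p0 j) (Lpu j))].
rewrite (_ : EFin \o _ = (fun x => ((- (97 * c))%:E * (EFin \o T) x)%E)); last first.
  by apply/funext => x; rewrite /= /V -EFinM mulNr mulrA.
exact: integrableZl.
Qed.

(** The variational inequality says that the integral of B is at most that of A,
and A is at most B + T_L'(w) G; so the integral of T_L'(w) G is nonnegative. *)
Lemma obstacle_energy L : 0 < L ->
  (\int[mu]_(x in Omega) (trunc' L (w x) * S x)%:E <=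
   (2 * CF / nu)%:E * \int[mu]_(x in Omega) (trunc' L (w x) * F x)%:E)%E.
Proof.
move=> L0; have iGt := itr L iG.
have iU : mu.-integrable Omega (EFin \o (fun x => B L x + trunc' L (w x) * G x)).
  exact: (integrableD mO (iB L0) iGt).
have h2 := u_sol.2 _ (competitor_admissible L0).
have h3 := le_Rintegral_ae mO iU iV (structure_inequalities L0).
rewrite RintegralD// in h3; last exact: iB.
have h4 : 0 <= \int[mu]_(x in Omega) (trunc' L (w x) * G x).
  by have := le_trans h2 h3; rewrite lerDl.
have [iS' iF'] := (itr L iS, itr L iF).
have iZ k g : mu.-integrable Omega (EFin \o g) -> mu.-integrable Omega (EFin \o (fun x => k * g x)).
  by move=> ig; apply: (integrableZl mO k ig).
have h5 : \int[mu]_(x in Omega) (trunc' L (w x) * G x) =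
    CF * \int[mu]_(x in Omega) (trunc' L (w x) * F x) -
    nu / 2 * \int[mu]_(x in Omega) (trunc' L (w x) * S x).
  rewrite -!RintegralZl//.
  rewrite -RintegralB//.
  - by apply: eq_Rintegral => x _; rewrite /G; ring.
  - exact: iZ.
  - exact: iZ.
have fin g : mu.-integrable Omega (EFin \o g) ->
    (\int[mu]_(x in Omega) (g x)%:E)%E = (\int[mu]_(x in Omega) g x)%:E.
  by move=> ig; rewrite /Rintegral fineK//; exact: integrable_fin_num.
rewrite !fin// -EFinM lee_fin.
rewrite h5 subr_ge0 in h4.
by rewrite mulrAC ler_pdivlMr//; lra.
Qed.

End obstacle_energy.

(** * Arithmetic of the exponents *)
Section exponent_arithmetic.
Context {R : realType} {n : nat}.
Variables (p q : 'I_n.+2 -> R) (b : R).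
Hypotheses (p1 : forall k, 1 < p k) (pq : forall k, p k < q k).
Hypothesis hmean_lt : hmean p < n.+2%:R.
Let pm := fam_max p.
Let pbar := hmean p.
Let pstar := sobolev_exp n.+2 (hmean p).
Hypothesis b0 : 0 < b.
Hypothesis b_le : b <= fam_min (fun j => 1 - p j / q j) * fam_min (fun i => 1 - (p i)^-1).
Hypothesis b_lt : b < (pm - 1) / pm * (pbar / pstar).
Let sigma := \sum_(i < n.+2) (p i)^-1.
Let kappa := b * (pm / (pm - 1)).

Let p0 k : 0 < p k. Proof. exact: lt_trans (p1 k). Qed.
Let q0 k : 0 < q k. Proof. exact: lt_trans (pq k). Qed.

Lemma fam_max_ge m (r : 'I_m -> R) i : r i <= fam_max r.
Proof. exact: le_bigmax. Qed.

Lemma fam_min_le m (r : 'I_m -> R) i : fam_min r <= r i.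
Proof. exact: bigmin_le. Qed.

Lemma fam_max_attained : exists i, pm = p i.
Proof.
have /bigmax_geP[h|[i _ h]] := lexx pm.
  by have := lt_le_trans (p0 ord0) (le_trans (fam_max_ge p ord0) h); rewrite ltxx.
by exists i; apply/eqP; rewrite eq_le h fam_max_ge.
Qed.

Lemma pm_gt1 : 1 < pm.
Proof. by have [i ->] := fam_max_attained. Qed.

Lemma sigma_gt0 : 0 < sigma.
Proof.
rewrite /sigma big_ord_recl ltr_pwDl ?invr_gt0//.
by apply: sumr_ge0 => i _; rewrite invr_ge0 ltW.
Qed.

Lemma hmeanE : pbar = n.+2%:R / sigma.
Proof. by rewrite /pbar /hmean invfM invrK. Qed.

Lemma sigma_gt1 : 1 < sigma.
Proof.
have := hmean_lt; rewrite -/pbar hmeanE ltr_pdivrMr ?sigma_gt0//.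
by rewrite -[ltLHS]mulr1 ltr_pM2l.
Qed.

Let sn : sigma - 1 != 0. Proof. by rewrite gt_eqF// subr_gt0 sigma_gt1. Qed.
Let sn0 : sigma != 0. Proof. by rewrite gt_eqF// sigma_gt0. Qed.

Lemma sobolev_expE : pstar = n.+2%:R / (sigma - 1).
Proof.
rewrite /pstar /sobolev_exp -/pbar hmeanE.
have N0 : n.+2%:R != 0 :> R by rewrite pnatr_eq0.
move: N0; move: (n.+2%:R : R) => N N0.
have e : N - N / sigma = N * (sigma - 1) / sigma by field.
rewrite e; field.
by rewrite N0 sn0 sn.
Qed.

(** In terms of sigma = sum of the 1 / p_k one has pbar = n / sigma and
pstar = n / (sigma - 1). *)
Lemma pbar_pstar : pbar / pstar = (sigma - 1) / sigma.
Proof.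
rewrite sobolev_expE hmeanE.
have N0 : n.+2%:R != 0 :> R by rewrite pnatr_eq0.
by move: N0; move: (n.+2%:R : R) => N N0; field; rewrite N0 sn0 sn.
Qed.

Lemma kappa_gt0 : 0 < kappa.
Proof. by have := pm_gt1 => h; rewrite mulr_gt0// divr_gt0 ?subr_gt0// (lt_trans _ h). Qed.

(** p_m is one of the p_i, hence the second minimum in the condition on b is at
most 1 - 1 / p_m, which cancels the factor p_m / (p_m - 1) of kappa. *)
Lemma kappa_le j : kappa <= 1 - p j / q j.
Proof.
have pm1 := pm_gt1; have pm0 : 0 < pm by exact: lt_trans pm1.
rewrite /kappa mulrA ler_pdivrMr ?subr_gt0// -ler_pdivlMr// -mulrA.
apply: (le_trans b_le); have [i pmi] := fam_max_attained.
(* i is an index at which the maximum p_m is attained. *)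
have e : (pm - 1) / pm = 1 - (p i)^-1 by rewrite pmi mulrBl mul1r divff// gt_eqF.
rewrite e; apply: ler_pM; rewrite ?fam_min_le//.
- apply/bigmin_geP; split=> // k _.
  by rewrite subr_ge0 ler_pdivrMr// mul1r ltW.
- apply/bigmin_geP; split=> // k _.
  by rewrite subr_ge0 invf_le1// ltW.
Qed.

Lemma kappa_lt1 : kappa < 1.
Proof. by apply: le_lt_trans (kappa_le ord0) _; rewrite gtrBl divr_gt0. Qed.

Lemma kappa_sigma_lt1 : kappa * (sigma / (sigma - 1)) < 1.
Proof.
have pm1 := pm_gt1; have pm0 : 0 < pm by exact: lt_trans pm1.
have := b_lt; rewrite pbar_pstar.
have c0 : 0 < pm / (pm - 1) * (sigma / (sigma - 1)).
  by rewrite mulr_gt0// divr_gt0 ?subr_gt0 ?sigma_gt1 ?sigma_gt0.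
rewrite -(ltr_pM2r c0) mulrA => /lt_le_trans; apply.
rewrite le_eqVlt; apply/orP; left; apply/eqP; field.
by rewrite sn0 sn !gt_eqF// subr_gt0.
Qed.

Lemma target_exponentE : pstar / (1 - b * pstar / pbar * (pm / (pm - 1))) =
  n.+2%:R / (sigma - 1) / (1 - kappa * (sigma / (sigma - 1))).
Proof.
rewrite sobolev_expE; congr (_ / (1 - _)); rewrite -sobolev_expE /kappa.
have -> : b * pstar / pbar = b * (sigma / (sigma - 1)).
  by rewrite -mulrA -[pstar / pbar]invf_div pbar_pstar invf_div.
by rewrite mulrAC.
Qed.

Lemma target_exponent_gt : pstar < pstar / (1 - b * pstar / pbar * (pm / (pm - 1))).
Proof.
rewrite target_exponentE -sobolev_expE.
have s0 : 0 < pstar by rewrite sobolev_expE divr_gt0// subr_gt0 sigma_gt1.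
have k1 := kappa_sigma_lt1.
have k0 : 0 < kappa * (sigma / (sigma - 1)).
  by rewrite mulr_gt0 ?kappa_gt0// divr_gt0 ?sigma_gt0// subr_gt0 sigma_gt1.
by rewrite ltr_pdivlMr ?subr_gt0// -[ltRHS]mulr1 ltr_pM2l// gtrBl.
Qed.

(** This bound and the next two place the terms of F in L^{1 / (1 - kappa)}. *)
Lemma integrability_h : (1 - kappa)^-1 <= fam_max (fun k => q k / p k).
Proof.
apply: le_trans (fam_max_ge _ ord0); rewrite -[leRHS]invf_div lef_pV2 ?posrE ?subr_gt0 ?kappa_lt1 ?divr_gt0//.
by have := kappa_le ord0; lra.
Qed.

Lemma integrability_grad j : p j * (1 - kappa)^-1 <= q j.
Proof.
rewrite ler_pdivrMr ?subr_gt0 ?kappa_lt1// -ler_pdivrMl// mulrC.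
by have := kappa_le j; lra.
Qed.

Lemma data_exponent_gt0 i : 0 < p i - 1 - b * p i.
Proof.
have h : b < 1 - (p i)^-1.
  apply: (le_lt_trans b_le).
  have i0 : 0 < 1 - (p i)^-1 by rewrite subr_gt0 invf_lt1.
  apply: (@le_lt_trans _ _ ((1 - p i / q i) * (1 - (p i)^-1))).
    apply: ler_pM; rewrite ?fam_min_le//.
    - apply/bigmin_geP; split=> // k _.
      by rewrite subr_ge0 ler_pdivrMr// mul1r ltW.
    - apply/bigmin_geP; split=> // k _.
      by rewrite subr_ge0 invf_le1// ltW.
  by rewrite -[ltRHS]mul1r ltr_pM2r// gtrBl divr_gt0.
have := h; rewrite -(ltr_pM2r (p0 i)) mulrBl mul1r mulVf ?gt_eqF//; lra.
Qed.

(** With p' the exponent conjugate to p_i, the exponent of the data is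
p' / (1 - b p'), and kappa <= b p' because p_i <= p_m. *)
Lemma integrability_data i :
  (1 - (p i)^-1)^-1 * (1 - kappa)^-1 <= p i / (p i - 1 - b * p i).
Proof.
have d0 := data_exponent_gt0 i; have pm1 := pm_gt1; have pi0 := p0 i.
have -> : p i / (p i - 1 - b * p i) = ((1 - (p i)^-1) * (1 - b * (p i / (p i - 1))))^-1.
  by field; rewrite !gt_eqF// ?subr_gt0//; lra.
have pi1 : 0 < p i - 1 by rewrite subr_gt0.
have kb : kappa <= b * (p i / (p i - 1)).
  rewrite /kappa ler_pM2l// ler_pdivrMr ?subr_gt0// mulrAC ler_pdivlMr//.
  by have := fam_max_ge p i; rewrite -/pm; lra.
have h1 : 0 < 1 - b * (p i / (p i - 1)).
  by rewrite subr_gt0 mulrA ltr_pdivrMr// mul1r; lra.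
have i0 : 0 < 1 - (p i)^-1 by rewrite subr_gt0 invf_lt1.
rewrite -invfM lef_pV2 ?posrE ?mulr_gt0// ?subr_gt0 ?kappa_lt1//.
by rewrite ler_pM2l//; lra.
Qed.

End exponent_arithmetic.

(** * Proof of the theorem *)
Section excess_estimates.
Context {R : realType} {n : nat}.
Local Notation Rn := 'rV[R]_n.+2.
Local Notation mu := (leb R n.+2).
Variable Omega : set (leb_rV R n.+2).
Hypothesis oO : open (Omega : set Rn).
Hypothesis fO : (mu Omega < +oo)%E.
Let mO : measurable Omega.
Proof. by apply: measurable_leb; exact: open_measurable_rV. Qed.

Lemma Lp_powR_integral s r (g : Rn -> R) : 0 < s -> 0 < r -> Lp Omega (s * r) g ->
  (\int[mu]_(x in Omega) (`| `|g x| `^ s | `^ r)%:E < +oo)%E.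
Proof.
move=> s0 r0 Lg; have := Lp_integral mO (mulr_gt0 s0 r0) Lg.
by under [in X in _ -> X]eq_integral do rewrite (ger0_norm (powR_ge0 _ _)) -powRrM.
Qed.

Lemma energy_bound_integral (p : 'I_n.+2 -> R) r h theta (f : 'I_n.+2 -> Rn -> R) w0 :
  (forall k, 1 < p k) -> 0 < r -> Lp Omega r h ->
  (forall k, Lp Omega (p k * r) (fun x => wD Omega k theta x + 1 * wD Omega k w0 x)) ->
  (forall k, Lp Omega ((1 - (p k)^-1)^-1 * r) (f k)) ->
  measurable_fun Omega (energy_bound Omega p h theta f w0) /\
  (\int[mu]_(x in Omega) (energy_bound Omega p h theta f w0 x `^ r)%:E < +oo)%E.
Proof.
move=> p1 r0 Lh LZ Lf.
have p0 k : 0 < p k by exact: lt_trans (p1 k).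
have p'0 k : 0 < (1 - (p k)^-1)^-1 by rewrite invr_gt0 subr_gt0 invf_lt1.
have m1 : measurable_fun Omega (fun x => `|h x|).
  by apply: (measurableT_comp (@normr_measurable R setT)); exact: Lp_measurable Lh.
have m2 k : measurable_fun Omega (fun x => `|wD Omega k theta x + 1 * wD Omega k w0 x| `^ p k).
  by apply: measurable_powR_abs; exact: Lp_measurable (mulr_gt0 (p0 k) r0) (LZ k).
have m3 k : measurable_fun Omega (fun x => `|f k x| `^ (1 - (p k)^-1)^-1).
  by apply: measurable_powR_abs; exact: Lp_measurable (mulr_gt0 (p'0 k) r0) (Lf k).
have m4 : measurable_fun Omega (fun x => \sum_(k < n.+2) `|wD Omega k theta x + 1 * wD Omega k w0 x| `^ p k).
  exact: measurable_sum.
have m5 : measurable_fun Omega (fun x => \sum_(k < n.+2) `|f k x| `^ (1 - (p k)^-1)^-1).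
  exact: measurable_sum.
have m12 := measurable_funD m1 m4.
split; first exact: (measurable_funD m12 m5).
rewrite (_ : \int[mu]_(x in Omega) _ = \int[mu]_(x in Omega) (`|energy_bound Omega p h theta f w0 x| `^ r)%:E)%E; last first.
  by apply: eq_integral => x _; rewrite ger0_norm// energy_bound_ge0.
apply: (integral_powR_add mO (ltW r0) m12 m5).
- apply: (integral_powR_add mO (ltW r0) m1 m4).
    under eq_integral do rewrite normr_id.
    exact: (Lp_integral mO r0 Lh).
  apply: (integral_powR_sum mO r0 m2) => k.
  exact: (Lp_powR_integral (p0 k) r0 (LZ k)).
- apply: (integral_powR_sum mO r0 m3) => k.
  exact: (Lp_powR_integral (p'0 k) r0 (Lf k)).
Qed.

(** The chain rule turns the weak derivatives of the cutoffs of w into multiples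
of those of w. *)
Lemma gagliardo_cutoff (w : Rn -> R) (g : 'I_n.+2 -> R) L : 0 < L -> (forall i, 1 <= g i) ->
  W11_0 Omega w ->
  (\int[mu]_(x in Omega) (\prod_(i < n.+2) `|cutoff L (g i) (w x)|%:E) `^ (n.+1%:R^-1) <=
   (\prod_(i < n.+2) \int[mu]_(x in Omega) `|cutoff' L (g i) (w x) * wD Omega i w x|%:E) `^ (n.+1%:R^-1))%E.
Proof.
move=> L0 g1 Ww; have g0 i : 0 < g i by exact: lt_le_trans (g1 i).
have H i : W11_0 Omega (cutoff L (g i) \o w) /\ forall k,
    {ae mu, forall x, Omega x -> wD Omega k (cutoff L (g i) \o w) x = wD Omega k w x * cutoff' L (g i) (w x)}.
  apply: (@W11_0_comp _ _ _ oO (cutoff L (g i)) (cutoff' L (g i)) (96 * g i / L) w).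
  - by move=> y; apply: is_derive_cutoff; rewrite gt_eqF.
  - exact: continuous_cutoff'.
  - by move=> y; exact: cutoff'_le_cst.
  - exact: cutoff0.
  - by move=> f; exact: smooth_cutoff.
  - exact: Ww.
apply: (le_trans (W11_0_gagliardo oO (fun i => (H i).1))).
rewrite le_eqVlt; apply/orP; left; apply/eqP; congr (_ `^ _)%E.
apply: eq_bigr => i _; apply: ae_eq_integral.
- exact: mO.
- by apply: (measurable_abs (L1_measurable (W11_wD oO i (H i).1.1).1)).
- apply: measurable_abs; apply: measurable_funM; last exact: measurable_wD Ww.1.
  apply: (measurableT_comp (f := cutoff' L (g i))); last exact: measurable_W11 Ww.1.
  by apply: continuous_measurable_fun => y; exact: continuous_cutoff'.
- by apply: (ae_mono ((H i).2 i)) => x /[apply] ->; rewrite mulrC.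
Qed.

End excess_estimates.

Theorem theorem1p1 (R : realType) (n : nat) (Omega : set 'rV[R]_n)
    (p q : 'I_n -> R) (h : 'rV[R]_n -> R)
    (a : 'I_n -> 'rV[R]_n -> 'rV[R]_n -> R) (c1 nu : R)
    (theta : 'rV[R]_n -> R) (psi : 'rV[R]_n -> \bar R)
    (b : R) (f : 'I_n -> 'rV[R]_n -> R) (u : 'rV[R]_n -> R)
    (n_ge2 : (2 <= n)%N)
    (Omega_open : open Omega) (Omega_bounded : bounded_set Omega)
    (p_gt1 : forall k, 1 < p k) (q_gtp : forall k, p k < q k)
    (hmean_ltn : hmean p < n%:R)
    (h_ge0 : {ae leb R n, forall x, Omega x -> 0 <= h x})
    (h_Lp : Lp Omega (fam_max (fun k => q k / p k)) h)
    (a_cara : forall i, caratheodory_fun Omega (a i))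
    (c1_gt0 : 0 < c1) (nu_gt0 : 0 < nu)
    (a_growth : {ae leb R n, forall x, Omega x -> forall (z : 'rV[R]_n) i,
       `|a i x z| <=
         c1 * (h x + \sum_(j < n) `|z ord0 j| `^ p j) `^ (1 - (p i)^-1)})
    (a_monotone : {ae leb R n, forall x, Omega x -> forall z z' : 'rV[R]_n,
       nu * (\sum_(i < n) `|z ord0 i - z' ord0 i| `^ p i) <=
         \sum_(i < n) (a i x z - a i x z') * (z ord0 i - z' ord0 i)})
    (theta_W1 : W1 Omega q theta)
    (theta_star := fun x => Order.max (psi x) (theta x)%:E)
    (theta_star_W1_0 :
       in_translate Omega theta_star (EFin \o theta) (W1_0 Omega q))
    (pm := fam_max p) (pbar := hmean p) (pstar := sobolev_exp n (hmean p))
    (b_gt0 : 0 < b)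
    (b_le : b <= fam_min (fun j => 1 - p j / q j) * fam_min (fun i => 1 - (p i)^-1))
    (b_lt : b < (pm - 1) / pm * (pbar / pstar))
    (f_Lp : forall i, Lp Omega (p i / (p i - 1 - b * p i)) (f i))
    (t := pstar / (1 - b * pstar / pbar * (pm / (pm - 1))))
    (u_sol : obstacle_solution Omega p a f psi theta u) :
  pstar < t /\ in_translate Omega (EFin \o u) theta_star (weak_Lp Omega t).
Proof.
destruct n as [|[|n']]; [by []|by []|].
have fO : (leb R n'.+2 Omega < +oo)%E.
  apply: leb_bounded Omega_bounded.
  by apply: measurable_leb; exact: open_measurable_rV.
have mO : measurable (Omega : set (leb_rV R n'.+2)).
  by apply: measurable_leb; exact: open_measurable_rV.
split; first exact: (target_exponent_gt p_gt1 hmean_ltn b_gt0 b_lt).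
pose kappa := b * (pm / (pm - 1)).
have k0 : 0 < kappa by exact: kappa_gt0.
have k1 : kappa < 1 by exact: (kappa_lt1 p_gt1 q_gtp b_le).
(* r is the exponent of integrability of the bound F. *)
pose r := (1 - kappa)^-1.
have r0 : 0 < r by rewrite invr_gt0 subr_gt0.
have r1 : 1 <= r by rewrite invf_ge1 ?subr_gt0// gerBl ltW.
have p0 k : 0 < p k by exact: lt_trans (p_gt1 k).
have p'0 k : 0 < (1 - (p k)^-1)^-1 by rewrite invr_gt0 subr_gt0 invf_lt1.
have [w0 Ww0 w0E] := theta_star_W1_0.
have [_ _ [w1 Ww1 w1E]] := u_sol.1.
pose w x := w1 x + -1 * w0 x.
have Ww : W1_0 Omega p w := W1_0_excess Omega_open fO p_gt1 q_gtp Ww0 Ww1.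
have Lh : Lp Omega r h.
  by apply: (Lp_le mO fO r0 _ h_Lp); exact: (integrability_h p_gt1 q_gtp b_le).
have Lf k : Lp Omega ((1 - (p k)^-1)^-1 * r) (f k).
  apply: (Lp_le mO fO _ _ (f_Lp k)); first by rewrite mulr_gt0.
  exact: (integrability_data p_gt1 q_gtp b_gt0 b_le).
have LZ k : Lp Omega (p k * r) (fun x => wD Omega k theta x + 1 * wD Omega k w0 x).
  apply: (Lp_le mO fO _ _ (Lp_Dts Omega_open p_gt1 q_gtp theta_W1 Ww0 k)); first by rewrite mulr_gt0.
  exact: (integrability_grad p_gt1 q_gtp b_le).
have [mF iF] := energy_bound_integral Omega_open p_gt1 r0 Lh LZ Lf.
have Lh1 : Lp Omega 1 h by exact: (Lp_le mO fO ltr01 r1 Lh).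
have Lf1 k : Lp Omega (1 - (p k)^-1)^-1 (f k).
  by apply: (Lp_le mO fO (p'0 k) _ (Lf k)); rewrite ler_peMr// ltW.
have s1 := sigma_gt1 p_gt1 hmean_ltn.
have mw : measurable_fun (Omega : set (leb_rV R n'.+2)) (w : leb_rV R n'.+2 -> R).
  exact: (measurable_W11 Omega_open Ww.1.1).
pose C := 2 * (\sum_i young_cst (nu / 4) (p i) * (c1 `^ (1 - (p i)^-1)^-1 + 1)) / nu.
have C0 : 0 <= C.
  rewrite divr_ge0 ?(ltW nu_gt0)// mulr_ge0// sumr_ge0// => i _.
  by rewrite mulr_ge0 ?addr_ge0 ?powR_ge0.
have [K K0 hK] := @superlevel_decay _ _ R (leb R n'.+2) Omega mO fO n' p w
  (fun k => wD Omega k w) (energy_bound Omega p h theta f w0) p_gt1 mw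
  (fun k => measurable_wD Omega_open k Ww.1.1)
  (fun k => Lp_integral mO (p0 k) (Ww.2 k)) s1
  (fun L L0 => gagliardo_cutoff Omega_open L0 (gam_ge1 p_gt1 s1) Ww.1)
  kappa C (introT andP (conj k0 k1))
  (kappa_sigma_lt1 p_gt1 hmean_ltn b_lt) C0 mF (@energy_bound_ge0 _ _ _ _ _ _ _ _) iF
  (fun L L0 => obstacle_energy Omega_open fO p_gt1 q_gtp h_ge0 c1_gt0 nu_gt0 a_growth
     a_monotone Lh1 Lf1 theta_W1 Ww0 Ww1 w0E w1E u_sol L0).
exists w; last first.
  apply: (ae_mono2 w0E w1E) => x e0 e1 Ox.
  by rewrite e0// e1// -!EFinD /w /=; congr (_%:E); ring.
split; first exact: mw.
exists K => // s s0; rewrite /t (target_exponentE b p_gt1 hmean_ltn).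
rewrite -[X in (X <= _)%E](tail_measureE mO fO mw s) lee_fin.
exact: hK.
Qed.
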